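(* Let $T$ be a singular integral operator of type $\kappa\in(0,1]$ on $\mathbb R^n$ and $\tilde T$ its modified version. Let $p\in(1,\infty)$, $u\in(0,\infty]$, $\Theta\in\Theta_*$, and let $$w(r)=r^{-\sigma}\Theta(r^{\tau}),\qquad \sigma,\tau\in(0,\infty)\ \text{with}\ \sigma>\tau.$$ If $-n/p+\sigma<\kappa$ and $\lambda\in[-n/p,\kappa-\sigma)$, then $\tilde T$ can be extended to a bounded operator on $B_w^u(\mathcal L_{p,\lambda})(\mathbb R^n)$ and on $\dot B_w^u(\mathcal L_{p,\lambda})(\mathbb R^n)$. Moreover, if $\sigma<\kappa$ and $\lambda\in[0,\kappa-\sigma)$, then $\tilde T$ can also be extended to a bounded operator on $B_w^u(\mathcal L_{1,\lambda})(\mathbb R^n)$ and on $\dot B_w^u(\mathcal L_{1,\lambda})(\mathbb R^n)$.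
   Context: For $r>0$, $Q_r\subset\mathbb R^n$ is the open cube $\{y:\max_i|y_i|<r\}$ (for all $r$), or the open ball $\{y:|y|<r\}$ (for all $r$); $Q(x,s)=x+Q_s$; $\chi_1$ is the characteristic function of $Q_1$; $f_G=\frac1{|G|}\int_G f$. For $U=\mathbb R^n$ or $U=Q_r$, the Campanato space $\mathcal L_{p,\lambda}(U)$ consists of all $f$ with $\|f\|_{\mathcal L_{p,\lambda}(U)}=\sup_{Q(x,s)\subset U}s^{-\lambda}\big(\frac1{|Q(x,s)|}\int_{Q(x,s)}|f-f_{Q(x,s)}|^p\big)^{1/p}<\infty$, regarded as a space of functions modulo constants. For $E=\mathcal L_{p,\lambda}$, $w:(0,\infty)\to(0,\infty)$ and $u\in(0,\infty]$, $B_w^u(E)(\mathbb R^n)$ and $\dot B_w^u(E)(\mathbb R^n)$ are the sets of measurable $f$ on $\mathbb R^n$ with $f|_{Q_r}\in E(Q_r)$ for all $r>0$ and, respectively, $\|f\|_{B_w^u(E)}=\big\|w(r)\|f\|_{E(Q_r)}\big\|_{L^u([1,\infty),dr/r)}<\infty$, $\|f\|_{\dot B_w^u(E)}=\big\|w(r)\|f\|_{E(Q_r)}\big\|_{L^u((0,\infty),dr/r)}<\infty$. $\Theta_*$ is the set of functions $\Theta:(0,\infty)\to(0,\infty)$ such that for some $C\in(0,\infty)$ and $\epsilon,\epsilon'\in(0,1)$, $\Theta(tr)/\Theta(r)\le C\max(t^{\epsilon},t^{\epsilon'})$ for all $r,t>0$. $T$ is a singular integral operator of type $\kappa$ if its kernel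 $K(x,y)$ satisfies, with $C$ independent of $x,y,z\in\mathbb R^n$: $|K(x,y)|\le C|x-y|^{-n}$ for $x\ne y$; $|K(x,y)-K(z,y)|+|K(y,x)-K(y,z)|\le\frac{C}{|x-y|^n}\big(\frac{|x-z|}{|x-y|}\big)^\kappa$ for $|x-y|\ge2|x-z|$; $\int_{r\le|x-y|<R}K(x,y)\,dy=\int_{r\le|x-y|<R}K(y,x)\,dy=0$ for $0<r<R<\infty$ and $x\in\mathbb R^n$; and, setting $T_\eta f(x)=\int_{|x-y|\ge\eta}K(x,y)f(y)\,dy$, for every $p\in(1,\infty)$ there is $C_p>0$ with $\|T_\eta f\|_p\le C_p\|f\|_p$ for all $\eta>0$ and compactly supported $f\in L^p$, and $Tf=\lim_{\eta\to0}T_\eta f$ exists in $L^p(\mathbb R^n)$. The modified version is $\tilde Tf=\lim_{\eta\to0}\tilde T_\eta f$, where $\tilde T_\eta f(x)=\int_{|x-y|\ge\eta}[K(x,y)-K(0,y)(1-\chi_1(y))]f(y)\,dy$; for $f\in\mathcal L_{p,\lambda}(\mathbb R^n)$ with $p\in(1,\infty)$, $\lambda\in[-n/p,1)$, the integral converges absolutely and the limit exists in $L^p(Q)$ for each $Q=Q(x,s)$. *)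

(* Defs.v *)
From HB Require Import structures.
From mathcomp Require Import all_boot all_order all_algebra.
From mathcomp Require Import all_classical all_reals all_analysis ess_sup_inf.

Set Implicit Arguments.
Unset Strict Implicit.
Unset Printing Implicit Defensive.

Import Order.TTheory GRing.Theory Num.Theory.
Import numFieldNormedType.Exports.

Local Open Scope classical_set_scope.
Local Open Scope ring_scope.

(** * Lebesgue measure on [R^n]

    ['rV[R]_n] carries the product sigma-algebra (as the library's
    [n.-tuple R] does); the measure is built by adding one coordinate at a
    time, and [lebesgue_rV_box] characterises it. *)

Section measurable_rV.
Context (R : realType) (n : nat).

Definition rV_coord (i : 'I_n) (x : 'rV[R]_n) : R := x 0 i.

Let rV_set0 : g_sigma_preimage rV_coord set0.
Proof. exact: sigma_algebra0. Qed.

Let rV_setC A : g_sigma_preimage rV_coord A -> g_sigma_preimage rV_coord (~` A).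
Proof. exact: sigma_algebraC. Qed.

Let rV_bigcup (F : (set 'rV[R]_n)^nat) :
  (forall i, g_sigma_preimage rV_coord (F i)) ->
  g_sigma_preimage rV_coord (\bigcup_i F i).
Proof. exact: sigma_algebra_bigcup. Qed.

HB.instance Definition _ := @isMeasurable.Build default_measure_display
  'rV[R]_n (g_sigma_preimage rV_coord) rV_set0 rV_setC rV_bigcup.

Lemma measurable_rV_coord (i : 'I_n) :
  measurable_fun [set: 'rV[R]_n] (rV_coord i).
Proof.
move=> _ Y mY; rewrite setTI; apply: sub_sigma_algebra => /=.
rewrite -bigcup_seq/=; exists i => /=; first by rewrite mem_index_enum.
by exists Y => //; rewrite setTI.
Qed.

Lemma measurable_fun_rV d (T : measurableType d) (f : T -> 'rV[R]_n) :
  (forall i, measurable_fun [set: T] (rV_coord i \o f)) ->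
  measurable_fun [set: T] f.
Proof.
move=> mf.
suff : g_sigma_preimage (fun i => rV_coord i \o f) `<=` measurable.
  rewrite g_sigma_preimage_comp => sub _ A mA.
  by apply: sub; exists A.
apply: smallest_sub; first exact: sigma_algebra_measurable.
rewrite -bigcup_seq; apply: bigcup_sub => i _ A [B mB <-].
exact: mf.
Qed.

End measurable_rV.

Section lebesgue_rV.
Context (R : realType).
Local Notation leb := (@lebesgue_measure R).

Definition rV_cons n (z : 'rV[R]_n * measurableTypeR R) : 'rV[R]_n.+1 :=
  \row_i oapp (fun j => z.1 0 j) z.2 (unlift ord0 i).

Lemma measurable_rV_cons n : measurable_fun setT (@rV_cons n).
Proof.
apply: measurable_fun_rV => i; case: (unliftP ord0 i) => [j|] ->.
- rewrite (_ : _ \o _ = @rV_coord R n j \o fst); last first.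
    by apply/funext => z /=; rewrite /rV_coord mxE liftK.
  by apply: measurableT_comp => //; exact: measurable_rV_coord.
- rewrite (_ : _ \o _ = snd) //.
  by apply/funext => z /=; rewrite /rV_coord mxE unlift_none.
Qed.

Section step.
Context (n : nat) (m : {measure set 'rV[R]_n -> \bar R}).

Definition lebesgue_rV_step : set 'rV[R]_n.+1 -> \bar R :=
  pushforward (m \x leb)%E (@rV_cons n).

Let step0 : lebesgue_rV_step set0 = 0%E.
Proof. by rewrite /lebesgue_rV_step /pushforward preimage_set0 measure0. Qed.

Let step_ge0 A : (0 <= lebesgue_rV_step A)%E.
Proof. exact: (measure_ge0 (m \x leb)%E). Qed.

Let step_sigma_additive : semi_sigma_additive lebesgue_rV_step.
Proof.
move=> F mF tF mUF; rewrite /lebesgue_rV_step /pushforward preimage_bigcup.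
have mcons := @measurable_rV_cons n measurableT.
apply: (@measure_semi_sigma_additive _ _ _ (m \x leb)%E (fun k => @rV_cons n @^-1` F k)).
- by move=> k; rewrite -[X in measurable X]setTI; exact: mcons.
- apply/trivIsetP => /= i j _ _ ij; rewrite -preimage_setI.
  by move/trivIsetP : tF => /(_ _ _ _ _ ij) ->//; rewrite preimage_set0.
- by rewrite -preimage_bigcup -[X in measurable X]setTI; exact: mcons.
Qed.

HB.instance Definition _ := isMeasure.Build _ _ _ lebesgue_rV_step
  step0 step_ge0 step_sigma_additive.

End step.

Fixpoint lebesgue_rV n : {measure set 'rV[R]_n -> \bar R} :=
  match n with
  | 0 => \d_(0 : 'rV[R]_0)
  | k.+1 => lebesgue_rV_step (lebesgue_rV k)
  end.

Lemma lebesgue_rV_box n (A : 'I_n -> set R) :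
  (forall i, measurable (A i)) ->
  lebesgue_rV n [set x : 'rV[R]_n | forall i, A i (x 0 i)] =
  (\prod_(i < n) leb (A i))%E.
Proof.
elim: n A => [|n IHn] A mA.
  rewrite big_ord0 /= diracE (_ : _ \in _) //.
  by apply/mem_set => -[].
rewrite big_ord_recl /= /lebesgue_rV_step /pushforward.
rewrite (_ : @rV_cons n @^-1` _ =
    [set x : 'rV[R]_n | forall i, A (lift ord0 i) (x 0 i)]
    `*` (A ord0 : set (measurableTypeR R))); last first.
  apply/seteqP; split => -[x a] /=.
    move=> h; split => [i|].
      by have := h (lift ord0 i); rewrite mxE liftK.
    by have := h ord0; rewrite mxE unlift_none.
  move=> [h1 h2] i; rewrite mxE.
  by case: unliftP => [j|] ->.
rewrite product_measure1E//; last exact: mA.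
  by rewrite muleC -(IHn (fun i => A (lift ord0 i))).
rewrite (_ : [set x : 'rV[R]_n | _] =
  \bigcap_(i in setT) (@rV_coord R n i @^-1` A (lift ord0 i))); last first.
  by apply/seteqP; split => x /= h; [move=> i _; exact: h|move=> i; exact: h].
apply: fin_bigcap_measurable; first exact: finite_finset.
move=> i _; rewrite -[X in measurable X]setTI.
exact: measurable_rV_coord.
Qed.

End lebesgue_rV.
Arguments lebesgue_rV {R n}.

(** * Cells, averages and Campanato spaces *)

Variant cell_shape := Cube | EuclideanBall.

Section campanato.
Context (R : realType) (n : nat).
Local Notation V := 'rV[R]_n.
Local Notation mu := (@lebesgue_rV R n).
Implicit Types (f g : V -> R) (U : set V) (x y : V).

(* The library's norm [`|x|] on ['rV[R]_n] is the maximum norm. *)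
Definition enorm x : R := Num.sqrt (\sum_(i < n) x 0 i ^+ 2).

Definition cell (s : cell_shape) x (r : R) : set V :=
  match s with
  | Cube => [set y | `|y - x| < r]
  | EuclideanBall => [set y | enorm (y - x) < r]
  end.

Definition mean f U : R := (fine (mu U))^-1 * \int[mu]_(y in U) f y.

Definition oscillation (p : R) f U : \bar R :=
  (((fine (mu U))^-1%:E *
    \int[mu]_(y in U) (`|f y - mean f U| `^ p)%:E) `^ p^-1)%E.

Definition campanato_norm (s : cell_shape) (p lambda : R) U f : \bar R :=
  ereal_sup [set e | exists x r, [/\ 0 < r, cell s x r `<=` U &
    e = ((r `^ (- lambda))%:E * oscillation p f (cell s x r))%E]].

(* Integrability on the cells makes the averages meaningful: the library's
   integral is a total function. *)
Definition campanato (s : cell_shape) (p lambda : R) U : set (V -> R) :=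
  [set f | [/\ measurable_fun U f,
    forall x r, 0 < r -> cell s x r `<=` U ->
      mu.-integrable (cell s x r) (EFin \o f) &
    (campanato_norm s p lambda U f < +oo)%E]].

Definition eq_mod_const f g : Prop :=
  exists c : R, \forall x \ae mu, f x = g x + c.

(** * The spaces [B_w^u(L_(p,lambda))] *)

(* The norm of [L^u(I, dr/r)] for [0 < u] and nonnegative [F]; the null sets
   of [dr/r] are the Lebesgue null sets. *)
Definition Lu_norm (I : set R) (u : \bar R) (F : R -> \bar R) : \bar R :=
  match u with
  | v%:E => ((\int[lebesgue_measure]_(r in I) (F r `^ v * (r^-1)%:E))
              `^ v^-1)%E
  | +oo%E => ess_sup lebesgue_measure (F \_ I)
  | -oo%E => 0%E
  end.

(* [I] is [`[1, +oo[] for [B_w^u] and [`]0, +oo[] for its homogeneous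
   (dotted) version. *)
Definition B_norm (I : set R) (s : cell_shape) (p lambda : R) (w : R -> R)
    (u : \bar R) f : \bar R :=
  Lu_norm I u (fun r => ((w r)%:E * campanato_norm s p lambda (cell s 0 r) f)%E).

Definition B_space (I : set R) (s : cell_shape) (p lambda : R) (w : R -> R)
    (u : \bar R) : set (V -> R) :=
  [set f | [/\ measurable_fun setT f,
    forall r, 0 < r -> campanato s p lambda (cell s 0 r) f &
    (B_norm I s p lambda w u f < +oo)%E]].

End campanato.

Definition Theta_star (R : realType) (Theta : R -> R) : Prop :=
  (forall r, 0 < r -> 0 < Theta r) /\
  exists C e e' : R, [/\ 0 < C, 0 < e < 1, 0 < e' < 1 &
    forall r t, 0 < r -> 0 < t ->
      Theta (t * r) / Theta r <= C * Num.max (t `^ e) (t `^ e')].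

(** * Singular integral operators *)

Section singular_integral.
Context (R : realType) (n : nat).
Local Notation V := 'rV[R]_n.
Local Notation mu := (@lebesgue_rV R n).
Implicit Types (f g : V -> R) (x y z : V) (K : V -> V -> R).

Definition truncated K (eta : R) f x : R :=
  \int[mu]_(y in [set y | eta <= enorm (x - y)]) (K x y * f y).

Definition compactly_supported f : Prop :=
  exists2 A : set V, compact A & forall y, ~ A y -> f y = 0.

(* [T] only matters up to almost everywhere equality: it is the [L^p] limit of
   the truncations. *)
Record singular_integral (kappa : R) K (T : (V -> R) -> V -> R) : Prop := {
  kernel_bounds : exists C : R,
    (forall x y, x != y -> `|K x y| <= C * enorm (x - y) ^- n) /\
    (forall x y z, 2 * enorm (x - z) <= enorm (x - y) ->
      `|K x y - K z y| + `|K y x - K y z| <=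
        C / enorm (x - y) ^+ n * (enorm (x - z) / enorm (x - y)) `^ kappa);
  kernel_cancellation : forall x (r r' : R), 0 < r -> r < r' ->
    \int[mu]_(y in [set y | r <= enorm (x - y) < r']) K x y = 0 /\
    \int[mu]_(y in [set y | r <= enorm (x - y) < r']) K y x = 0;
  truncated_bounded : forall p : R, 1 < p -> exists2 Cp : R, 0 < Cp &
    forall eta f, 0 < eta -> f \in Lfun mu p%:E -> compactly_supported f ->
      ('N[mu]_p%:E[EFin \o truncated K eta f] <=
        Cp%:E * 'N[mu]_p%:E[EFin \o f])%E;
  truncated_limit : forall (p : R) f, 1 < p ->
    f \in Lfun mu p%:E -> compactly_supported f ->
    T f \in Lfun mu p%:E /\
    'N[mu]_p%:E[EFin \o (truncated K eta f \- T f)%R]%E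
      @[eta --> 0^'+] --> 0%E
}.

(** * The modified operator *)

Section modified.
Context (s : cell_shape) (K : V -> V -> R).

Definition modified_integrand f x y : R :=
  (K x y - K 0 y * (1 - \1_(cell s 0 1) y)) * f y.

Definition modified_truncated (eta : R) f x : R :=
  \int[mu]_(y in [set y | eta <= enorm (x - y)]) modified_integrand f x y.

(* [g] is the value at [f] of the modified operator: the integrals converge
   absolutely and the truncations tend to [g] in [L^q] of every cell. *)
Definition modified_value (q : R) f g : Prop :=
  (forall eta x, 0 < eta ->
    mu.-integrable [set y | eta <= enorm (x - y)]
      (EFin \o modified_integrand f x)) /\
  (forall x r, 0 < r ->
    g \_ (cell s x r) \in Lfun mu q%:E /\
    'N[mu]_q%:E[EFin \o ((modified_truncated eta f \- g) \_ (cell s x r))%R]%E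
      @[eta --> 0^'+] --> 0%E).

(* [X] and [N] are a function space modulo constants and its norm; [S] acts on
   representatives. The last clause says that the modified operator is defined
   on the members of [X] that lie in some [L_(q,lambda)(R^n)], so that the
   clause before it is not void. *)
Definition modified_extends_boundedly (X : set (V -> R))
    (N : (V -> R) -> \bar R) : Prop :=
  exists S : (V -> R) -> V -> R,
  [/\ forall f g, X f -> X g -> eq_mod_const f g -> eq_mod_const (S f) (S g),
      forall (a : R) f g, X f -> X g ->
        eq_mod_const (S (fun x => a * f x + g x))
                     (fun x => a * S f x + S g x),
      exists C : R, forall f, X f -> X (S f) /\ (N (S f) <= C%:E * N f)%E,
      forall (q : R) f g, 1 < q -> X f -> modified_value q f g ->
        eq_mod_const (S f) g &
      forall (q lambda : R) f, 1 < q -> - n%:R / q <= lambda < 1 -> X f ->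
        campanato s q lambda setT f -> exists g, modified_value q f g].

End modified.

End singular_integral.

(* Main.v *)
From HB Require Import structures.
Require Import Defs.
From mathcomp Require Import all_boot all_order all_algebra.
From mathcomp Require Import all_classical all_reals all_analysis ess_sup_inf measurable_realfun.
From mathcomp Require Import ring lra.

Set Implicit Arguments.
Unset Strict Implicit.
Unset Printing Implicit Defensive.

Import Order.TTheory GRing.Theory Num.Theory.
Import numFieldNormedType.Exports.

Local Open Scope classical_set_scope.
Local Open Scope ring_scope.

(** Write [A eta f] for [modified_truncated s K eta f]. On a ball [B x r] the
    function [A eta f] is, up to a constant and to an error that vanishes with
    [eta], the sum of the truncated operator at [(f - c) 1_(B x (2 r))] and of
    the integral of [(K y z - K x z) (f z - c)] over the complement of that
    larger ball ([modified_truncated_split]). The constant [c] is free because,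
    by the cancellation of the kernel, [A eta] maps constants to constants up
    to such an error ([modified_truncated_cst]). The first summand is controlled
    by the [L^q] bound of the operator, the second one by the regularity of the
    kernel, as soon as [f] is in [L^q] of every ball and has a finite integral
    against [|z| ^ (- n - kappa)] at infinity ([admissible]). For such [f] the
    limit exists ([modified_limit_exists]), is determined almost everywhere by
    the truncations, whatever the exponent ([modified_limit_lin]), and satisfies
    a local estimate with [c] at will ([modified_limit_ball]).

    Let [N r] be the Campanato norm of [f] on the cell of radius [r] about the
    origin. Membership in the spaces makes [N (2 ^ j r)] grow at most like
    [2 ^ (j delta)] for every [delta > sigma], because, up to a
    constant, [w] loses at most the factor [t ^ (- sigma)] under dilation by [t]. Take [delta] between [sigma]
    and [kappa - lambda]. Then the oscillations of [f] over the dilates by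
    [2 ^ k] of a small cell grow at most like [2 ^ (k (lambda + delta))], and as
    [lambda + delta < kappa] the series over dyadic shells that bounds the
    integral at infinity converges. Hence members of the spaces are admissible
    ([campanato_growth_admissible]), and the norm [N' r] of the image is at most
    a multiple of [sup_j 2 ^ (- j delta) N (2 ^ (j + m) r)]
    ([modified_limit_campanato]).

    It remains to pass to the weighted norms ([Lu_norm_compare]). As [N] and
    [N'] are monotone and [w] is nearly constant on dyadic intervals, integrals
    may be compared with sums over a grid [a 2 ^ k], and there the supremum
    is summed with the ratio [2 ^ (sigma - delta) < 1] ([geometric_sup_sum]).
    Since [w] may fail to be measurable, the integrals are only compared
    through step functions below and above the integrand.

    For the exponent 1 the operator has no local bound. There [lambda >= 0], and
    the John-Nirenberg inequality ([john_nirenberg], [campanato_norm2_le])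
    bounds the norm with exponent 2 on a cell by the norm with exponent 1 on a
    dilate of it, so that the previous argument applies with [q = 2]. *)

(** * The Euclidean norm and the cells *)

Section enorm.
Context (R : realType) (n : nat).
Local Notation V := 'rV[R]_n.
Implicit Types (x y z : V) (s : cell_shape).

Lemma enorm_ge0 x : 0 <= enorm x.
Proof. exact: sqrtr_ge0. Qed.

Lemma enorm_sq x : enorm x ^+ 2 = \sum_(i < n) x 0 i ^+ 2.
Proof. by rewrite sqr_sqrtr// sumr_ge0// => i _; exact: sqr_ge0. Qed.

Lemma enormZ (a : R) x : enorm (a *: x) = `|a| * enorm x.
Proof.
rewrite /enorm -sqrtr_sqr -sqrtrM ?sqr_ge0// mulr_sumr.
by congr Num.sqrt; apply: eq_bigr => i _; rewrite mxE exprMn.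
Qed.

Lemma enormN x : enorm (- x) = enorm x.
Proof. by rewrite -scaleN1r enormZ normrN normr1 mul1r. Qed.

Lemma enorm_distC x y : enorm (x - y) = enorm (y - x).
Proof. by rewrite -opprB enormN. Qed.

Lemma enorm0 : enorm (0 : V) = 0.
Proof. by rewrite -(scale0r (0 : V)) enormZ normr0 mul0r. Qed.

Lemma enorm_dot x y : \sum_(i < n) x 0 i * y 0 i <= enorm x * enorm y.
Proof.
set a := enorm x; set b := enorm y; set D := (X in X <= _).
have : 0 <= \sum_(i < n) (b * x 0 i - a * y 0 i) ^+ 2.
  by apply: sumr_ge0 => i _; exact: sqr_ge0.
have -> : \sum_(i < n) (b * x 0 i - a * y 0 i) ^+ 2 =
    b ^+ 2 * a ^+ 2 + a ^+ 2 * b ^+ 2 - (a * b) * D *+ 2.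
  transitivity (b ^+ 2 * (\sum_(i < n) x 0 i ^+ 2) +
      a ^+ 2 * (\sum_(i < n) y 0 i ^+ 2) - (a * b) * D *+ 2).
    rewrite !mulr_sumr -sumrMnl -big_split/= -sumrB.
    by apply: eq_bigr => i _; ring.
  by rewrite -!enorm_sq.
have a0 : 0 <= a := enorm_ge0 x; have b0 : 0 <= b := enorm_ge0 y.
have [ab0|] := ltP 0 (a * b).
  move=> h; rewrite -subr_ge0 -(pmulr_rge0 _ ab0); nra.
move=> ab0; have /eqP : a * b = 0 by apply/eqP; rewrite eq_le ab0 mulr_ge0.
move=> ab _; have : (a * b) ^+ 2 = 0 by rewrite (eqP ab) expr0n.
suff : D ^+ 2 <= 0 by move=> D0 _; nra.
have z0 (v : V) : enorm v = 0 -> forall i, v 0 i = 0.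
  move=> v0 i; have : \sum_(j < n) v 0 j ^+ 2 = 0 by rewrite -enorm_sq v0 expr0n.
  move/eqP; rewrite psumr_eq0; last by move=> j _; exact: sqr_ge0.
  by move=> /allP/(_ i); rewrite mem_index_enum sqrf_eq0 => /(_ isT)/eqP.
rewrite (_ : D = 0) ?expr0n//; apply: big1 => i _.
move: ab; rewrite mulf_eq0 => /orP[] /eqP /z0/(_ i) ->; rewrite ?mul0r ?mulr0//.
Qed.

Lemma enormD x y : enorm (x + y) <= enorm x + enorm y.
Proof.
rewrite -(ler_pXn2r (_ : 0 < 2)%N) ?nnegrE ?addr_ge0 ?enorm_ge0//.
rewrite sqrrD !enorm_sq; have := enorm_dot x y; set D := (X in X <= _) => h.
apply: (@le_trans _ _ (\sum_(i < n) x 0 i ^+ 2 + D *+ 2 + \sum_(i < n) y 0 i ^+ 2)).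
  rewrite /D -sumrMnl -!big_split/= ler_sum// => i _.
  by rewrite mxE sqrrD.
by rewrite lerD2r lerD2l lerMn2r.
Qed.

Lemma coord_le_enorm x i : `|x 0 i| <= enorm x.
Proof.
rewrite -sqrtr_sqr ler_sqrt; last by apply: sumr_ge0 => j _; exact: sqr_ge0.
by rewrite (bigD1 i)//= lerDl; apply: sumr_ge0 => j _; exact: sqr_ge0.
Qed.

Lemma coord_le_norm x i : `|x 0 i| <= `|x|.
Proof.
rewrite -[`|x|]/(mx_norm x) mx_normrE.
by apply: (le_trans _ (le_bigmax _ _ (0, i))).
Qed.

Lemma norm_le (c : R) x : 0 <= c -> (forall i, `|x 0 i| <= c) -> `|x| <= c.
Proof.
move=> c0 h; rewrite -[`|x|]/(mx_norm x) mx_normrE.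
by apply/bigmax_leP; split => // -[i j] _ /=; rewrite (ord1 i).
Qed.

Lemma norm_le_enorm x : `|x| <= enorm x.
Proof. by apply: norm_le => [|i]; [exact: enorm_ge0|exact: coord_le_enorm]. Qed.

Lemma enorm_le_norm x : enorm x <= Num.sqrt n%:R * `|x|.
Proof.
rewrite -{1}(ger0_norm (normr_ge0 x)) -sqrtr_sqr -sqrtrM// ler_sqrt; last first.
  by rewrite mulr_ge0// sqr_ge0.
rewrite mulr_natl -[n in _ *+ n]card_ord -sumr_const ler_sum// => i _.
by rewrite -real_normK ?num_real// ler_pXn2r ?nnegrE ?coord_le_norm.
Qed.

Lemma enorm_eq0 x : (enorm x == 0) = (x == 0).
Proof.
apply/eqP/eqP => [x0|->]; last exact: enorm0.
by apply/eqP; rewrite -normr_le0 (le_trans (norm_le_enorm x))// x0.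
Qed.

(** The norm whose balls are the cells of shape [s]. *)
Definition snorm s x := if s is Cube then `|x| else enorm x.

Lemma cellE s x r : cell s x r = [set y | snorm s (y - x) < r].
Proof. by case: s. Qed.

Lemma snorm_ge0 s x : 0 <= snorm s x.
Proof. by case: s => //=; exact: enorm_ge0. Qed.

Lemma snormZ s (a : R) x : snorm s (a *: x) = `|a| * snorm s x.
Proof. by case: s => /=; rewrite ?enormZ ?normrZ. Qed.

Lemma snormD s x y : snorm s (x + y) <= snorm s x + snorm s y.
Proof. by case: s => /=; [exact: ler_normD|exact: enormD]. Qed.

Lemma snorm_eq0 s x : (snorm s x == 0) = (x == 0).
Proof. by case: s; rewrite /= ?normr_eq0 ?enorm_eq0. Qed.

Lemma snorm0 s : snorm s 0 = 0.
Proof. by apply/eqP; rewrite snorm_eq0. Qed.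

Lemma snorm_le_enorm s x : snorm s x <= enorm x.
Proof. by case: s => //=; exact: norm_le_enorm. Qed.

Hypothesis n0 : (0 < n)%N.
Local Notation d := (Num.sqrt n%:R : R).

Lemma sqrtn_ge1 : 1 <= d.
Proof. by rewrite -[X in X <= _]sqrtr1 ler_sqrt ?ler1n ?ler0n. Qed.

Lemma norm_le_snorm s x : `|x| <= snorm s x.
Proof. by case: s => //=; exact: norm_le_enorm. Qed.

Lemma enorm_le_snorm s x : enorm x <= d * snorm s x.
Proof.
apply: (le_trans (enorm_le_norm x)); rewrite ler_pM2l ?norm_le_snorm//.
exact: (lt_le_trans ltr01 sqrtn_ge1).
Qed.

(** The radius of a cell that lies in a cell about the origin: move from the
    centre in the direction of the centre itself. *)
Lemma cell_sub_origin s x t r : 0 < t -> cell s x t `<=` cell s 0 r ->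
  snorm s x + t <= r.
Proof.
move=> t0 sub.
have [v [v1 xv]] : exists v : V, snorm s v = 1 /\ x = snorm s x *: v.
  have [->|x0] := eqVneq x 0.
    pose u : V := const_mx 1.
    have u0 : u != 0.
      apply/eqP => /rowP/(_ (Ordinal n0)); rewrite !mxE => /eqP.
      by rewrite oner_eq0.
    exists ((snorm s u)^-1 *: u); rewrite snorm0 scale0r; split => //.
    rewrite snormZ ger0_norm ?invr_ge0 ?snorm_ge0// mulVf//.
    by rewrite snorm_eq0.
  exists ((snorm s x)^-1 *: x); rewrite snormZ scalerA.
  rewrite ger0_norm ?invr_ge0 ?snorm_ge0// mulVf ?snorm_eq0// mulfV ?snorm_eq0//.
  by rewrite scale1r.
apply/ler_addgt0Pr => e e0.
pose a := Num.max (t - e) 0.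
have a0 : 0 <= a by rewrite le_max lexx orbT.
have at_ : a < t by rewrite gt_max t0 andbT ltrBlDr ltrDl.
have : cell s 0 r (x + a *: v).
  apply: sub; rewrite cellE/= addrC addKr snormZ v1 mulr1 ger0_norm//.
rewrite cellE/= subr0 {1}xv -scalerDl snormZ v1 mulr1 ger0_norm ?addr_ge0 ?snorm_ge0//.
have : t - e <= a by rewrite le_max lexx.
lra.
Qed.

Lemma sub_cell s x y t r : snorm s (y - x) + t <= r -> cell s y t `<=` cell s x r.
Proof.
move=> h z; rewrite !cellE/= => zy.
have := snormD s (z - y) (y - x); rewrite addrA subrK; lra.
Qed.

Lemma sub_cell_origin s x t r : snorm s x + t <= r -> cell s x t `<=` cell s 0 r.
Proof. by move=> h; apply: sub_cell; rewrite subr0. Qed.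

End enorm.

(** * Lebesgue measure of cells *)

Section measurable_norms.
Context (R : realType) (n : nat).
Local Notation V := 'rV[R]_n.

Lemma measurable_rV_subr (d : measure_display) (T : measurableType d) (f g : T -> V) :
  measurable_fun setT f -> measurable_fun setT g ->
  measurable_fun setT (fun t => f t - g t).
Proof.
move=> mf mg; apply: measurable_fun_rV => i.
rewrite (_ : _ \o _ = (rV_coord i \o f) \- (rV_coord i \o g)); last first.
  by apply/funext => t /=; rewrite /rV_coord !mxE.
by apply: measurable_funB; apply: measurableT_comp => //; exact: measurable_rV_coord.
Qed.

Lemma measurable_snorm s : measurable_fun [set: V] (@snorm R n s).
Proof.
case: s => /=; last first.
  apply: (@measurableT_comp _ _ _ _ _ _ (@Num.sqrt R)).
    by apply: continuous_measurable_fun; exact: sqrt_continuous.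
  apply: measurable_sum => i; apply: measurable_funX.
  exact: measurable_rV_coord.
rewrite (_ : snorm _ = fun x : V => \big[Num.max/0]_(i < n) `|x 0 i|); last first.
  apply/funext => x /=; apply/eqP; rewrite eq_le; apply/andP; split.
    apply: norm_le => [|i]; last exact: le_bigmax.
    by apply/bigmax_geP; left.
  by apply/bigmax_leP; split => // i _; exact: coord_le_norm.
elim: (index_enum _) => [|i r ih].
  under eq_fun do rewrite big_nil.
  exact: measurable_cst.
under eq_fun do rewrite big_cons.
apply: measurable_maxr => //; apply: measurableT_comp => //.
exact: measurable_rV_coord.
Qed.

Lemma measurable_enorm : measurable_fun [set: V] (@enorm R n).
Proof. exact: (measurable_snorm EuclideanBall). Qed.

Lemma measurable_enorm_pair :
  measurable_fun [set: V * V] (fun z : V * V => enorm (z.1 - z.2)).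
Proof.
apply: (@measurableT_comp _ _ _ _ _ _ (@enorm R n)); first exact: measurable_enorm.
by apply: measurable_rV_subr; [exact: measurable_fst|exact: measurable_snd].
Qed.

Lemma measurable_enorm_subl (x : V) : measurable_fun [set: V] (fun y => enorm (x - y)).
Proof.
apply: (@measurableT_comp _ _ _ _ _ _ (@enorm R n)); first exact: measurable_enorm.
exact: measurable_rV_subr.
Qed.

Lemma measurable_cell s (x : V) r : measurable (cell s x r).
Proof.
rewrite cellE -[X in measurable X]setTI.
have m : measurable_fun [set: V] (fun y => snorm s (y - x)).
  apply: (@measurableT_comp _ _ _ _ _ _ (@snorm R n s)); first exact: measurable_snorm.
  exact: measurable_rV_subr.
have := m measurableT [set` `]-oo, r[] (measurable_itv _).
by congr measurable; apply/seteqP; split => y /=; rewrite in_itv.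
Qed.

Definition away (x : V) (r : R) : set V := [set z | r <= enorm (x - z)].

Lemma measurable_away (x : V) r : measurable (away x r).
Proof.
rewrite -[X in measurable X]setTI.
have := @measurable_enorm_subl x measurableT _ (measurable_itv `[r, +oo[).
by congr measurable; apply/seteqP; split => y /=; rewrite in_itv/= andbT.
Qed.

End measurable_norms.
Arguments measurable_cell {R n} s x r.
Arguments measurable_away {R n} x r.
#[global] Hint Extern 0 (measurable (cell _ _ _)) =>
  solve [apply: measurable_cell] : core.
#[global] Hint Extern 0 (measurable [set y | _ <= enorm (_ - y)]) =>
  solve [apply: measurable_away] : core.
#[global] Hint Extern 0 (measurable (away _ _)) =>
  solve [apply: measurable_away] : core.

Section volume.
Context (R : realType) (n : nat).
Hypothesis n0 : (0 < n)%N.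
Local Notation V := 'rV[R]_n.
Local Notation mu := (@lebesgue_rV R n).
Local Notation d := (Num.sqrt n%:R : R).

Lemma lebesgue_cube (x : V) (r : R) : 0 < r -> mu (cell Cube x r) = ((2 * r) ^+ n)%:E.
Proof.
move=> r0; rewrite (_ : cell _ _ _ =
    [set y : V | forall i, [set` `]x 0 i - r, x 0 i + r[] (y 0 i)]); last first.
  apply/seteqP; split => y /=.
    move=> yx i; rewrite in_itv/= -ltr_distl distrC -distrC.
    by have := coord_le_norm (y - x) i; rewrite !mxE => /le_lt_trans; exact.
  move=> h; have h' i : `|(y - x) 0 i| < r.
    by have := h i; rewrite in_itv/= -ltr_distl !mxE.
  have [[i ->]|->//] : (exists i, `|y - x| = `|(y - x) 0 i|) \/ `|y - x| = 0.
    have [->|/eqP] := eqVneq `|y - x| 0; first by right.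
    move/eqP => /mx_norm_neq0[[i j] e]; left; exists j.
    by rewrite -[LHS]/(mx_norm (y - x)) e (ord1 i).
  exact: h'.
rewrite (@lebesgue_rV_box R n (fun i => [set` `]x 0 i - r, x 0 i + r[]))//.
rewrite (eq_bigr (fun=> (2 * r)%:E)); last first.
  move=> i _; rewrite lebesgue_measure_itv/= lte_fin ltrBlDr -addrA ltrDl addr_gt0//.
  by rewrite -EFinB; congr EFin; ring.
by rewrite prodEFin prodr_const card_ord.
Qed.

Lemma cell_sub_cube s (x : V) r : cell s x r `<=` cell Cube x r.
Proof. by rewrite !cellE => y /=; apply: le_lt_trans; exact: norm_le_snorm. Qed.

Lemma ball_sub_cell s (x : V) r : cell EuclideanBall x r `<=` cell s x r.
Proof. by rewrite !cellE => y /=; apply: le_lt_trans; exact: snorm_le_enorm. Qed.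

Lemma cell_sub_ball s (x : V) r : cell s x r `<=` cell EuclideanBall x (d * r).
Proof.
rewrite !cellE => y /= h; apply: le_lt_trans (enorm_le_snorm n0 s _) _.
by rewrite ltr_pM2l// (lt_le_trans ltr01)// sqrtn_ge1.
Qed.

Lemma sqrtn_gt0 : 0 < d.
Proof. by rewrite (lt_le_trans ltr01)// sqrtn_ge1. Qed.

Lemma volume_cell_lty s (x : V) r : 0 < r -> (mu (cell s x r) < +oo)%E.
Proof.
move=> r0; apply: (@le_lt_trans _ _ (mu (cell Cube x r))).
  by apply: le_measure; [apply/mem_set; exact: measurable_cell..|exact: cell_sub_cube].
by rewrite lebesgue_cube// ltry.
Qed.

Lemma volume_cell_fin s (x : V) r : 0 < r -> mu (cell s x r) \is a fin_num.
Proof. by move=> r0; rewrite ge0_fin_numE ?volume_cell_lty. Qed.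

Definition volume s (x : V) r : R := fine (mu (cell s x r)).

Lemma volumeE s (x : V) r : 0 < r -> mu (cell s x r) = (volume s x r)%:E.
Proof. by move=> r0; rewrite /volume fineK// volume_cell_fin. Qed.

Lemma volume_le s (x : V) r : 0 < r -> volume s x r <= (2 * r) ^+ n.
Proof.
move=> r0; rewrite -lee_fin -volumeE// -(lebesgue_cube x)//.
by apply: le_measure; [apply/mem_set; exact: measurable_cell..|exact: cell_sub_cube].
Qed.

Lemma volume_ge s (x : V) r : 0 < r -> (2 * (r / d)) ^+ n <= volume s x r.
Proof.
move=> r0; rewrite -lee_fin -volumeE// -(lebesgue_cube x)//; last first.
  by rewrite divr_gt0// sqrtn_gt0.
apply: le_measure; [apply/mem_set; exact: measurable_cell..|].
apply: subset_trans (@ball_sub_cell s x r).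
rewrite {2}(_ : r = d * (r / d)); first exact: cell_sub_ball.
by rewrite mulrC divfK// gt_eqF// sqrtn_gt0.
Qed.

Lemma volume_gt0 s (x : V) r : 0 < r -> 0 < volume s x r.
Proof.
move=> r0; apply: lt_le_trans (volume_ge s x r0).
by rewrite exprn_gt0// mulr_gt0// divr_gt0// sqrtn_gt0.
Qed.

Lemma volume_doubling s s' (x y : V) r b : 0 < r -> 0 < b ->
  volume s x (b * r) <= (d * b) ^+ n * volume s' y r.
Proof.
move=> r0 b0; apply: le_trans (volume_le _ _ (mulr_gt0 b0 r0)) _.
have : (d * b) ^+ n * (2 * (r / d)) ^+ n <= (d * b) ^+ n * volume s' y r.
  rewrite ler_pM2l ?volume_ge// exprn_gt0// mulr_gt0 ?sqrtn_gt0//.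
rewrite -exprMn; congr (_ ^+ _ <= _).
by field; rewrite gt_eqF// sqrtn_gt0.
Qed.

Lemma lebesgue_rV_sigma_finite : sigma_finite setT mu.
Proof.
exists (fun k => cell Cube 0 k.+1%:R); last first.
  by move=> k; split => //; exact: volume_cell_lty.
apply/seteqP; split => // x _; exists (Num.truncn `|x|) => //=.
by rewrite subr0; exact: truncnS_gt.
Qed.

End volume.

(** * Joint measurability of the kernel *)

Section rounding.
Context (R : realType) (n : nat).
Local Notation V := 'rV[R]_n.

Definition grid (m : nat) (x : V) : 'rV[int]_n := \row_i Num.floor (x 0 i * m.+1%:R).

Definition of_grid (m : nat) (z : 'rV[int]_n) : V := \row_i ((z 0 i)%:~R / m.+1%:R).

Lemma enorm_round (m : nat) (x : V) :
  enorm (x - of_grid m (grid m x)) <= Num.sqrt n%:R * m.+1%:R^-1.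
Proof.
apply: (le_trans (enorm_le_norm _)); rewrite ler_wpM2l ?sqrtr_ge0//.
apply: norm_le => [|i]; first by rewrite invr_ge0.
rewrite !mxE; set a := x 0 i.
have m0 : 0 < m.+1%:R :> R by [].
have -> : a - (Num.floor (a * m.+1%:R))%:~R / m.+1%:R =
    (a * m.+1%:R - (Num.floor (a * m.+1%:R))%:~R) / m.+1%:R.
  by rewrite mulrBl mulfK// gt_eqF.
set b := a * _; have := floor_le_tmp b; have := floorD1_gt b.
rewrite intrD => h1 h2; rewrite ger0_norm; last by rewrite divr_ge0// subr_ge0.
by rewrite -[leRHS]mul1r ler_pM2r ?invr_gt0//; lra.
Qed.

Lemma measurable_grid_fiber m (z : 'rV[int]_n) : measurable (grid m @^-1` [set z]).
Proof.
rewrite (_ : _ @^-1` _ = \bigcap_(i in setT)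
    [set x : V | x 0 i * m.+1%:R \in `[(z 0 i)%:~R, (z 0 i + 1)%:~R[]); last first.
  apply/seteqP; split => x /=.
    move=> <- i _ /=; rewrite mxE in_itv/=.
    by rewrite floor_le_tmp floorD1_gt.
  move=> h; apply/rowP => i; rewrite mxE; apply: floor_def.
  by have := h i I; rewrite /= in_itv.
apply: fin_bigcap_measurable => // i _.
rewrite -[X in measurable X]setTI.
have mi : measurable_fun [set: V] (fun x : V => x 0 i * m.+1%:R).
  by apply: measurable_funM => //; exact: measurable_rV_coord.
exact: (mi measurableT _ (measurable_itv _)).
Qed.

(** Grid points form a countable set. *)
Lemma measurable_grid_pair m (G : 'rV[int]_n -> 'rV[int]_n -> R) :
  measurable_fun [set: V * V] (fun z : V * V => G (grid m z.1) (grid m z.2)).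
Proof.
move=> _ Y mY; rewrite setTI.
rewrite (_ : _ @^-1` _ = \bigcup_(w : 'rV[int]_n * 'rV[int]_n)
    (if `[< Y (G w.1 w.2) >] then (grid m @^-1` [set w.1]) `*` (grid m @^-1` [set w.2])
     else set0)); last first.
  apply/seteqP; split => -[x y] /=.
    by move=> h; exists (grid m x, grid m y) => //=; rewrite asboolT.
  by move=> [[w1 w2] _] /=; case: asboolP => // h [/= -> ->].
apply: countable_bigcupT_measurable => [|w]; first exact: countableP.
by case: asboolP => // _; apply: measurableX; exact: measurable_grid_fiber.
Qed.

End rounding.
Arguments of_grid {R n} m z.

Record standard_kernel (R : realType) n (kappa C : R) (K : 'rV[R]_n -> 'rV[R]_n -> R) : Prop := {
  kernel_kappa_gt0 : 0 < kappa;
  kernel_const_ge0 : 0 <= C;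
  kernel_size : forall x y, x != y -> `|K x y| <= C * enorm (x - y) ^- n;
  kernel_regular : forall x y z, 2 * enorm (x - z) <= enorm (x - y) ->
    `|K x y - K z y| + `|K y x - K y z| <=
      C / enorm (x - y) ^+ n * (enorm (x - z) / enorm (x - y)) `^ kappa }.

Section kernel_measurability.
Context (R : realType) (n : nat).
Local Notation V := 'rV[R]_n.
Local Notation mu := (@lebesgue_rV R n).
Local Notation d := (Num.sqrt n%:R : R).
Variables (kappa C : R) (K : V -> V -> R).
Hypotheses (n0 : (0 < n)%N) (hK : standard_kernel kappa C K).

(** Off the diagonal the regularity condition makes the kernel jointly
    continuous, so that it is the limit of its values at grid points. *)
Lemma kernel_round_cvg (x y : V) : x != y ->
  K (of_grid m (grid m x)) (of_grid m (grid m y)) @[m --> \oo] --> K x y.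
Proof.
move=> xy; have kappa0 := kernel_kappa_gt0 hK; have C0 := kernel_const_ge0 hK.
set D := enorm (x - y).
have D0 : 0 < D by rewrite lt_def enorm_ge0 enorm_eq0 subr_eq0 xy.
apply/cvgrPdist_le => e e0.
pose A := 2 * (C + 1) * (2 / D) ^+ n.
have A0 : 0 < A by rewrite !mulr_gt0// ?ltr_wpDl ?exprn_gt0 ?divr_gt0.
pose b := Num.min (2^-1) ((e / A) `^ kappa^-1).
have b0 : 0 < b by rewrite lt_min invr_gt0 ltr0n/= powR_gt0// divr_gt0.
have lim0 : d * m.+1%:R^-1 @[m --> \oo] --> (0 : R).
  by rewrite -(mulr0 d); apply: cvgMr; exact: cvg_harmonic.
have : \forall m \near \oo, d * m.+1%:R^-1 < D / 2 * b.
  have Db : 0 < D / 2 * b by rewrite mulr_gt0// divr_gt0.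
  by apply: (cvgr_lt _ lim0).
apply: filterS => m hm.
set x' := of_grid _ _; set y' := of_grid _ _.
have hx : enorm (x - x') < D / 2 * b by apply: le_lt_trans hm; exact: enorm_round.
have hy : enorm (y - y') < D / 2 * b by apply: le_lt_trans hm; exact: enorm_round.
have b2 : b <= 2^-1 by rewrite ge_min lexx.
have Db4 : D / 2 * b <= D / 4 by rewrite -[4]/((2 * 2)%:R) natrM invfM mulrA ler_pM2l// divr_gt0.
have Dy' : D / 2 <= enorm (x - y').
  have := enormD (x - y') (y' - y); rewrite addrA subrK -/D (enorm_distC y' y).
  lra.
have regular (u : R) (v w : V) : D / 2 <= enorm v -> enorm w < D / 2 * b ->
    C / enorm v ^+ n * (enorm w / enorm v) `^ kappa <= e / 2.
  move=> hv hw; have v0 : 0 < enorm v by apply: lt_le_trans hv; rewrite divr_gt0.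
  apply: (@le_trans _ _ ((C + 1) * (2 / D) ^+ n * b `^ kappa)).
    apply: ler_pM; rewrite ?powR_ge0 ?mulr_ge0 ?invr_ge0 ?exprn_ge0 ?enorm_ge0//.
      apply: ler_pM; rewrite ?invr_ge0 ?exprn_ge0 ?enorm_ge0// ?lerDl//.
      rewrite -exprVn ler_pXn2r ?nnegrE ?invr_ge0 ?divr_ge0 ?enorm_ge0 ?(ltW D0)//.
      by rewrite -[2 / D]invrK lef_pV2 ?posrE ?invf_div ?divr_gt0.
    rewrite ge0_ler_powR ?nnegrE ?divr_ge0 ?enorm_ge0 ?(ltW kappa0) ?(ltW b0)//.
    rewrite ler_pdivrMr//; apply: (le_trans (ltW hw)).
    by rewrite mulrC ler_pM2l.
  have -> : (C + 1) * (2 / D) ^+ n * b `^ kappa = A / 2 * b `^ kappa.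
    by congr (_ * _); rewrite /A; set q := _ ^+ n; field.
  have : b `^ kappa <= e / A.
    apply: (@le_trans _ _ (((e / A) `^ kappa^-1) `^ kappa)).
      rewrite ge0_ler_powR ?nnegrE ?powR_ge0 ?(ltW kappa0) ?(ltW b0)//.
      by rewrite ge_min lexx orbT.
    by rewrite -powRrM mulVf ?gt_eqF// powRr1// divr_ge0 ?ltW.
  rewrite ler_pdivlMr// => h; lra.
have h1 : `|K x y' - K x' y'| <= e / 2.
  apply: le_trans (regular 0 (x - y') (x - x') Dy' hx).
  apply: le_trans (kernel_regular hK (y := y') _); first by rewrite lerDl.
  by apply: le_trans Dy'; lra.
have h2 : `|K x y - K x y'| <= e / 2.
  apply: le_trans (regular 0 (y - x) (y - y') _ hy); last first.
    by rewrite enorm_distC -/D; lra.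
  apply: le_trans (kernel_regular hK (y := x) _); first by rewrite lerDr.
  by rewrite (enorm_distC y x) -/D; lra.
rewrite -(subrKA (K x y')); apply: (le_trans (ler_normD _ _)); lra.
Qed.

Lemma measurable_kernel_away (r : R) : 0 < r ->
  measurable_fun [set: V * V] ((fun z : V * V => K z.1 z.2) \_ [set z | r <= enorm (z.1 - z.2)]).
Proof.
move=> r0; have mE : measurable [set z : V * V | r <= enorm (z.1 - z.2)].
  rewrite -[X in measurable X]setTI.
  have := @measurable_enorm_pair R n measurableT _ (measurable_itv `[r, +oo[).
  by congr measurable; apply/seteqP; split => y /=; rewrite in_itv/= andbT.
apply/measurable_restrict => //; rewrite setTI.
apply: (measurable_fun_cvg (h := fun m z => K (of_grid m (grid m z.1)) (of_grid m (grid m z.2)))).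
  move=> m; apply: measurable_funTS.
  exact: (measurable_grid_pair m (fun a b => K (of_grid m a) (of_grid m b))).
move=> [x y] /= rxy; apply: kernel_round_cvg.
by rewrite -subr_eq0 -enorm_eq0 gt_eqF// (lt_le_trans r0).
Qed.

End kernel_measurability.

Section parametric_integral.
Context (R : realType) (n : nat).
Local Notation V := 'rV[R]_n.
Local Notation mu := (@lebesgue_rV R n).

(** A copy of the measure that carries its sigma-finiteness, for the
    Fubini-Tonelli theorem. *)
Definition sigma_lebesgue_rV : set V -> \bar R := mu.
HB.instance Definition _ := Measure.copy sigma_lebesgue_rV mu.
HB.instance Definition _ :=
  Measure_isSigmaFinite.Build _ _ _ sigma_lebesgue_rV (lebesgue_rV_sigma_finite R n).

Lemma measurable_Rintegral_param (F : V * V -> R) : measurable_fun setT F ->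
  measurable_fun [set: V] (fun x => \int[mu]_y F (x, y)).
Proof.
move=> mF; rewrite /Rintegral.
apply: (@measurableT_comp _ _ _ _ _ _ (@fine R)) => //.
under eq_fun do rewrite integralE.
have mFE : measurable_fun [set: V * V] (EFin \o F) by exact/measurable_EFinP.
have tonelli (G : V * V -> \bar R) : measurable_fun [set: V * V] G ->
    (forall z, 0 <= G z)%E -> measurable_fun [set: V] (fun x => \int[mu]_y G (x, y))%E.
  by move=> mG G0; apply: (@measurable_fun_fubini_tonelli_F _ _ _ _ _ sigma_lebesgue_rV).
apply: emeasurable_funB.
  rewrite (_ : (fun x => _) = (fun x => \int[mu]_y ((EFin \o F)^\+)%E (x, y))%E).
    apply: tonelli => [|z]; last exact: funepos_ge0.
    exact: measurable_funepos.
  by apply/funext => x; apply: eq_integral => y _; rewrite !funeposE.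
rewrite (_ : (fun x => _) = (fun x => \int[mu]_y ((EFin \o F)^\-)%E (x, y))%E).
  apply: tonelli => [|z]; last exact: funeneg_ge0.
  exact: measurable_funeneg.
by apply/funext => x; apply: eq_integral => y _; rewrite !funenegE.
Qed.

End parametric_integral.

(** * Norms over subsets *)

Lemma le_poweR (R : realType) (r : R) (x y : \bar R) : 0 <= r ->
  (0 <= x)%E -> (x <= y)%E -> (x `^ r <= y `^ r)%E.
Proof.
move=> r0 x0 xy; apply: gt0_ler_poweR => //.
  by rewrite in_itv/= x0 leey.
by rewrite in_itv/= (le_trans x0 xy) leey.
Qed.

Section Lq.
Context (d : measure_display) (T : measurableType d) (R : realType).
Variable mu : {measure set T -> \bar R}.
Implicit Types (U : set T) (f g : T -> R) (q : R).

(** Functions are restricted by extension with zero, so that the properties of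
    norms over the whole space carry over. *)
Definition Lq q U f : \bar R := ('N[mu]_q%:E[EFin \o (f \_ U)])%E.

Lemma LqE q U f : 0 < q ->
  Lq q U f = ((\int[mu]_(x in U) (`|f x| `^ q)%:E) `^ q^-1)%E.
Proof.
move=> q0; rewrite /Lq unlock; congr poweR.
rewrite [RHS]integral_mkcond; apply: eq_integral => x _ /=.
rewrite !patchE; case: ifPn => //= _.
by rewrite normr0 powR0// gt_eqF.
Qed.

Lemma Lq1E U f : Lq 1 U f = (\int[mu]_(x in U) `|f x|%:E)%E.
Proof.
rewrite LqE// invr1 poweRe1; last by apply: integral_ge0 => x _; rewrite lee_fin powR_ge0.
by apply: eq_integral => x _; rewrite powRr1.
Qed.

Lemma Lq_ge0 q U f : (0 <= Lq q U f)%E.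
Proof. exact: Lnorm_ge0. Qed.

Lemma measurable_powR_norm q U f : measurable_fun U f ->
  measurable_fun U (fun x => (`|f x| `^ q)%:E).
Proof.
move=> mf; apply/measurable_EFinP.
apply: (@measurableT_comp _ _ _ _ _ _ (@powR R ^~ q)) => //.
exact: measurableT_comp.
Qed.

Lemma Lq_le q U f g : 0 < q -> measurable U -> measurable_fun U f -> measurable_fun U g ->
  (forall x, U x -> `|f x| <= `|g x|) -> (Lq q U f <= Lq q U g)%E.
Proof.
move=> q0 mU mf mg fg; rewrite !(LqE _ _ q0).
apply: le_poweR; first by rewrite invr_ge0 ltW.
- by apply: integral_ge0 => x _; rewrite lee_fin powR_ge0.
- apply: ge0_le_integral => //.
  + exact: measurable_powR_norm.
  + exact: measurable_powR_norm.
  + by move=> x Ux; rewrite lee_fin ge0_ler_powR ?nnegrE ?(ltW q0)// fg.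
Qed.

Lemma eq_Lq q U f g : (forall x, U x -> f x = g x) -> Lq q U f = Lq q U g.
Proof.
move=> fg; rewrite /Lq; congr Lnorm; apply/funext => x /=; rewrite !patchE.
by case: ifPn => // /[!inE] /fg ->.
Qed.

Lemma Lq_subset q U U' f : 0 < q -> measurable U -> measurable U' ->
  measurable_fun U' f -> U `<=` U' -> (Lq q U f <= Lq q U' f)%E.
Proof.
move=> q0 mU mU' mf UU'; rewrite !LqE//.
apply: le_poweR; first by rewrite invr_ge0 ltW.
- by apply: integral_ge0 => x _; rewrite lee_fin powR_ge0.
- by apply: ge0_subset_integral => //; exact: measurable_powR_norm.
Qed.

Lemma measurable_patch U f : measurable U -> measurable_fun U f ->
  measurable_fun setT (f \_ U).
Proof. by move=> mU mf; apply/measurable_restrict => //; rewrite setTI. Qed.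

Lemma LqD q U f g : 1 <= q -> measurable U -> measurable_fun U f -> measurable_fun U g ->
  (Lq q U (f \+ g)%R <= Lq q U f + Lq q U g)%E.
Proof.
move=> q1 mU mf mg; rewrite /Lq.
rewrite (_ : (f \+ g) \_ U = (f \_ U) \+ (g \_ U)); last first.
  by apply/funext => x; rewrite /= !patchE; case: ifPn => //; rewrite addr0.
by apply: minkowski_EFin => //; exact: measurable_patch.
Qed.

Lemma LqN q U f : Lq q U (\- f) = Lq q U f.
Proof.
rewrite /Lq -[RHS]oppe_Lnorm; congr Lnorm; apply/funext => x /=.
by rewrite !patchE; case: ifPn => //= _; rewrite oppr0.
Qed.

Lemma LqB q U f g : 1 <= q -> measurable U -> measurable_fun U f -> measurable_fun U g ->
  (Lq q U (f \- g)%R <= Lq q U f + Lq q U g)%E.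
Proof.
move=> q1 mU mf mg; rewrite -[in leRHS](LqN _ _ g).
by apply: (LqD (g := \- g)) => //; exact: measurableT_comp.
Qed.

Lemma LqZ q U (a : R) f : 0 < q -> measurable U -> measurable_fun U f ->
  Lq q U (fun x => a * f x) = (`|a|%:E * Lq q U f)%E.
Proof.
move=> q0 mU mf; rewrite !LqE//.
rewrite (_ : (\int[mu]_(x in U) _)%E =
    ((`|a| `^ q)%:E * \int[mu]_(x in U) (`|f x| `^ q)%:E)%E); last first.
  rewrite -ge0_integralZl//; first by apply: eq_integral => x _; rewrite normrM powRM.
  exact: measurable_powR_norm.
rewrite poweRM ?lee_fin ?powR_ge0//; last first.
  by apply: integral_ge0 => x _; rewrite lee_fin powR_ge0.
by rewrite poweR_EFin -powRrM mulfV ?gt_eqF// powRr1.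
Qed.

Lemma Lq_cst q U (a : R) : 0 < q -> measurable U ->
  Lq q U (cst a) = (`|a|%:E * mu U `^ q^-1)%E.
Proof.
move=> q0 mU; rewrite LqE// (eq_integral (cst (`|a| `^ q)%:E))// integral_cst//.
rewrite poweRM ?lee_fin ?powR_ge0//.
by rewrite poweR_EFin -powRrM mulfV ?gt_eqF// powRr1.
Qed.

Lemma Lq_le_cst q U (a : R) f : 0 < q -> 0 <= a -> measurable U -> measurable_fun U f ->
  (forall x, U x -> `|f x| <= a) -> (Lq q U f <= a%:E * mu U `^ q^-1)%E.
Proof.
move=> q0 a0 mU mf fa; rewrite -[X in (X%:E * _)%E](ger0_norm a0) -Lq_cst//.
by apply: Lq_le => // x Ux /=; rewrite (ger0_norm a0) fa.
Qed.

Lemma Lq_holder q U f : 1 < q -> measurable U -> measurable_fun U f ->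
  (\int[mu]_(x in U) `|f x|%:E <= Lq q U f * mu U `^ (1 - q^-1))%E.
Proof.
move=> q1 mU mf; have q0 : 0 < q by apply: lt_trans q1.
have q'0 : 0 < 1 - q^-1 by rewrite subr_gt0 invf_lt1.
rewrite -Lq1E; have mUf := measurable_patch mU mf.
have mU1 : measurable_fun setT (\1_U : T -> R) by exact: measurable_indic.
have := @hoelder _ _ _ mu (f \_ U) (\1_U) q (1 - q^-1)^-1 mUf mU1.
rewrite invr_gt0 invrK => /(_ q0 q'0); rewrite addrC subrK => /(_ erefl).
rewrite /Lq (_ : EFin \o (f \_ U \* \1_U)%R = EFin \o (f \_ U)); last first.
  apply/funext => x /=; rewrite !patchE indicE; case: ifPn => _ /=.
    by rewrite mulr1.
  by rewrite mul0r.
move=> /le_trans; apply; rewrite le_eqVlt; apply/orP; left; apply/eqP; congr (_ * _)%E.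
rewrite (_ : \1_U = (cst (1 : R)) \_ U); last first.
  by apply/funext => x; rewrite indicE patchE /=; case: ifPn.
rewrite -[LHS]/(Lq _ U (cst 1)) Lq_cst ?invr_gt0// normr1 mul1e invrK//.
Qed.

Lemma Lq_lty_integrable q U f : 1 <= q -> measurable U -> (mu U < +oo)%E ->
  measurable_fun U f -> (Lq q U f < +oo)%E -> mu.-integrable U (EFin \o f).
Proof.
move=> q1 mU muU mf fq; apply/integrableP; split; first exact/measurable_EFinP.
move: q1; rewrite le_eqVlt => /predU1P[q1|q1]; first by rewrite -q1 Lq1E in fq.
apply: le_lt_trans (Lq_holder q1 mU mf) _.
rewrite lte_mul_pinfty ?Lq_ge0 ?ge0_fin_numE ?Lq_ge0//.
by rewrite poweR_lty.
Qed.

Lemma Lq_eq0_ae q U f : 0 < q -> measurable U -> measurable_fun U f ->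
  Lq q U f = 0%E -> {ae mu, forall x, U x -> f x = 0}.
Proof.
move=> q0 mU mf fq; have := @Lnorm_eq0_eq0 _ _ _ mu (EFin \o (f \_ U)) q%:E.
have mUf := measurable_patch mU mf.
move=> /(_ (measurableT_comp (@EFin_measurable R setT) mUf)); rewrite lte_fin => /(_ q0 fq).
apply: filterS => x /(_ I)/= + Ux; rewrite patchE ifT ?inE//.
by move=> [].
Qed.

Lemma Lq_ae q U f g : 0 < q -> measurable U -> measurable_fun U f -> measurable_fun U g ->
  {ae mu, forall x, U x -> f x = g x} -> Lq q U f = Lq q U g.
Proof.
move=> q0 mU mf mg fg; rewrite !(LqE _ _ q0).
rewrite (@ge0_ae_eq_integral _ _ _ mu U _ (fun x => (`|g x| `^ q)%:E))//.
- exact: measurable_powR_norm.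
- exact: measurable_powR_norm.
- by apply: filterS fg => x h Ux; rewrite h.
Qed.

Lemma Lq_LfunP q U f : measurable U -> measurable_fun U f -> (Lq q U f < +oo)%E ->
  f \_ U \in Lfun mu q%:E.
Proof. by move=> mU mf fq; rewrite inE; apply/andP; split; rewrite inE//=; exact: measurable_patch. Qed.

Lemma Lfun_patchP q U f : measurable U -> f \_ U \in Lfun mu q%:E ->
  measurable_fun U f /\ (Lq q U f < +oo)%E.
Proof.
move=> mU /andP[]; rewrite !inE => mf fq; split => //.
by rewrite -(setTI U); apply/measurable_restrict.
Qed.

End Lq.

(** * The truncated modified operator *)

Section modified_decomposition.
Context (R : realType) (n : nat) (s : cell_shape).
Local Notation V := 'rV[R]_n.
Local Notation mu := (@lebesgue_rV R n).
Local Notation d := (Num.sqrt n%:R : R).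
Local Notation B := (cell EuclideanBall).
Variables (kappa C : R) (K : V -> V -> R).
Hypotheses (n0 : (0 < n)%N) (hK : standard_kernel kappa C K).
Implicit Types (f g h : V -> R) (x y z : V).

Lemma awayE x r : away x r = ~` B x r.
Proof.
apply/seteqP; split => z; rewrite /away/= enorm_distC leNgt => /negP//.
Qed.

Definition kernel0 y : R := K 0 y * (1 - \1_(cell s 0 1) y).

Lemma kernel0_eq0 y : cell s 0 1 y -> kernel0 y = 0.
Proof. by move=> yc; rewrite /kernel0 indicE mem_set// subrr mulr0. Qed.

Lemma kernel0E y : ~ cell s 0 1 y -> kernel0 y = K 0 y.
Proof. by move=> yc; rewrite /kernel0 indicE memNset// subr0 mulr1. Qed.

Lemma not_cell1 y : d <= enorm (0 - y) -> ~ cell s 0 1 y.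
Proof.
rewrite cellE sub0r enormN /= subr0 => dy; apply/negP; rewrite -leNgt.
have := enorm_le_snorm n0 s y => h.
by rewrite -(ler_pM2l (sqrtn_gt0 R n0)) mulr1 (le_trans dy).
Qed.

Lemma not_cell1_enorm y : ~ cell s 0 1 y -> 1 <= enorm (0 - y).
Proof.
rewrite cellE/= subr0 => /negP; rewrite -leNgt sub0r enormN => /le_trans; apply.
exact: snorm_le_enorm.
Qed.

Lemma kernel_le x y r : 0 < r -> r <= enorm (x - y) -> `|K x y| <= C * r ^- n.
Proof.
move=> r0 rxy; have xy : x != y.
  by rewrite -subr_eq0 -enorm_eq0 gt_eqF// (lt_le_trans r0).
apply: (le_trans (kernel_size hK xy)).
rewrite ler_wpM2l ?(kernel_const_ge0 hK)//.
rewrite lef_pV2 ?posrE ?exprn_gt0// ?(lt_le_trans r0)//.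
by rewrite lerXn2r ?nnegrE ?enorm_ge0// ltW.
Qed.

Lemma kernel0_le y : `|kernel0 y| <= C.
Proof.
have [yc|yc] := pselect (cell s 0 1 y).
  by rewrite kernel0_eq0// normr0 (kernel_const_ge0 hK).
rewrite kernel0E//; apply: le_trans (kernel_le ltr01 (not_cell1_enorm yc)) _.
by rewrite expr1n invr1 mulr1.
Qed.

Lemma measurable_kernel_section x r : 0 < r -> measurable_fun (away x r) (K x).
Proof.
move=> r0; rewrite -(setTI (away x r)); apply/measurable_restrict => //.
have := measurable_fun_pair2 x (measurable_kernel_away n0 hK r0).
by apply: eq_measurable_fun => z _; rewrite !patchE/=.
Qed.

Lemma measurable_kernel0 : measurable_fun setT kernel0.
Proof.
have -> : kernel0 = (fun y => (K 0 \_ (away 0 1)) y * (1 - \1_(cell s 0 1) y)).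
  apply/funext => y; have [yc|yc] := pselect (cell s 0 1 y).
    by rewrite kernel0_eq0// indicE mem_set// subrr mulr0.
  by rewrite kernel0E// indicE memNset// subr0 mulr1 patchE ifT// inE; exact: not_cell1_enorm.
apply: measurable_funM.
  apply/measurable_restrict => //; rewrite setTI.
  exact: measurable_kernel_section.
by apply: measurable_funB => //; exact: measurable_indic.
Qed.

(** The decay of [K x z - K x' z] in [z], for [x'] at distance at most [r] from [x]. *)
Definition decay x (r : R) z : R := (r / enorm (x - z)) `^ kappa / enorm (x - z) ^+ n.

Lemma decay_ge0 x r z : 0 <= decay x r z.
Proof. by rewrite /decay mulr_ge0 ?powR_ge0// invr_ge0 exprn_ge0 ?enorm_ge0. Qed.

Lemma kernel_diff_le x x' z r : 0 < r -> enorm (x - x') <= r ->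
  2 * r <= enorm (x - z) -> `|K x' z - K x z| <= C * decay x r z.
Proof.
move=> r0 xx' rz; rewrite distrC.
have h : 2 * enorm (x - x') <= enorm (x - z) by apply: le_trans rz; rewrite ler_pM2l.
have xz0 : 0 < enorm (x - z) by apply: lt_le_trans rz; rewrite mulr_gt0.
apply: le_trans (_ : _ <= C / enorm (x - z) ^+ n * (enorm (x - x') / enorm (x - z)) `^ kappa) _.
  by apply: le_trans (kernel_regular hK h); rewrite lerDl.
rewrite /decay -mulrA ler_wpM2l ?(kernel_const_ge0 hK)// mulrC ler_wpM2r//.
  by rewrite invr_ge0 exprn_ge0// enorm_ge0.
rewrite ge0_ler_powR ?nnegrE ?divr_ge0 ?enorm_ge0 ?(ltW r0)//.
  exact: ltW (kernel_kappa_gt0 hK).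
by rewrite ler_pM2r// invr_gt0.
Qed.

Lemma measurable_decay x r : measurable_fun setT (decay x r).
Proof.
have mi : measurable_fun setT (fun z => (enorm (x - z))^-1).
  rewrite (_ : (fun z => _) = (fun z => enorm (x - z) `^ (-1))); last first.
    by apply/funext => z; rewrite powR_inv1// enorm_ge0.
  apply: (@measurableT_comp _ _ _ _ _ _ (@powR R ^~ (-1))) => //.
  exact: measurable_enorm_subl.
rewrite (_ : decay x r = fun z => (r * (enorm (x - z))^-1) `^ kappa * (enorm (x - z))^-1 ^+ n).
  apply: measurable_funM; last exact: measurable_funX.
  apply: (@measurableT_comp _ _ _ _ _ _ (@powR R ^~ kappa)) => //.
  exact: measurable_funM.
by apply/funext => z; rewrite /decay exprVn.
Qed.

Definition far_integral x r f : \bar R :=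
  (\int[mu]_(z in away x r) (decay x r z * `|f z|)%:E)%E.

(** The functions on which the modified operator acts: locally in [L^q], with
    enough decay in the mean at infinity. *)
Record admissible (q : R) f : Prop := {
  admissible_measurable : measurable_fun setT f;
  admissible_local : forall x r, 0 < r -> (Lq mu q (B x r) f < +oo)%E;
  admissible_far : forall x r, 0 < r -> (far_integral x r f < +oo)%E }.

Section one_function.
Variables (q : R) (f : V -> R).
Hypotheses (q1 : 1 <= q) (af : admissible q f).

Let mf (D : set V) : measurable_fun D f.
Proof. exact: measurable_funTS (admissible_measurable af). Qed.

Lemma admissible_integrable x r : 0 < r -> mu.-integrable (B x r) (EFin \o f).
Proof.
move=> r0; apply: (Lq_lty_integrable q1) => //; first exact: volume_cell_lty.
exact: admissible_local.
Qed.

Lemma kernel0_integrable x r : 0 < r ->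
  mu.-integrable (B x r) (EFin \o (fun z => kernel0 z * f z)).
Proof.
move=> r0; have := integrableZl (measurable_cell EuclideanBall x r) C
  (integrable_norm (admissible_integrable x r0)).
apply: le_integrable => //.
  apply/measurable_EFinP; apply: measurable_funM => //.
  exact: measurable_funTS measurable_kernel0.
move=> z _ /=; rewrite lee_fin [leLHS]normrM [leRHS]normrM normr_id ler_wpM2r//.
by rewrite (ger0_norm (kernel_const_ge0 hK)) kernel0_le.
Qed.

Lemma far_integrable x r : 0 < r ->
  mu.-integrable (away x r) (EFin \o (fun z => decay x r z * `|f z|)).
Proof.
move=> r0; apply/integrableP; split.
  apply/measurable_EFinP; apply: measurable_funM.
    exact: measurable_funTS (measurable_decay x r).
  exact: measurableT_comp.
apply: le_lt_trans (admissible_far af x r0); rewrite /far_integral.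
rewrite le_eqVlt; apply/orP; left; apply/eqP; apply: eq_integral => z _ /=.
by rewrite ger0_norm// mulr_ge0 ?decay_ge0.
Qed.

Lemma modified_integrandE x z :
  modified_integrand s K f x z = K x z * f z - kernel0 z * f z.
Proof. by rewrite /modified_integrand mulrBl. Qed.

Lemma measurable_modified_integrand x r : 0 < r ->
  measurable_fun (away x r) (modified_integrand s K f x).
Proof.
move=> r0; apply: measurable_funM => //; apply: measurable_funB.
  exact: measurable_kernel_section.
exact: measurable_funTS measurable_kernel0.
Qed.

(** Near the origin both kernels are bounded; far from it their difference is
    bounded by [decay]. *)
Lemma modified_integrable x r : 0 < r ->
  mu.-integrable (away x r) (EFin \o modified_integrand s K f x).
Proof.
move=> r0; pose rho := 2 * (enorm (0 - x) + d).
have rho0 : 0 < rho by rewrite mulr_gt0// ltr_wpDl ?enorm_ge0 ?sqrtn_gt0.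
pose g1 := (fun z => (C * r ^- n + C) * `|f z|) \_ (B 0 rho).
pose g2 := (fun z => C * (decay 0 rho z * `|f z|)) \_ (away 0 rho).
have ig1 : mu.-integrable setT (EFin \o g1).
  rewrite /g1 -restrict_EFin; apply/(integrable_mkcond _ (measurable_cell _ _ _)).
  exact: (integrableZl (measurable_cell _ _ _) _
    (integrable_norm (admissible_integrable 0 rho0))).
have ig2 : mu.-integrable setT (EFin \o g2).
  rewrite /g2 -restrict_EFin; apply/(integrable_mkcond _ (measurable_away _ _)).
  exact: (integrableZl (measurable_away _ _) _ (far_integrable 0 rho0)).
have := integrableS measurableT (measurable_away x r) (@subsetT _ _)
  (integrableD measurableT ig1 ig2).
apply: le_integrable => //.
  by apply/measurable_EFinP; exact: measurable_modified_integrand.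
move=> z rz; rewrite /= lee_fin.
have C0 := kernel_const_ge0 hK.
have g10 : 0 <= g1 z.
  by rewrite /g1 patchE; case: ifP => // _; rewrite mulr_ge0// addr_ge0// mulr_ge0// invr_ge0 exprn_ge0// ltW.
have g20 : 0 <= g2 z.
  by rewrite /g2 patchE; case: ifP => // _; apply: mulr_ge0 => //; apply: mulr_ge0 => //; exact: decay_ge0.
rewrite (ger0_norm (addr_ge0 g10 g20)).
have [zB|zB] := pselect (B 0 rho z).
  apply: (@le_trans _ _ (g1 z)); last by rewrite lerDl.
  rewrite /g1 patchE ifT ?inE// /modified_integrand normrM ler_wpM2r//.
  apply: (le_trans (ler_normB _ _)); apply: lerD; last exact: kernel0_le.
  exact: kernel_le.
have za : away 0 rho z by rewrite awayE.
apply: (@le_trans _ _ (g2 z)); last by rewrite lerDr.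
rewrite /g2 patchE ifT ?inE// mulrA /modified_integrand normrM ler_wpM2r//.
rewrite -/(kernel0 z) kernel0E; last first.
  apply: not_cell1; apply: le_trans za; rewrite /rho.
  by have := enorm_ge0 (0 - x); have := sqrtn_gt0 R n0; lra.
have h : 2 * (enorm (0 - x) + d) <= enorm (0 - z) by [].
apply: le_trans (kernel_diff_le (r := enorm (0 - x) + d) _ _ h) _.
- by rewrite ltr_wpDl ?enorm_ge0 ?sqrtn_gt0.
- by rewrite lerDl ltW// sqrtn_gt0.
- rewrite ler_wpM2l// /decay ler_wpM2r//.
    by rewrite invr_ge0 exprn_ge0// enorm_ge0.
  have : 0 <= enorm (0 - x) := enorm_ge0 _.
  have : 0 < d := sqrtn_gt0 R n0 => d0 x0.
  rewrite ge0_ler_powR ?nnegrE ?divr_ge0 ?enorm_ge0 ?(ltW rho0) ?addr_ge0 ?(ltW d0)//.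
    exact: ltW (kernel_kappa_gt0 hK).
  rewrite ler_wpM2r ?invr_ge0 ?enorm_ge0// /rho; lra.
Qed.

End one_function.
End modified_decomposition.

Section decomposition.
Context (R : realType) (n : nat) (s : cell_shape).
Local Notation V := 'rV[R]_n.
Local Notation mu := (@lebesgue_rV R n).
Local Notation d := (Num.sqrt n%:R : R).
Local Notation B := (cell EuclideanBall).
Variables (kappa C : R) (K : V -> V -> R).
Hypotheses (n0 : (0 < n)%N) (hK : standard_kernel kappa C K).
Implicit Types (f g h : V -> R) (x y z : V).
Local Notation k0 := (kernel0 s K).

(** The contribution of the far points, relative to the centre of the ball. *)
Definition smooth_part x (r : R) h y : R :=
  \int[mu]_(z in away x (2 * r)) ((K y z - K x z) * h z).

(** What depends neither on the point of the ball nor on the truncation. *)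
Definition constant_part x (r : R) h : R :=
  \int[mu]_(z in away x (2 * r)) modified_integrand s K h x z -
  \int[mu]_(z in B x (2 * r)) (k0 z * h z).

Lemma ball_sub_ball x y (r r' : R) : enorm (y - x) + r <= r' -> B y r `<=` B x r'.
Proof. exact: (sub_cell (s := EuclideanBall)). Qed.

Section one_function.
Variables (q : R) (h : V -> R).
Hypotheses (q1 : 1 <= q) (ah : admissible kappa q h).

Let mh (D : set V) : measurable_fun D h.
Proof. exact: measurable_funTS (admissible_measurable ah). Qed.

(** Splitting the domain at a ball [B x (2 r)]: inside it stands the truncated
    operator itself, outside it a function of [y] that varies little. *)
Lemma modified_truncated_split x (r : R) y (eta : R) :
  0 < eta -> eta <= r -> B x r y ->
  modified_truncated s K eta h y =
    truncated K eta (h \_ (B x (2 * r))) y + smooth_part x r h y +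
    constant_part x r h + \int[mu]_(z in B y eta) (k0 z * h z).
Proof.
move=> eta0 etar Bxy; have r0 : 0 < r by apply: lt_le_trans etar.
have r20 : 0 < 2 * r by rewrite mulr_gt0.
set E := B x (2 * r); set F := away x (2 * r).
have BE : B y eta `<=` E by apply: ball_sub_ball; move: Bxy; rewrite cellE/=; lra.
have mE : measurable E by exact: measurable_cell.
have mF : measurable F by exact: measurable_away.
have mA : measurable (away y eta) by [].
have FA : F `<=` away y eta.
  by rewrite /F !awayE; apply: subsetC.
have AEF : away y eta = (away y eta `&` E) `|` F.
  rewrite -[LHS](setIT) -(setUv E) setIUr; congr (_ `|` _).
  by rewrite -awayE -/F; apply/seteqP; split => [z []//|z Fz]; split => //; exact: FA.
have EB : E = (away y eta `&` E) `|` B y eta.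
  rewrite -[LHS]setTI -(setUv (B y eta)) setIUl setUC -awayE; congr (_ `|` _).
  by apply/seteqP; split => [z []//|z Bz]; split => //; exact: BE.
have imod := modified_integrable s n0 hK q1 ah.
have mAE : measurable (away y eta `&` E) by exact: measurableI.
have iAE : mu.-integrable (away y eta `&` E) (EFin \o modified_integrand s K h y).
  by apply: (integrableS mA mAE); [exact: subIsetl|exact: imod].
have iF : mu.-integrable F (EFin \o modified_integrand s K h y).
  by apply: (integrableS mA mF) => //; exact: imod.
have iFx : mu.-integrable F (EFin \o modified_integrand s K h x) by exact: imod.
have ik0E : mu.-integrable E (EFin \o (fun z => k0 z * h z)).
  exact: (kernel0_integrable s n0 hK q1 ah).
have ik0 : mu.-integrable (away y eta `&` E) (EFin \o (fun z => k0 z * h z)).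
  by apply: (integrableS mE mAE) => //; exact: subIsetr.
have iK : mu.-integrable (away y eta `&` E) (EFin \o (fun z => K y z * h z)).
  have := integrableD mAE iAE ik0; apply: eq_integrable => // z _ /=.
  by rewrite modified_integrandE -EFinD subrK.
have -> : modified_truncated s K eta h y =
    \int[mu]_(z in away y eta `&` E) modified_integrand s K h y z +
    \int[mu]_(z in F) modified_integrand s K h y z.
  rewrite /modified_truncated -Rintegral_setU//; first by rewrite -AEF.
    by rewrite -AEF; exact: imod.
  apply/disj_set2P; rewrite /F [away x _]awayE -setIA.
  by rewrite setICr setI0.
have -> : \int[mu]_(z in F) modified_integrand s K h y z =
    smooth_part x r h y + \int[mu]_(z in F) modified_integrand s K h x z.
  have iFyx : mu.-integrable F (EFin \o (fun z => (K y z - K x z) * h z)).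
    have := integrableB mF iF iFx; apply: eq_integrable => // z _ /=.
    by rewrite !modified_integrandE -EFinB; congr EFin; ring.
  rewrite -RintegralD//; apply: eq_Rintegral => z _.
  by rewrite !modified_integrandE; ring.
have -> : \int[mu]_(z in away y eta `&` E) modified_integrand s K h y z =
    truncated K eta (h \_ E) y - \int[mu]_(z in away y eta `&` E) (k0 z * h z).
  have -> : truncated K eta (h \_ E) y = \int[mu]_(z in away y eta `&` E) (K y z * h z).
    rewrite Rintegral_mkcondr; apply: eq_Rintegral => z _.
    by rewrite !patchE; case: ifP => // _; rewrite mulr0.
  rewrite -RintegralB//; apply: eq_Rintegral => z _.
  by rewrite modified_integrandE.
rewrite /constant_part -/E -/F.
have -> : \int[mu]_(z in E) (k0 z * h z) =
    \int[mu]_(z in away y eta `&` E) (k0 z * h z) + \int[mu]_(z in B y eta) (k0 z * h z).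
  rewrite -Rintegral_setU//; [by rewrite -EB..|].
  by apply/disj_set2P; rewrite awayE setIAC setICl set0I.
ring.
Qed.

Lemma smooth_part_le x (r : R) y : 0 < r -> B x r y ->
  `|smooth_part x r h y| <= C * fine (far_integral kappa x r h).
Proof.
move=> r0; rewrite cellE/= => xy; have r20 : 0 < 2 * r by rewrite mulr_gt0.
have mF : measurable (away x (2 * r)) by [].
have FF : away x (2 * r) `<=` away x r.
  by move=> z /=; apply: le_trans; lra.
have ifar := far_integrable ah.
have iF : mu.-integrable (away x (2 * r))
    (EFin \o (fun z => C * (decay kappa x r z * `|h z|))).
  exact: (integrableZl mF C (integrableS (measurable_away x r) mF FF (ifar x r r0))).
have iFK : mu.-integrable (away x (2 * r)) (EFin \o (fun z => (K y z - K x z) * h z)).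
  apply: le_integrable iF => //.
    apply/measurable_EFinP; apply: measurable_funM => //.
    apply: measurable_funB; last exact: (measurable_kernel_section n0 hK).
    apply: (measurable_funS (measurable_away y r)); last first.
      exact: (measurable_kernel_section n0 hK).
    move=> z /= xz; have := enormD (x - y) (y - z); rewrite addrA subrK.
    by move: xz; rewrite (enorm_distC x y) /away/=; lra.
  move=> z xz /=; rewrite lee_fin normrM mulrA normrM normr_id ler_wpM2r//.
  rewrite [leRHS]ger0_norm; last first.
    by apply: mulr_ge0; [exact: kernel_const_ge0 hK|exact: decay_ge0].
  by apply: (kernel_diff_le hK) => //; rewrite enorm_distC ltW.
apply: (le_trans (le_normr_Rintegral mF iFK)).
have -> : fine (far_integral kappa x r h) = \int[mu]_(z in away x r) (decay kappa x r z * `|h z|) by [].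
rewrite -RintegralZl//; last exact: ifar.
apply: le_trans (_ : _ <= \int[mu]_(z in away x (2 * r)) (C * (decay kappa x r z * `|h z|))) _.
  apply: le_Rintegral => //; first exact: integrable_norm.
  move=> z xz; rewrite normrM mulrA ler_wpM2r//.
  by apply: (kernel_diff_le hK) => //; rewrite enorm_distC ltW.
rewrite /Rintegral fine_le//.
- exact: integrable_fin_num.
- apply: integrable_fin_num => //.
  exact: (integrableZl (measurable_away x r) C (ifar x r r0)).
- apply: ge0_subset_integral => //.
    apply/measurable_EFinP; apply: measurable_funM => //; apply: measurable_funM.
      exact: measurable_funTS (measurable_decay _ _ _).
    exact: measurableT_comp.
  move=> z _; rewrite lee_fin; apply: mulr_ge0; first exact: kernel_const_ge0 hK.
  by apply: mulr_ge0 => //; exact: decay_ge0.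
Qed.

Lemma kernel0_part_le x y (r eta : R) : 1 < q -> 0 < eta -> B y eta `<=` B x r -> 0 < r ->
  `|\int[mu]_(z in B y eta) (k0 z * h z)| <=
    C * (fine (Lq mu q (B x r) h) * ((2 * eta) ^+ n) `^ (1 - q^-1)).
Proof.
move=> q1' eta0 sub r0; have q0 : 0 < q by apply: lt_trans q1'.
have mB : measurable (B y eta) by [].
have ik0 := kernel0_integrable s n0 hK q1 ah y eta0.
have ih := integrable_norm (admissible_integrable q1 ah y eta0).
apply: (le_trans (le_normr_Rintegral mB ik0)).
apply: (@le_trans _ _ (\int[mu]_(z in B y eta) (C * `|h z|))).
  apply: le_Rintegral => //; first exact: integrable_norm.
    exact: (integrableZl mB C ih).
  by move=> z _; rewrite normrM ler_wpM2r// (kernel0_le s hK).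
rewrite RintegralZl// ler_wpM2l ?(kernel_const_ge0 hK)//.
have Lfin (z : V) (t : R) : 0 < t -> Lq mu q (B z t) h \is a fin_num.
  by move=> t0; rewrite ge0_fin_numE ?Lq_ge0//; exact: (admissible_local ah z t0).
rewrite -lee_fin EFinM fineK; last exact: integrable_fin_num ih.
rewrite fineK ?Lfin//.
apply: (@le_trans _ _ (Lq mu q (B y eta) h * mu (B y eta) `^ (1 - q^-1))%E).
  exact: Lq_holder.
apply: lee_pmul; rewrite ?Lq_ge0 ?poweR_ge0//.
  exact: Lq_subset.
rewrite volumeE// poweR_EFin lee_fin ge0_ler_powR ?nnegrE ?volume_le//.
- by rewrite subr_ge0 invf_le1// ltW.
- exact: ltW (volume_gt0 n0 _ _ eta0).
- by rewrite exprn_ge0// mulr_ge0// ltW.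
Qed.

End one_function.
End decomposition.

(** * Integrals over dyadic shells *)

Lemma powR_expn (R : realType) (x a : R) k : 0 <= x -> (x `^ a) ^+ k = (x ^+ k) `^ a.
Proof.
move=> x0; rewrite -(powR_mulrn _ (powR_ge0 x a)) -(powR_mulrn _ x0).
by rewrite -!powRrM mulrC.
Qed.

Section shells.
Context (R : realType) (n : nat).
Local Notation V := 'rV[R]_n.
Local Notation mu := (@lebesgue_rV R n).
Local Notation B := (cell EuclideanBall).
Implicit Types (f g h : V -> R) (x y z : V).

Lemma nneseries_geometric_le (M rho : R) : 0 <= M -> 0 <= rho -> rho < 1 ->
  (\sum_(0 <= k <oo) (M * rho ^+ k)%:E <= (M / (1 - rho))%:E)%E.
Proof.
move=> M0 rho0 rho1; apply: lime_le.
  by apply: is_cvg_nneseries => k _ _; rewrite lee_fin mulr_ge0// exprn_ge0.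
apply: nearW => N; rewrite sumEFin lee_fin -mulr_sumr ler_wpM2l//.
rewrite big_mkord; have d0 : 0 < 1 - rho by rewrite subr_gt0.
rewrite -[leRHS]mul1r ler_pdivlMr// mulrC -opprB mulNr -subrX1 opprB.
by rewrite lerBlDr lerDl exprn_ge0.
Qed.

(** On the shell between the radii [2 ^+ k * r] and [2 ^+ k.+1 * r] the decay is at most
    [2^-1 `^ kappa ^+ k] over the volume. *)
Lemma far_integral_le kappa x (r M theta : R) f : 0 < r -> 0 <= M -> 0 <= theta ->
  0 < kappa -> theta * 2^-1 `^ kappa < 1 -> measurable_fun setT f ->
  (forall k, (\int[mu]_(z in B x (2 ^+ k.+1 * r)) `|f z|%:E <=
    (M * (2 ^+ k * r) ^+ n * theta ^+ k)%:E)%E) ->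
  (far_integral kappa x r f <= (M / (1 - theta * 2^-1 `^ kappa))%:E)%E.
Proof.
move=> r0 M0 theta0 kappa0 theta1 mf hM.
pose F k : set V := away x (2 ^+ k * r) `&` B x (2 ^+ k.+1 * r).
have pr k : 0 < 2 ^+ k * r by rewrite mulr_gt0// exprn_gt0.
have mF k : measurable (F k).
  by apply: measurableI; [exact: measurable_away|exact: measurable_cell].
have FE : away x r = \bigcup_k F k.
  apply/seteqP; split => z; last first.
    move=> [k _ [+ _]]; rewrite /away/=; apply: le_trans.
    by rewrite -[leLHS]mul1r ler_pM2r// exprn_ege1// ler1n.
  rewrite /away/= => rz.
  have : exists N, enorm (x - z) < 2 ^+ N * r.
    exists (Num.Def.archi_bound (enorm (x - z) / r)).
    by rewrite -ltr_pdivrMr//; exact: upper_nthrootP.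
  move=> /ex_minnP[[|N]]; first by rewrite expr0 mul1r ltNge rz.
  move=> hN hmin; exists N => //; split; last by rewrite cellE/= enorm_distC.
  by rewrite /away/= leNgt; apply/negP => /hmin; rewrite ltnn.
have tF : trivIset setT F.
  apply/trivIsetP => i j _ _; wlog ij : i j / (i < j)%N.
    move=> wl; rewrite neq_ltn => /orP[] ij; first by apply: wl => //; rewrite ltn_eqF.
    by rewrite setIC; apply: wl => //; rewrite ltn_eqF.
  move=> _; apply/seteqP; split => // z [[_ zi] [zj _]].
  move: zi zj; rewrite cellE /away/= enorm_distC => zi zj.
  have := le_lt_trans zj zi; rewrite ltr_pM2r// ltNge ler_eXn2l ?ltr1n//.
  by rewrite ij.
have mg (D : set V) : measurable_fun D (fun z => (decay kappa x r z * `|f z|)%:E).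
  apply/measurable_EFinP; apply: measurable_funM.
    exact: measurable_funTS (measurable_decay _ _ _).
  by apply: measurableT_comp => //; exact: measurable_funTS.
have g0 z : (0 <= (decay kappa x r z * `|f z|)%:E)%E.
  by rewrite lee_fin; apply: mulr_ge0 => //; exact: decay_ge0.
have c0 : 0 <= 2^-1 `^ kappa :> R by exact: powR_ge0.
rewrite /far_integral FE ge0_integral_bigcup//.
apply: le_trans (nneseries_geometric_le M0 _ theta1); last by rewrite mulr_ge0.
apply: lee_nneseries => k _; first by move=> _; exact: integral_ge0.
have mB := measurable_cell EuclideanBall x (2 ^+ k.+1 * r).
have mfB : measurable_fun (B x (2 ^+ k.+1 * r)) (fun z => `|f z|%:E).
  apply/measurable_EFinP; apply: measurableT_comp => //; exact: measurable_funTS.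
pose a := (2^-1 `^ kappa) ^+ k * (2 ^+ k * r) ^- n.
have a0 : 0 <= a by rewrite mulr_ge0 ?exprn_ge0// invr_ge0 exprn_ge0// ltW.
apply: (@le_trans _ _ (\int[mu]_(z in B x (2 ^+ k.+1 * r)) (a%:E * `|f z|%:E))%E).
  apply: le_trans (_ : (_ <= \int[mu]_(z in F k) (a%:E * `|f z|%:E))%E) _.
    apply: ge0_le_integral => //.
      apply: measurable_funeM; apply: measurable_funS mfB => //; exact: subIsetr.
    move=> z [zk _]; rewrite -EFinM lee_fin ler_wpM2r//.
    have z0 : 0 < enorm (x - z) by apply: lt_le_trans zk.
    rewrite /decay /a; apply: ler_pM; rewrite ?powR_ge0 ?invr_ge0 ?exprn_ge0 ?enorm_ge0//.
      rewrite powR_expn ?invr_ge0//.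
      rewrite ge0_ler_powR ?nnegrE ?divr_ge0 ?exprn_ge0 ?invr_ge0 ?enorm_ge0 ?(ltW r0) ?(ltW kappa0)//.
      rewrite ler_pdivrMr// -ler_pdivrMl ?exprn_gt0 ?invr_gt0//.
      by rewrite exprVn invrK.
    by rewrite lef_pV2 ?posrE ?exprn_gt0// lerXn2r ?nnegrE ?enorm_ge0// ltW.
  apply: ge0_subset_integral => //; first exact: measurable_funeM.
    by move=> z _; rewrite mule_ge0.
  exact: subIsetr.
rewrite ge0_integralZl//.
apply: (@le_trans _ _ (a%:E * (M * (2 ^+ k * r) ^+ n * theta ^+ k)%:E)%E).
  by rewrite lee_wpmul2l ?lee_fin.
rewrite -EFinM lee_fin /a le_eqVlt; apply/orP; left; apply/eqP.
rewrite [in RHS]exprMn; have : (2 ^+ k * r) ^+ n != 0 by rewrite gt_eqF// exprn_gt0.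
set u := (2 ^+ k * r) ^+ n => u0; set v := _ ^+ k; set w := theta ^+ k.
by field.
Qed.

End shells.

(** * The action on constants *)

Lemma half_powR_lt1 (R : realType) (a : R) : 0 < a -> 2^-1 `^ a < 1.
Proof.
move=> a0; apply: (@lt_le_trans _ _ (1 `^ a)); last by rewrite powR1.
rewrite gt0_ltr_powR ?nnegrE ?invr_ge0//.
by rewrite invf_lt1// ltr1n.
Qed.

Section admissible_closed.
Context (R : realType) (n : nat).
Local Notation V := 'rV[R]_n.
Local Notation mu := (@lebesgue_rV R n).
Local Notation B := (cell EuclideanBall).
Variables (kappa q : R).
Hypotheses (kappa0 : 0 < kappa) (q1 : 1 <= q).

Let q0 : 0 < q. Proof. exact: lt_le_trans q1. Qed.

Lemma far_integral_cst_le (x : V) (r c : R) : 0 < r ->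
  (far_integral kappa x r (cst c) <= (`|c| * 4 ^+ n / (1 - 2^-1 `^ kappa))%:E)%E.
Proof.
move=> r0; rewrite -[X in (1 - X)]mul1r; apply: far_integral_le => //.
  by rewrite mul1r half_powR_lt1.
move=> k; have pr : 0 < 2 ^+ k.+1 * r by rewrite mulr_gt0// exprn_gt0.
rewrite (eq_integral (cst `|c|%:E))// integral_cst; last exact: measurable_cell.
rewrite volumeE// -EFinM lee_fin expr1n mulr1 -mulrA ler_wpM2l//.
apply: (le_trans (volume_le _ _ pr)); rewrite -exprMn exprS.
by rewrite le_eqVlt; apply/orP; left; apply/eqP; congr (_ ^+ _); ring.
Qed.

Lemma admissible_cst (c : R) : admissible kappa q (cst c : V -> R).
Proof.
split => // x r r0.
  rewrite Lq_cst// lte_mul_pinfty ?lee_fin//.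
  by rewrite poweR_lty// volume_cell_lty.
exact: le_lt_trans (far_integral_cst_le _ _ r0) (ltry _).
Qed.

Lemma admissible_lin (a : R) (f g : V -> R) :
  admissible kappa q f -> admissible kappa q g ->
  admissible kappa q (fun x => a * f x + g x).
Proof.
move=> af ag; have mf := admissible_measurable af; have mg := admissible_measurable ag.
have maf : measurable_fun setT (fun x => a * f x) by exact: measurable_funM.
split; first exact: measurable_funD.
  move=> x r r0; have mB : measurable (B x r) by exact: measurable_cell.
  apply: le_lt_trans (LqD (f := fun x => a * f x) mu q1 mB _ _) _ => //.
  - exact: measurable_funTS.
  - exact: measurable_funTS.
  rewrite LqZ//; last exact: measurable_funTS.
  rewrite lte_add_pinfty//; last exact: admissible_local ag _ _ r0.
  by rewrite lte_mul_pinfty ?lee_fin//; exact: admissible_local af _ _ r0.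
move=> x r r0; have mA : measurable (away x r) by exact: measurable_away.
have := integrableD mA (integrableZl mA `|a| (far_integrable af x r0)) (far_integrable ag x r0).
move=> /integrableP[_]; apply: le_lt_trans.
have md (h : V -> R) : measurable_fun setT h ->
    measurable_fun (away x r) (fun z => decay kappa x r z * `|h z|).
  move=> mh; apply: measurable_funM.
    exact: measurable_funTS (measurable_decay _ _ _).
  by apply: measurableT_comp => //; exact: measurable_funTS.
apply: ge0_le_integral => //.
- by move=> z _; rewrite lee_fin; apply: mulr_ge0 => //; exact: decay_ge0.
- by apply/measurable_EFinP; apply: md; exact: measurable_funD.
- apply: measurableT_comp => //; apply/measurable_EFinP.
  by apply: measurable_funD; [apply: measurable_funM => //|]; exact: md.
move=> z _ /=; rewrite lee_fin.
have d0 := decay_ge0 kappa x r z.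
apply: le_trans (ler_norm _).
apply: (@le_trans _ _ (decay kappa x r z * (`|a| * `|f z| + `|g z|))).
  by rewrite ler_wpM2l// -normrM ler_normD.
by rewrite le_eqVlt; apply/orP; left; apply/eqP; ring.
Qed.

End admissible_closed.

Section modified_constant.
Context (R : realType) (n : nat) (s : cell_shape).
Local Notation V := 'rV[R]_n.
Local Notation mu := (@lebesgue_rV R n).
Local Notation d := (Num.sqrt n%:R : R).
Local Notation B := (cell EuclideanBall).
Variables (kappa C : R) (K : V -> V -> R).
Hypotheses (n0 : (0 < n)%N) (hK : standard_kernel kappa C K).
Local Notation k0 := (kernel0 s K).
Let kappa0 := kernel_kappa_gt0 hK.
Let C0 := kernel_const_ge0 hK.

Lemma modified_truncated_lin q eta (a : R) (f g : V -> R) (x : V) : 0 < eta -> 1 <= q ->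
  admissible kappa q f -> admissible kappa q g ->
  modified_truncated s K eta (fun y => a * f y + g y) x =
  a * modified_truncated s K eta f x + modified_truncated s K eta g x.
Proof.
move=> eta0 q1 af ag; have mA : measurable (away x eta) by exact: measurable_away.
have iff := modified_integrable s n0 hK q1 af x eta0.
have ig := modified_integrable s n0 hK q1 ag x eta0.
rewrite /modified_truncated -RintegralZl// -RintegralD//.
  by apply: eq_Rintegral => z _; rewrite /modified_integrand; ring.
exact: (integrableZl mA a iff).
Qed.

(** Thin annuli of large radius are small compared with the balls they bound:
    otherwise many disjoint ones would fill more than a ball. *)
Lemma thin_annulus (a e R0 : R) : 0 <= a -> 0 < e -> exists r, [/\ R0 <= r, a < r &
  volume EuclideanBall (0 : V) (r + a) - volume EuclideanBall (0 : V) (r - a) <= e * r ^+ n].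
Proof.
move=> a0 e0; pose v r := volume EuclideanBall (0 : V) r.
pose m := Num.Def.archi_bound (4 ^+ n / e).
have hm : 4 ^+ n / e < m%:R by apply: archi_boundP; rewrite divr_ge0 ?exprn_ge0// ltW.
pose rho : R := `|R0| + 2 * a * m%:R + a + 1.
have am : 0 <= 2 * a * m%:R by rewrite !mulr_ge0.
have R00 : 0 <= `|R0| by [].
have rho0 : 0 < rho by rewrite /rho; lra.
pose r (i : nat) : R := rho + 2 * a * i%:R.
have rrho i : rho <= r i by rewrite /r lerDl !mulr_ge0.
apply: contrapT => h.
(* If every radius [r i] failed, the [m] disjoint annuli about them would have
   more volume than the ball that contains them. *)
have {}h i : e * rho ^+ n < v (r i + a) - v (r i - a).
  rewrite ltNge; apply/negP => hi; apply: h; exists (r i); split.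
  - apply: le_trans (rrho i); apply: (le_trans (ler_norm R0)); rewrite /rho; lra.
  - by apply: lt_le_trans (rrho i); rewrite /rho; lra.
  - apply: (le_trans hi); rewrite ler_pM2l// lerXn2r ?nnegrE ?(ltW rho0)//.
    exact: (le_trans (ltW rho0) (rrho i)).
have sum k : k%:R * (e * rho ^+ n) <= v (r k - a).
  elim: k => [|k ih].
    by rewrite mul0r; apply: fine_ge0.
  have := h k; have -> : r k + a = r k.+1 - a.
    by rewrite /r -[k.+1]addn1 natrD; ring.
  rewrite -[k.+1]addn1 natrD mulrDl mul1r; lra.
have rm : 0 < r m - a by have := rrho m; rewrite /rho; lra.
have := le_trans (sum m) (volume_le _ _ rm); apply/negP; rewrite -ltNge.
apply: (@le_lt_trans _ _ ((4 * rho) ^+ n)).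
  rewrite lerXn2r ?nnegrE ?mulr_ge0 ?(ltW rho0) ?(ltW rm)//.
  have : 2 * a * m%:R <= rho by rewrite /rho; lra.
  by rewrite /r; lra.
rewrite exprMn mulrA ltr_pM2r ?exprn_gt0//.
by rewrite -ltr_pdivrMr.
Qed.

Lemma kernel0_ball_integrable (x : V) r : 0 < r -> mu.-integrable (B x r) (EFin \o k0).
Proof.
move=> r0; have := kernel0_integrable s n0 hK (lexx 1)
  (admissible_cst n kappa0 (lexx 1) 1) x r0.
by apply: eq_integrable => // z _ /=; rewrite mulr1.
Qed.

Definition kernel0_mass : R := \int[mu]_(z in B 0 d) k0 z.

Hypothesis cancel : forall x (r r' : R), 0 < r -> r < r' ->
  \int[mu]_(y in [set y | r <= enorm (x - y) < r']) K x y = 0.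

Lemma shellE (x : V) r r' : [set y | r <= enorm (x - y) < r'] = away x r `&` B x r'.
Proof.
apply/seteqP; split => y; rewrite cellE /away/= (enorm_distC y x); first by move=> /andP[].
by move=> [-> ->].
Qed.

Lemma ball_shell (x : V) r r' : r <= r' -> B x r' = (away x r `&` B x r') `|` B x r.
Proof.
move=> rr'; rewrite -[LHS]setTI -(setUv (B x r)) setIUl setUC -awayE; congr (_ `|` _).
apply/seteqP; split => [z []//|z Bz]; split => //.
by move: Bz; rewrite !cellE/= => /lt_le_trans; exact.
Qed.

Lemma shell_disj (x : V) r r' : [disjoint away x r `&` B x r' & B x r].
Proof. by apply/disj_set2P; rewrite awayE setIAC setICl set0I. Qed.

Lemma measurable_shell (x : V) r r' : measurable (away x r `&` B x r').
Proof. by apply: measurableI; [exact: measurable_away|exact: measurable_cell]. Qed.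

(** The shells that fill up a larger ball contribute nothing, by cancellation. *)
Lemma kernel0_massE r : d <= r -> \int[mu]_(z in B 0 r) k0 z = kernel0_mass.
Proof.
rewrite le_eqVlt => /predU1P[<-//|dr].
have d0 := sqrtn_gt0 R n0; have r0 : 0 < r by exact: lt_trans dr.
have iB := kernel0_ball_integrable 0 r0.
rewrite (ball_shell 0 (ltW dr)) Rintegral_setU//.
- rewrite (_ : \int[mu]_(z in _ `&` _) _ = 0) ?add0r//.
  rewrite -[RHS](cancel 0 d0 dr) shellE; apply: eq_Rintegral => z.
  by rewrite inE => -[dz _]; rewrite kernel0E//; exact: not_cell1.
- exact: measurable_shell.
- by rewrite -(ball_shell 0 (ltW dr)).
- exact: shell_disj.
Qed.

(** Outside a large ball [B y r] the two kernels nearly cancel. Inside it the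
    integral of [K y] over the shell vanishes, and that of [k0] equals
    [kernel0_mass] up to the integral over a subset of a thin annulus. *)
Lemma modified_truncated_cst (eta : R) (y : V) : 0 < eta ->
  modified_truncated s K eta (cst 1) y = - kernel0_mass + \int[mu]_(z in B y eta) k0 z.
Proof.
move=> eta0; pose a := enorm y; pose rho : R := a + d.
have a0 : 0 <= a := enorm_ge0 y; have d0 : 0 < d := sqrtn_gt0 R n0.
have rho0 : 0 < rho by rewrite ltr_wpDl.
have ac q := admissible_cst n kappa0 q (1 : R).
have imod := modified_integrable s n0 hK (lexx 1) (ac 1 (lexx 1)) y.
set A := modified_truncated _ _ _ _ _; set I := \int[mu]_(z in B y eta) k0 z.
suff h (e : R) : 0 < e -> `|A + kernel0_mass - I| <= e.
  have /eqP : `|A + kernel0_mass - I| = 0.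
    apply/eqP; rewrite eq_le normr_ge0 andbT; apply/ler_addgt0Pr => e /h.
    by rewrite add0r.
  by rewrite normr_eq0 => /eqP h0; apply/eqP; rewrite -subr_eq0 -h0; apply/eqP; ring.
move=> e0; pose D := 4 ^+ n / (1 - 2^-1 `^ kappa) : R.
have D0 : 0 < D by rewrite divr_gt0 ?exprn_gt0// subr_gt0 half_powR_lt1.
pose b : R := (e / (2 * (C + 1) * D)) `^ kappa^-1.
have C1 : 0 < C + 1 by rewrite ltr_wpDl.
have CD0 : 0 < 2 * (C + 1) * D by apply: mulr_gt0 => //; exact: mulr_gt0.
have b0 : 0 < b by rewrite powR_gt0// divr_gt0.
pose e' : R := e / (2 * (C + 1) * 2 ^+ n).
have CD1 : 0 < 2 * (C + 1) * 2 ^+ n by rewrite !mulr_gt0 ?exprn_gt0.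
have e'0 : 0 < e' by rewrite divr_gt0.
have [r [hr ar thin]] := thin_annulus (2 * rho + eta + 1 + rho / b) a0 e'0.
have rb0 : 0 < rho / b by rewrite divr_gt0.
have r2 : 2 * rho <= r by lra.
have rho2 : rho = a + d by [].
have er : eta < r by lra.
have r0 : 0 < r by lra.
have ra0 : 0 < r - a by rewrite subr_gt0.
have mS := measurable_shell y eta r.
have mr : measurable (away y r) by exact: measurable_away.
have me : measurable (away y eta) by exact: measurable_away.
have ar_sub : away y r `<=` away y eta.
  by move=> z; rewrite /away/=; apply: le_trans; exact: ltW.
have AE : away y eta = (away y eta `&` B y r) `|` away y r.
  rewrite -[LHS]setIT -(setUv (B y r)) setIUr; congr (_ `|` _).
  by rewrite -awayE; apply/seteqP; split => [z []//|z Fz]; split => //; exact: ar_sub.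
have iS : mu.-integrable (away y eta `&` B y r) (EFin \o modified_integrand s K (cst 1) y).
  by apply: (integrableS me mS); [exact: subIsetl|exact: imod].
have ikr := kernel0_ball_integrable y r0.
have ikS : mu.-integrable (away y eta `&` B y r) (EFin \o k0).
  by apply: (integrableS (measurable_cell EuclideanBall y r) mS) => //; exact: subIsetr.
have A1 : A = \int[mu]_(z in away y eta `&` B y r) modified_integrand s K (cst 1) y z +
    \int[mu]_(z in away y r) modified_integrand s K (cst 1) y z.
  rewrite -Rintegral_setU//; first by rewrite -AE.
    by rewrite -AE; exact: imod.
  by apply/disj_set2P; rewrite [away y r]awayE -setIA setICr setI0.
have S1 : \int[mu]_(z in away y eta `&` B y r) modified_integrand s K (cst 1) y z =
    - \int[mu]_(z in away y eta `&` B y r) k0 z.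
  have iKS : mu.-integrable (away y eta `&` B y r) (EFin \o K y).
    have := integrableD mS iS ikS; apply: eq_integrable => // z _ /=.
    by rewrite modified_integrandE -EFinD /= !mulr1 subrK.
  transitivity (\int[mu]_(z in away y eta `&` B y r) (K y z - k0 z)).
    by apply: eq_Rintegral => z _; rewrite modified_integrandE /= !mulr1.
  by rewrite RintegralB// -shellE cancel// sub0r shellE.
have I1 : \int[mu]_(z in B y r) k0 z = \int[mu]_(z in away y eta `&` B y r) k0 z + I.
  rewrite {1}(ball_shell y (ltW er)) Rintegral_setU//.
  - by rewrite -(ball_shell y (ltW er)).
  - exact: shell_disj.
have sub0 : B 0 (r - a) `<=` B y r.
  by apply: ball_sub_ball; rewrite sub0r enormN -/a; lra.
have suby : B y r `<=` B 0 (r + a).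
  by apply: ball_sub_ball; rewrite subr0 -/a; lra.
have mD : measurable (B y r `\` B 0 (r - a)).
  by apply: measurableD; exact: measurable_cell.
have iD : mu.-integrable (B y r `\` B 0 (r - a)) (EFin \o k0).
  by apply: (integrableS (measurable_cell EuclideanBall y r) mD) => //; exact: subDsetl.
have J1 : \int[mu]_(z in B y r) k0 z =
    kernel0_mass + \int[mu]_(z in B y r `\` B 0 (r - a)) k0 z.
  rewrite -[B y r in LHS](setDUK sub0) Rintegral_setU//.
  - by rewrite kernel0_massE//; lra.
  - by rewrite setDUK.
  - by apply/disj_set2P; rewrite setDIK.
have J2 : `|\int[mu]_(z in B y r `\` B 0 (r - a)) k0 z| <= e / 2.
  apply: (le_trans (le_normr_Rintegral mD iD)).
  have muD : (mu (B y r `\` B 0 (r - a)) <=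
      (volume EuclideanBall (0 : V) (r + a) - volume EuclideanBall (0 : V) (r - a))%:E)%E.
    rewrite measureD//; last exact: volume_cell_lty.
    rewrite EFinB -!volumeE//; last by lra.
    have -> : B y r `&` B 0 (r - a) = B 0 (r - a) by rewrite setIC; exact/setIidPl.
    apply: leeB => //.
    by apply: le_measure; [apply/mem_set; exact: measurable_cell..|].
  have muDfin : mu (B y r `\` B 0 (r - a)) \is a fin_num.
    by rewrite ge0_fin_numE//; exact: le_lt_trans muD (ltry _).
  apply: (@le_trans _ _ (\int[mu]_(z in B y r `\` B 0 (r - a)) (C * (r - a) ^- n))).
    apply: le_Rintegral => //; first exact: integrable_norm.
      apply/integrableP; split; first exact/measurable_EFinP.
      rewrite integral_cst// lte_mul_pinfty//.
      by rewrite -ge0_fin_numE.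
    move=> z [_]; rewrite cellE/= subr0 => /negP; rewrite -leNgt => rz.
    have [zc|zc] := pselect (cell s 0 1 z).
      by rewrite kernel0_eq0// normr0 mulr_ge0// invr_ge0 exprn_ge0// ltW.
    by rewrite kernel0E// (kernel_le hK)// sub0r enormN.
  rewrite Rintegral_cst//.
  apply: (@le_trans _ _ (C * (r - a) ^- n * (e' * r ^+ n))).
    rewrite ler_wpM2l//; first by rewrite mulr_ge0// invr_ge0 exprn_ge0// ltW.
    by apply: le_trans thin; rewrite -lee_fin fineK.
  apply: (@le_trans _ _ ((C + 1) * (2 ^+ n * r ^- n) * (e' * r ^+ n))).
    apply: ler_wpM2r; first by apply: mulr_ge0; [exact: ltW|exact/exprn_ge0/ltW].
    apply: ler_pM; rewrite ?invr_ge0 ?exprn_ge0 ?(ltW ra0)// ?lerDl//.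
    rewrite -exprVn -exprVn -exprMn lerXn2r ?nnegrE ?invr_ge0 ?mulr_ge0 ?invr_ge0 ?(ltW r0) ?(ltW ra0)//.
    by rewrite -[2 / r]invrK lef_pV2 ?posrE ?invr_gt0 ?divr_gt0// invf_div; lra.
  rewrite le_eqVlt; apply/orP; left; apply/eqP; rewrite /e'.
  have : r ^+ n != 0 by rewrite gt_eqF// exprn_gt0.
  have : (2 : R) ^+ n != 0 by rewrite gt_eqF// exprn_gt0.
  have : C + 1 != 0 by rewrite gt_eqF.
  set u := r ^+ n; set v := 2 ^+ n => *; field; apply/and3P; split => //.
have J3 : `|\int[mu]_(z in away y r) modified_integrand s K (cst 1) y z| <= e / 2.
  have iar := imod _ r0.
  have ifar := far_integrable (ac 1 (lexx 1)) y r0.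
  apply: (le_trans (le_normr_Rintegral mr iar)).
  pose c := (rho / r) `^ kappa.
  have c0 : 0 <= c := powR_ge0 _ _.
  apply: (@le_trans _ _ (\int[mu]_(z in away y r) (C * c * (decay kappa y r z * `|cst 1 z|)))).
    apply: le_Rintegral => //; first exact: integrable_norm.
      exact: (integrableZl mr (C * c) ifar).
    move=> z yz; rewrite modified_integrandE /= normr1 !mulr1.
    have yz2 : 2 * rho <= enorm (y - z) by apply: le_trans yz.
    have z0 : 0 < enorm (y - z) by apply: lt_le_trans yz.
    rewrite kernel0E; last first.
      apply: not_cell1 => //; have := enormD (y - z) (z - 0).
      rewrite addrA subrK subr0 -/a sub0r enormN.
      have := enormD y (- z); rewrite enormN -/a => h1 h2.
      by lra.
    rewrite distrC; apply: le_trans (kernel_diff_le hK rho0 _ yz2) _.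
      by rewrite subr0 -/a /rho lerDl ltW.
    rewrite -mulrA ler_wpM2l// /decay mulrA ler_wpM2r ?invr_ge0 ?exprn_ge0 ?enorm_ge0//.
    rewrite /c -powRM ?divr_ge0 ?enorm_ge0 ?(ltW r0) ?(ltW rho0)//.
    by rewrite mulrA divfK ?gt_eqF.
  rewrite RintegralZl//.
  have -> : \int[mu]_(z in away y r) (decay kappa y r z * `|cst 1 z|) =
    fine (far_integral kappa y r (cst 1)) by [].
  have hfar : fine (far_integral kappa y r (cst 1)) <= D.
    have h1 := far_integral_cst_le kappa0 y 1 r0.
    rewrite normr1 mul1r -/D in h1.
    rewrite -lee_fin fineK// ge0_fin_numE; first exact: le_lt_trans h1 (ltry _).
    by apply: integral_ge0 => z _; rewrite lee_fin; apply: mulr_ge0 => //; exact: decay_ge0.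
  have cb : c <= e / (2 * (C + 1) * D).
    apply: (@le_trans _ _ (b `^ kappa)).
      rewrite ge0_ler_powR ?nnegrE ?divr_ge0 ?(ltW kappa0) ?(ltW rho0) ?(ltW r0) ?(ltW b0)//.
      rewrite ler_pdivrMr// -ler_pdivrMl// mulrC; lra.
    rewrite /b -powRrM mulVf ?gt_eqF// powRr1// divr_ge0 ?(ltW e0) ?(ltW CD0)//.
  apply: (@le_trans _ _ ((C + 1) * (e / (2 * (C + 1) * D)) * D)).
    apply: ler_pM => //; first exact: mulr_ge0.
      by apply: fine_ge0; apply: integral_ge0 => z _; rewrite lee_fin; apply: mulr_ge0 => //; exact: decay_ge0.
    by apply: ler_pM => //; rewrite lerDl.
  rewrite le_eqVlt; apply/orP; left; apply/eqP.
  have : C + 1 != 0 by rewrite gt_eqF.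
  have : D != 0 by rewrite gt_eqF.
  by move=> *; field; apply/andP; split.
have -> : A + kernel0_mass - I = \int[mu]_(z in away y r) modified_integrand s K (cst 1) y z -
    \int[mu]_(z in B y r `\` B 0 (r - a)) k0 z.
  by rewrite A1 S1; move: I1 J1; set u := \int[mu]_(z in B y r) k0 z; lra.
by apply: (le_trans (ler_normB _ _)); lra.
Qed.

End modified_constant.

(** * Existence and uniqueness of the modified operator *)

(** Convergence to zero as the truncation parameter tends to zero, for
    quantities that may be infinite. *)
Definition vanishing (R : realType) (F : R -> \bar R) : Prop :=
  forall e : R, 0 < e -> \forall eta \near 0^'+, (F eta <= e%:E)%E.

Section vanishing.
Context (R : realType).
Implicit Types (F G : R -> \bar R).

Lemma vanishingP F : (forall eta, 0 <= F eta)%E ->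
  vanishing F <-> F eta @[eta --> 0^'+] --> 0%E.
Proof.
move=> F0; split.
  move=> vF; apply/fine_cvgP; split.
    by near=> eta; rewrite ge0_fin_numE//; apply: (@le_lt_trans _ _ 1%:E);
      [near: eta; exact: vF|exact: ltry].
  apply/cvgrPdist_le => e e0; near=> eta.
  rewrite sub0r normrN ger0_norm ?fine_ge0//= -lee_fin.
  have h : (F eta <= e%:E)%E by near: eta; exact: vF.
  by rewrite fineK// ge0_fin_numE//; exact: le_lt_trans h (ltry _).
move=> /fine_cvgP[Ffin /cvgrPdist_le Fc] e e0; near=> eta.
have Fe : F eta \is a fin_num by near: eta; exact: Ffin.
rewrite -(fineK Fe) lee_fin -[leLHS]ger0_norm ?fine_ge0// -normrN -sub0r.
near: eta; exact: (Fc e e0).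
Unshelve. all: by end_near. Qed.

Lemma vanishing_le F G : (\forall eta \near 0^'+, F eta <= G eta)%E ->
  vanishing G -> vanishing F.
Proof.
move=> FG vG e e0; near=> eta.
apply: (@le_trans _ _ (G eta)); first by near: eta.
by near: eta; exact: vG.
Unshelve. all: by end_near. Qed.

Lemma vanishingD F G : vanishing F -> vanishing G -> vanishing (fun eta => F eta + G eta)%E.
Proof.
move=> vF vG e e0; have e2 : 0 < e / 2 by rewrite divr_gt0.
near=> eta; rewrite [e in leRHS]splitr EFinD; apply: leeD.
  by near: eta; exact: vF.
by near: eta; exact: vG.
Unshelve. all: by end_near. Qed.

Lemma vanishingZ F (c : R) : 0 <= c -> vanishing F -> vanishing (fun eta => c%:E * F eta)%E.
Proof.
move=> c0 vF e e0; have c1 : 0 < c + 1 by rewrite ltr_wpDl.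
have ec : 0 < e / (c + 1) by rewrite divr_gt0.
near=> eta; apply: (@le_trans _ _ (c%:E * (e / (c + 1))%:E)%E).
  by rewrite lee_wpmul2l ?lee_fin//; near: eta; exact: vF.
rewrite -EFinM lee_fin mulrCA -[leRHS]mulr1 ler_pM2l//.
by rewrite ler_pdivrMr// mul1r lerDl.
Unshelve. all: by end_near. Qed.

Lemma vanishing_powR (a : R) : 0 < a -> vanishing (fun eta : R => (eta `^ a)%:E).
Proof.
move=> a0 e e0; have b0 : 0 < e `^ a^-1 by rewrite powR_gt0.
near=> eta; rewrite lee_fin.
have eta0 : 0 < eta by near: eta; exact: nbhs_right_gt.
have h : eta < e `^ a^-1 by near: eta; exact: nbhs_right_lt.
rewrite -[leRHS](powRr1 (ltW e0)) -(mulVf (lt0r_neq0 a0)) powRrM.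
by rewrite ge0_ler_powR ?nnegrE ?(ltW a0) ?(ltW eta0) ?powR_ge0// ltW.
Unshelve. all: by end_near. Qed.

Lemma vanishing_le_cst (a : \bar R) F : vanishing F -> (\forall eta \near 0^'+, a <= F eta)%E ->
  (a <= 0)%E.
Proof.
move=> vF aF; apply/lee_addgt0Pr => e e0; rewrite add0e.
have : \forall eta \near (0 : R)^'+, (a <= e%:E)%E.
  near=> eta; apply: (@le_trans _ _ (F eta)); first by near: eta.
  by near: eta; exact: vF.
by move=> /filter_ex[].
Unshelve. all: by end_near. Qed.

End vanishing.

Section Lq_comparison.
Context (d : measure_display) (T : measurableType d) (R : realType).
Variable mu : {measure set T -> \bar R}.

Lemma Lq1_le q (U : set T) (f : T -> R) : 1 <= q -> measurable U -> measurable_fun U f ->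
  (Lq mu 1 U f <= Lq mu q U f * mu U `^ (1 - q^-1))%E.
Proof.
rewrite le_eqVlt => /predU1P[<- mU mf|q1 mU mf].
  by rewrite invr1 subrr poweRe0 mule1.
by rewrite Lq1E; exact: Lq_holder.
Qed.

End Lq_comparison.

Section modified_limit.
Context (R : realType) (n : nat) (s : cell_shape).
Local Notation V := 'rV[R]_n.
Local Notation mu := (@lebesgue_rV R n).
Local Notation d := (Num.sqrt n%:R : R).
Local Notation B := (cell EuclideanBall).
Variables (kappa C : R) (K : V -> V -> R).
Hypotheses (n0 : (0 < n)%N) (hK : standard_kernel kappa C K).
Local Notation k0 := (kernel0 s K).
Implicit Types (f g h : V -> R).

Lemma measurable_away_pair r : measurable [set z : V * V | r <= enorm (z.1 - z.2)].
Proof.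
rewrite -[X in measurable X]setTI.
have := @measurable_enorm_pair R n measurableT _ (measurable_itv `[r, +oo[).
by congr measurable; apply/seteqP; split => y /=; rewrite in_itv/= andbT.
Qed.

Lemma measurable_truncated eta f : 0 < eta -> measurable_fun setT f ->
  measurable_fun setT (truncated K eta f).
Proof.
move=> eta0 mf; pose A := [set z : V * V | eta <= enorm (z.1 - z.2)].
have -> : truncated K eta f = fun x => \int[mu]_y
    (((fun z : V * V => K z.1 z.2) \_ A) (x, y) * f y).
  apply/funext => x; rewrite /truncated Rintegral_mkcond; apply: eq_Rintegral => y _.
  rewrite !patchE; have [h|h] := pselect (eta <= enorm (x - y)).
    by rewrite !mem_set.
  by rewrite !memNset// mul0r.
apply: (measurable_Rintegral_param (F := fun z =>
  ((fun z : V * V => K z.1 z.2) \_ A) z * f z.2)).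
apply: measurable_funM; first exact: (measurable_kernel_away n0 hK eta0).
exact: (measurableT_comp mf measurable_snd).
Qed.

Lemma measurable_modified_truncated eta f : 0 < eta -> measurable_fun setT f ->
  measurable_fun setT (modified_truncated s K eta f).
Proof.
move=> eta0 mf; pose A := [set z : V * V | eta <= enorm (z.1 - z.2)].
have -> : modified_truncated s K eta f = fun x => \int[mu]_y
    ((((fun z : V * V => K z.1 z.2) \_ A) (x, y) - \1_A (x, y) * k0 y) * f y).
  apply/funext => x; rewrite /modified_truncated Rintegral_mkcond; apply: eq_Rintegral => y _.
  rewrite !patchE indicE; have [h|h] := pselect (eta <= enorm (x - y)).
    by rewrite !mem_set// mul1r.
  by rewrite !memNset// mul0r subrr mul0r.
apply: (measurable_Rintegral_param (F := fun z =>
  (((fun z : V * V => K z.1 z.2) \_ A) z - \1_A z * k0 z.2) * f z.2)).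
apply: measurable_funM; last exact: (measurableT_comp mf measurable_snd).
apply: measurable_funB; first exact: (measurable_kernel_away n0 hK eta0).
apply: measurable_funM; first by apply: measurable_indic; exact: measurable_away_pair.
exact: (measurableT_comp (measurable_kernel0 s n0 hK) measurable_snd).
Qed.

Lemma measurable_smooth_part x r h : 0 < r -> measurable_fun setT h ->
  measurable_fun (B x r) (smooth_part K x r h).
Proof.
move=> r0 mh; pose A := [set z : V * V | r <= enorm (z.1 - z.2)].
pose D := away x (2 * r).
have r20 : 0 < 2 * r by rewrite mulr_gt0.
pose F (z : V * V) := (((fun z : V * V => K z.1 z.2) \_ A) z * \1_D z.2 -
  ((K x) \_ D) z.2) * h z.2.
have mD : measurable D by exact: measurable_away.
have mi : measurable_fun setT (\1_D : V -> R) by exact: measurable_indic.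
have mKx : measurable_fun setT ((K x) \_ D).
  by apply: measurable_patch => //; exact: (measurable_kernel_section n0 hK).
have mF : measurable_fun setT F.
  apply: measurable_funM; last exact: (measurableT_comp mh measurable_snd).
  apply: measurable_funB.
    apply: measurable_funM; first exact: (measurable_kernel_away n0 hK r0).
    exact: (measurableT_comp mi measurable_snd).
  exact: (measurableT_comp mKx measurable_snd).
apply: (@eq_measurable_fun _ _ _ _ _ (fun y => \int[mu]_z F (y, z))); last first.
  exact: measurable_funTS (measurable_Rintegral_param mF).
move=> y; rewrite inE cellE/= => xy; rewrite /smooth_part [RHS]Rintegral_mkcond.
apply: eq_Rintegral => z _; rewrite /F !patchE indicE /=.
have [h'|h'] := pselect (D z); last by rewrite !(memNset h') mulr0 subrr mul0r.
rewrite (mem_set h') mem_set ?mulr1//.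
rewrite /A/=; move: h'; rewrite /D /away/=.
have := enormD (x - y) (y - z); rewrite addrA subrK (enorm_distC x y); lra.
Qed.

(** Every cell lies in a ball about the origin, so that these balls suffice. *)
Record modified_limit (q : R) f g : Prop := {
  modified_limit_measurable : measurable_fun setT g;
  modified_limit_lty : forall r : R, 0 < r -> (Lq mu q (B 0 r) g < +oo)%E;
  modified_limit_cvg : forall r : R, 0 < r ->
    vanishing (fun eta => Lq mu q (B 0 r) (modified_truncated s K eta f \- g)%R) }.

Lemma ball_exhaust : \bigcup_k B (0 : V) k.+1%:R = setT.
Proof.
apply/seteqP; split => // x _; exists (Num.truncn (enorm x)) => //=.
by rewrite subr0; exact: truncnS_gt.
Qed.

Lemma ae_balls (P : V -> Prop) :
  (forall r : R, 0 < r -> {ae mu, forall x, B 0 r x -> P x}) -> \forall x \ae mu, P x.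
Proof.
move=> h; have : {ae mu, forall x, forall k, B 0 k.+1%:R x -> P x}.
  by apply/ae_foralln => k; exact: h.
apply: filterS => x hx; have : [set: V] x by [].
by rewrite -ball_exhaust => -[k _]; exact: hx.
Qed.

(** Limits in different exponents agree, and they depend linearly on the
    function: compare all of them in [L^1] of a ball. *)
Lemma modified_limit_lin (q1 q2 q3 a : R) f1 f2 f3 g1 g2 g3 :
  1 <= q1 -> 1 <= q2 -> 1 <= q3 ->
  measurable_fun setT f1 -> measurable_fun setT f2 -> measurable_fun setT f3 ->
  (forall eta x, 0 < eta -> modified_truncated s K eta f3 x =
    a * modified_truncated s K eta f1 x + modified_truncated s K eta f2 x) ->
  modified_limit q1 f1 g1 -> modified_limit q2 f2 g2 -> modified_limit q3 f3 g3 ->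
  \forall x \ae mu, g3 x = a * g1 x + g2 x.
Proof.
move=> q11 q21 q31 mf1 mf2 mf3 hA l1 l2 l3; apply: ae_balls => r r0.
have mB : measurable (B (0 : V) r) by exact: measurable_cell.
have L1 q f g : 1 <= q -> measurable_fun setT f -> modified_limit q f g ->
    vanishing (fun eta => Lq mu 1 (B 0 r) (modified_truncated s K eta f \- g)%R).
  move=> qq mf l; have c0 : 0 <= fine (mu (B (0 : V) r) `^ (1 - q^-1))%E.
    by apply: fine_ge0; exact: poweR_ge0.
  apply: vanishing_le (vanishingZ c0 (modified_limit_cvg l r0)).
  near=> eta; have eta0 : 0 < eta by near: eta; exact: nbhs_right_gt.
  rewrite fineK; last by apply: fin_num_poweR; exact: volume_cell_fin.
  rewrite muleC; apply: Lq1_le => //; apply: measurable_funB.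
    by apply: measurable_funTS; exact: measurable_modified_truncated.
  exact: measurable_funTS (modified_limit_measurable l).
have mg1 := modified_limit_measurable l1; have mg2 := modified_limit_measurable l2.
have mg3 := modified_limit_measurable l3.
have mG : measurable_fun (B 0 r) (fun x => g3 x - (a * g1 x + g2 x)).
  apply: measurable_funB; first exact: measurable_funTS.
  by apply: measurable_funD; [apply: measurable_funM => //|]; exact: measurable_funTS.
suff : Lq mu 1 (B 0 r) (fun x => g3 x - (a * g1 x + g2 x)) = 0%E.
  move=> /(Lq_eq0_ae ltr01 mB mG); apply: filterS => x h /h /eqP.
  by rewrite subr_eq0 => /eqP.
apply/eqP; rewrite eq_le Lq_ge0 andbT.
have v := vanishingD (L1 _ _ _ q31 mf3 l3) (vanishingD
  (vanishingZ (normr_ge0 a) (L1 _ _ _ q11 mf1 l1)) (L1 _ _ _ q21 mf2 l2)).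
apply: (vanishing_le_cst v); near=> eta.
have eta0 : 0 < eta by near: eta; exact: nbhs_right_gt.
have mA f g : measurable_fun setT f -> measurable_fun setT g ->
    measurable_fun (B 0 r) (modified_truncated s K eta f \- g).
  move=> mf mg; apply: measurable_funB; last exact: measurable_funTS.
  by apply: measurable_funTS; exact: measurable_modified_truncated.
rewrite -LqZ//; last exact: mA.
have -> : Lq mu 1 (B 0 r) (fun x => g3 x - (a * g1 x + g2 x)) = Lq mu 1 (B 0 r)
    ((fun x => a * (modified_truncated s K eta f1 \- g1) x) \+
     (modified_truncated s K eta f2 \- g2) \- (modified_truncated s K eta f3 \- g3)).
  by apply: eq_Lq => x _ /=; rewrite hA//; ring.
have mZ : measurable_fun (B 0 r) (fun x => a * (modified_truncated s K eta f1 \- g1) x).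
  by apply: measurable_funM => //; exact: mA.
apply: le_trans (LqB mu (lexx 1) mB (measurable_funD mZ (mA _ _ mf2 mg2)) (mA _ _ mf3 mg3)) _.
by rewrite addeC leeD2l//; apply: LqD => //; exact: mA.
Unshelve. all: by end_near. Qed.

End modified_limit.

Section limit_exists.
Context (R : realType) (n : nat) (s : cell_shape).
Local Notation V := 'rV[R]_n.
Local Notation mu := (@lebesgue_rV R n).
Local Notation B := (cell EuclideanBall).
Variables (kappa C : R) (K : V -> V -> R) (T : (V -> R) -> V -> R).
Hypotheses (n0 : (0 < n)%N) (hK : standard_kernel kappa C K).
Hypothesis hT : singular_integral kappa K T.
Implicit Types (f g h : V -> R).

Lemma vanishing_unique (F : R -> V -> R) (U : set V) q g g' : 1 <= q -> measurable U ->
  (forall eta, 0 < eta -> measurable_fun U (F eta)) ->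
  measurable_fun U g -> measurable_fun U g' ->
  vanishing (fun eta => Lq mu q U (F eta \- g)%R) ->
  vanishing (fun eta => Lq mu q U (F eta \- g')%R) ->
  {ae mu, forall x, U x -> g x = g' x}.
Proof.
move=> q1 mU mF mg mg' v v'; have q0 : 0 < q by apply: lt_le_trans q1.
suff /(Lq_eq0_ae q0 mU (measurable_funB mg mg')) : Lq mu q U (g \- g')%R = 0%E.
  by apply: filterS => x h /h /eqP; rewrite subr_eq0 => /eqP.
apply/eqP; rewrite eq_le Lq_ge0 andbT.
apply: (vanishing_le_cst (vanishingD v' v)); near=> eta.
have eta0 : 0 < eta by near: eta; exact: nbhs_right_gt.
have -> : Lq mu q U (g \- g')%R = Lq mu q U ((F eta \- g') \- (F eta \- g))%R.
  by apply: eq_Lq => x _ /=; ring.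
by apply: LqB => //; apply: measurable_funB => //; exact: mF.
Unshelve. all: by end_near. Qed.

Lemma compactly_supported_patch x r h : compactly_supported (h \_ (B x r)).
Proof.
exists [set v : V | forall i, [set` `[x 0 i - r, x 0 i + r]] (v ord0 i)].
  apply: (@rV_compact _ _ (fun i => [set` `[x 0 i - r, x 0 i + r]])) => i.
  exact: segment_compact.
move=> y hy; rewrite patchE memNset//.
move=> /cell_sub_cube; rewrite cellE/= => yr; apply: hy => i /=.
have := le_lt_trans (coord_le_norm (y - x) i) yr.
by rewrite !mxE in_itv/= ltr_distl => /andP[/ltW -> /ltW ->].
Qed.

Lemma patch_Lfun q x r h : 1 < q -> admissible kappa q h -> 0 < r ->
  h \_ (B x r) \in Lfun mu q%:E.
Proof.
move=> q1 ah r0; apply: Lq_LfunP; first exact: measurable_cell.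
  exact: measurable_funTS (admissible_measurable ah).
exact: (admissible_local ah).
Qed.

Lemma truncated_patch_le q : 1 < q -> exists2 Cq : R, 0 < Cq &
  forall eta x r h U, 0 < eta -> 0 < r -> measurable U -> admissible kappa q h ->
  (Lq mu q U (truncated K eta (h \_ (B x r))) <= Cq%:E * Lq mu q (B x r) h)%E.
Proof.
move=> q1; have [Cq Cq0 hC] := truncated_bounded hT q1; exists Cq => //.
move=> eta x r h U eta0 r0 mU ah.
apply: le_trans (hC eta _ eta0 (patch_Lfun x q1 ah r0) (compactly_supported_patch x r h)).
have mt : measurable_fun setT (truncated K eta (h \_ (B x r))).
  apply: (measurable_truncated n0 hK) => //; apply: measurable_patch.
    exact: measurable_cell.
  exact: measurable_funTS (admissible_measurable ah).
apply: le_trans (Lq_subset mu (lt_trans ltr01 q1) mU measurableT mt (@subsetT _ _)) _.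
by rewrite /Lq patch_setT.
Qed.

Lemma operator_patch_vanishing q x r h U : 1 < q -> 0 < r -> measurable U ->
  admissible kappa q h ->
  vanishing (fun eta => Lq mu q U
    (truncated K eta (h \_ (B x r)) \- T (h \_ (B x r)))%R).
Proof.
move=> q1 r0 mU ah.
have [/andP[mT _] cT] := truncated_limit hT q1 (patch_Lfun x q1 ah r0)
  (compactly_supported_patch x r h).
rewrite inE in mT.
apply: vanishing_le; last first.
  exact: (proj2 (vanishingP (fun eta => Lnorm_ge0 mu q%:E _)) cT).
near=> eta; have eta0 : 0 < eta by near: eta; exact: nbhs_right_gt.
have mt : measurable_fun setT (truncated K eta (h \_ (B x r)) \- T (h \_ (B x r))).
  apply: measurable_funB => //.
  apply: (measurable_truncated n0 hK) => //; apply: measurable_patch.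
    exact: measurable_cell.
  exact: measurable_funTS (admissible_measurable ah).
apply: le_trans (Lq_subset mu (lt_trans ltr01 q1) mU measurableT mt (@subsetT _ _)) _.
by rewrite /Lq patch_setT.
Unshelve. all: by end_near. Qed.

(** By Hoelder's inequality the integral over a ball of radius [eta] is
    uniformly small. *)
Lemma kernel0_part_vanishing q x r h : 1 < q -> 0 < r -> admissible kappa q h ->
  vanishing (fun eta => Lq mu q (B x r) (fun y => \int[mu]_(z in B y eta) (kernel0 s K z * h z))).
Proof.
move=> q1 r0 ah; have q0 : 0 < q by apply: lt_trans q1.
have mh := admissible_measurable ah.
have a0 : 0 < 1 - q^-1 by rewrite subr_gt0 invf_lt1.
have r20 : 0 < 2 * r by rewrite mulr_gt0.
pose L := fine (Lq mu q (B x (2 * r)) h).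
have L0 : 0 <= L by apply: fine_ge0; exact: Lq_ge0.
pose M := C * (L * (2 ^+ n) `^ (1 - q^-1)) * fine (mu (B x r) `^ q^-1)%E.
have M0 : 0 <= M.
  rewrite mulr_ge0 ?fine_ge0 ?poweR_ge0// mulr_ge0 ?(kernel_const_ge0 hK)//.
  by rewrite mulr_ge0// powR_ge0.
have na0 : 0 < n%:R * (1 - q^-1) by rewrite mulr_gt0// ltr0n.
apply: vanishing_le (vanishingZ M0 (vanishing_powR na0)); near=> eta.
have eta0 : 0 < eta by near: eta; exact: nbhs_right_gt.
have er : eta <= r by near: eta; exact: nbhs_right_le.
pose A := [set z : V * V | eta <= enorm (z.1 - z.2)].
have mJ : measurable_fun (B x r) (fun y => \int[mu]_(z in B y eta) (kernel0 s K z * h z)).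
  apply: measurable_funTS.
  have -> : (fun y => \int[mu]_(z in B y eta) (kernel0 s K z * h z)) =
      (fun y => \int[mu]_z ((1 - \1_A (y, z)) * (kernel0 s K z * h z))).
    apply/funext => y; rewrite Rintegral_mkcond; apply: eq_Rintegral => z _.
    rewrite patchE indicE; have [h1|h1] := pselect (B y eta z).
      rewrite mem_set// memNset ?subr0 ?mul1r//.
      by move: h1; rewrite cellE/= enorm_distC => h1; rewrite /A/= leNgt h1.
    rewrite memNset// mem_set ?subrr ?mul0r//.
    rewrite /A/= leNgt; apply/negP => h2; apply: h1; rewrite cellE/= enorm_distC//.
  apply: (measurable_Rintegral_param (F := fun z => (1 - \1_A z) * (kernel0 s K z.2 * h z.2))).
  apply: measurable_funM.
    by apply: measurable_funB => //; apply: measurable_indic; exact: measurable_away_pair.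
  apply: measurable_funM; last exact: (measurableT_comp mh measurable_snd).
  exact: (measurableT_comp (measurable_kernel0 s n0 hK) measurable_snd).
have c0 : 0 <= C * (L * ((2 * eta) ^+ n) `^ (1 - q^-1)).
  by rewrite mulr_ge0 ?(kernel_const_ge0 hK)// mulr_ge0// powR_ge0.
apply: le_trans (Lq_le_cst mu q0 c0 (measurable_cell _ _ _) mJ _) _.
  move=> y By; apply: (kernel0_part_le s n0 hK (ltW q1) ah) => //.
  by apply: ball_sub_ball; move: By; rewrite cellE/=; lra.
rewrite /M; set c := (mu _ `^ _)%E.
have cfin : c \is a fin_num by apply: fin_num_poweR; exact: volume_cell_fin.
rewrite -(fineK cfin) -!EFinM lee_fin le_eqVlt; apply/orP; left; apply/eqP.
rewrite exprMn powRM ?exprn_ge0// ?(ltW eta0)// -(powR_mulrn n (ltW eta0)) -powRrM.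
ring.
Unshelve. all: by end_near. Qed.

(** On each ball the decomposition exhibits the limit. The limits on different
    balls agree almost everywhere on the smaller one, and are glued along
    shells to stay measurable. *)
Lemma modified_limit_exists q f : 1 < q -> admissible kappa q f ->
  exists g, modified_limit s K q f g.
Proof.
move=> q1 af; have q0 : 0 < q by apply: lt_trans q1.
have mf := admissible_measurable af.
have mB r : measurable (B (0 : V) r) by exact: measurable_cell.
pose A eta := modified_truncated s K eta f.
have mA eta U : 0 < eta -> measurable_fun U (A eta).
  by move=> eta0; apply: measurable_funTS; exact: (measurable_modified_truncated s n0 hK).
pose gr r y := T (f \_ (B 0 (2 * r))) y + smooth_part K 0 r f y + constant_part s K 0 r f.
have TL r : 0 < r -> T (f \_ (B 0 (2 * r))) \in Lfun mu q%:E.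
  move=> r0; have r20 : 0 < 2 * r by rewrite mulr_gt0.
  by have [] := truncated_limit hT q1 (patch_Lfun 0 q1 af r20) (compactly_supported_patch 0 (2 * r) f).
have mT r : 0 < r -> measurable_fun setT (T (f \_ (B 0 (2 * r)))).
  by move=> /TL /andP[]; rewrite inE.
have msm r : 0 < r -> measurable_fun (B 0 r) (smooth_part K 0 r f).
  by move=> r0; exact: (measurable_smooth_part n0 hK).
have mgr r : 0 < r -> measurable_fun (B 0 r) (gr r).
  move=> r0; apply: measurable_funD => //; apply: measurable_funD; last exact: msm.
  exact: measurable_funTS (mT _ r0).
have grfin r : 0 < r -> (Lq mu q (B 0 r) (gr r) < +oo)%E.
  move=> r0; pose M := C * fine (far_integral kappa 0 r f) + `|constant_part s K 0 r f|.
  have M0 : 0 <= M.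
    rewrite addr_ge0// mulr_ge0 ?(kernel_const_ge0 hK)//; apply: fine_ge0.
    by apply: integral_ge0 => z _; rewrite lee_fin; apply: mulr_ge0 => //; exact: decay_ge0.
  have mc : measurable_fun (B 0 r) (fun y => smooth_part K 0 r f y + constant_part s K 0 r f).
    by apply: measurable_funD => //; exact: msm.
  have -> : Lq mu q (B 0 r) (gr r) = Lq mu q (B 0 r) (T (f \_ (B 0 (2 * r))) \+
      (fun y => smooth_part K 0 r f y + constant_part s K 0 r f))%R.
    by apply: eq_Lq => y _; rewrite /gr/=; ring.
  apply: le_lt_trans (LqD mu (ltW q1) (mB r) (measurable_funTS (mT _ r0)) mc) _.
  rewrite lte_add_pinfty//.
    apply: le_lt_trans (Lq_subset mu q0 (mB r) measurableT (mT _ r0) (@subsetT _ _)) _.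
    by rewrite /Lq patch_setT; have /andP[_] := TL _ r0; rewrite inE.
  apply: le_lt_trans (Lq_le_cst mu q0 M0 (mB r) mc _) _.
    move=> y By; apply: (le_trans (ler_normD _ _)); rewrite lerD2r.
    exact: (smooth_part_le n0 hK af).
  by rewrite lte_mul_pinfty ?lee_fin// poweR_lty// volume_cell_lty.
have grv r : 0 < r -> vanishing (fun eta => Lq mu q (B 0 r) (A eta \- gr r)%R).
  move=> r0; have r20 : 0 < 2 * r by rewrite mulr_gt0.
  apply: vanishing_le (vanishingD (operator_patch_vanishing 0 q1 r20 (mB r) af)
    (kernel0_part_vanishing 0 q1 r0 af)).
  near=> eta; have eta0 : 0 < eta by near: eta; exact: nbhs_right_gt.
  have er : eta <= r by near: eta; exact: nbhs_right_le.
  have mt : measurable_fun setT (truncated K eta (f \_ (B 0 (2 * r)))).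
    apply: (measurable_truncated n0 hK) => //.
    by apply: measurable_patch; [exact: mB|exact: measurable_funTS].
  pose e y := A eta y - (truncated K eta (f \_ (B 0 (2 * r))) y + smooth_part K 0 r f y +
    constant_part s K 0 r f).
  have eE y : B 0 r y -> e y = \int[mu]_(z in B y eta) (kernel0 s K z * f z).
    by move=> By; rewrite /e /A (modified_truncated_split s n0 hK (ltW q1) af eta0 er By); ring.
  have -> : Lq mu q (B 0 r) (fun y => \int[mu]_(z in B y eta) (kernel0 s K z * f z)) =
      Lq mu q (B 0 r) e by apply: eq_Lq => y By; rewrite eE.
  have me : measurable_fun (B 0 r) e.
    apply: measurable_funB; first exact: mA.
    apply: measurable_funD => //; apply: measurable_funD; last exact: msm.
    exact: measurable_funTS.
  have -> : Lq mu q (B 0 r) (A eta \- gr r)%R = Lq mu q (B 0 r)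
     ((truncated K eta (f \_ (B 0 (2 * r))) \- T (f \_ (B 0 (2 * r)))) \+ e)%R.
    by apply: eq_Lq => y _; rewrite /e /gr/=; ring.
  apply: LqD => //; first exact: ltW.
  by apply: measurable_funB; [exact: measurable_funTS|exact: measurable_funTS (mT _ r0)].
pose k x := Num.truncn (enorm (x : V)).
pose g x := gr (k x).+1%:R x.
have kr j : 0 < j.+1%:R :> R by [].
have agree i j : (i <= j)%N -> {ae mu, forall x, B 0 i.+1%:R x -> gr i.+1%:R x = gr j.+1%:R x}.
  move=> ij; have sub : B (0 : V) i.+1%:R `<=` B 0 j.+1%:R.
    by apply: ball_sub_ball; rewrite subrr enorm0 add0r ler_nat.
  have mgj : measurable_fun (B 0 i.+1%:R) (gr j.+1%:R).
    exact: measurable_funS sub (mgr _ (kr j)).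
  apply: (vanishing_unique (F := A) (q := q)) => //; [exact: ltW|by move=> *; exact: mA|exact: mgr|exact: grv|].
  apply: vanishing_le (grv _ (kr j)); near=> eta.
  have eta0 : 0 < eta by near: eta; exact: nbhs_right_gt.
  apply: Lq_subset => //; apply: measurable_funB; [exact: mA|exact: mgr].
have gE j : {ae mu, forall x, B 0 j.+1%:R x -> g x = gr j.+1%:R x}.
  have : {ae mu, forall x, forall i, (i <= j)%N -> B 0 i.+1%:R x -> gr i.+1%:R x = gr j.+1%:R x}.
    apply/ae_foralln => i; have [ij|ij] := leqP i j.
      by apply: filterS (agree _ _ ij) => x h _.
    by apply: nearW => x /=; rewrite ltnNge in ij.
  apply: filterS => x h; rewrite cellE/= subr0 => xj; apply: h.
    by rewrite -ltnS -(ltr_nat R); apply: le_lt_trans xj; rewrite truncn_le enorm_ge0.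
  by rewrite cellE/= subr0; exact: truncnS_gt.
have mg : measurable_fun setT g.
  pose E i := away (0 : V) i%:R `&` B 0 i.+1%:R.
  have mE i : measurable (E i) by exact: measurable_shell.
  have <- : \bigcup_i E i = setT.
    apply/seteqP; split => // x _; exists (k x) => //; split.
      by rewrite /away/= sub0r enormN truncn_le enorm_ge0.
    by rewrite cellE/= subr0; exact: truncnS_gt.
  apply/measurable_fun_bigcup => // i.
  apply: (@eq_measurable_fun _ _ _ _ _ (gr i.+1%:R)); last first.
    by apply: measurable_funS (mgr _ (kr i)) => //; exact: subIsetr.
  move=> x; rewrite inE => -[]; rewrite /away cellE/= sub0r enormN subr0 => h1 h2.
  rewrite /g (_ : k x = i)//; apply/eqP; rewrite /k.
  by rewrite truncn_eq ?enorm_ge0// h1 h2.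
have gfin j : (Lq mu q (B 0 j.+1%:R) g < +oo)%E.
  by rewrite (Lq_ae q0 (mB _) (measurable_funTS mg) (mgr _ (kr j)) (gE j)); exact: grfin.
have gv j : vanishing (fun eta => Lq mu q (B 0 j.+1%:R) (A eta \- g)%R).
  apply: vanishing_le (grv _ (kr j)); near=> eta.
  have eta0 : 0 < eta by near: eta; exact: nbhs_right_gt.
  rewrite (@Lq_ae _ _ _ mu q _ _ (A eta \- gr j.+1%:R))//.
  - by apply: measurable_funB; [exact: mA|exact: measurable_funTS].
  - by apply: measurable_funB; [exact: mA|exact: mgr].
  - by apply: filterS (gE j) => x h /h /= ->.
have sub r : 0 < r -> B (0 : V) r `<=` B 0 (Num.truncn r).+1%:R.
  by move=> r0; apply: ball_sub_ball; rewrite subrr enorm0 add0r ltW// truncnS_gt.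
exists g; split => // r r0.
  by apply: le_lt_trans (gfin (Num.truncn r)); apply: Lq_subset => //; [exact: measurable_funTS|exact: sub].
apply: vanishing_le (gv (Num.truncn r)); near=> eta.
have eta0 : 0 < eta by near: eta; exact: nbhs_right_gt.
apply: Lq_subset => //; last exact: sub.
by apply: measurable_funB; [exact: mA|exact: measurable_funTS].
Unshelve. all: by end_near. Qed.

End limit_exists.

(** * Mean oscillation *)

Section oscillation.
Context (R : realType) (n : nat).
Local Notation V := 'rV[R]_n.
Local Notation mu := (@lebesgue_rV R n).
Implicit Types (f g : V -> R) (U : set V).

Section one_set.
Variables (U : set V).
Hypotheses (mU : measurable U) (Ufin : mu U \is a fin_num) (U0 : 0 < fine (mu U)).
Local Notation v := (fine (mu U)).

Let muU : mu U = v%:E. Proof. by rewrite fineK. Qed.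

Let muU_lty : (mu U < +oo)%E. Proof. by rewrite muU ltry. Qed.

Lemma integrable_cst (a : R) : mu.-integrable U (EFin \o cst a).
Proof.
apply/integrableP; split; first exact/measurable_EFinP.
rewrite (eq_integral (cst `|a|%:E))// integral_cst//.
by rewrite muU -EFinM ltry.
Qed.

Lemma integrable_subr f (a : R) : mu.-integrable U (EFin \o f) ->
  mu.-integrable U (EFin \o (fun x => f x - a)).
Proof.
move=> iff; have := integrableB mU iff (integrable_cst a).
by apply: eq_integrable.
Qed.

Lemma mean_dist_le f (a : R) : mu.-integrable U (EFin \o f) ->
  `|mean f U - a| <= v^-1 * \int[mu]_(x in U) `|f x - a|.
Proof.
move=> iff; have -> : mean f U - a = v^-1 * \int[mu]_(x in U) (f x - a).
  rewrite RintegralB//; last exact: integrable_cst.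
  by rewrite Rintegral_cst// mulrBr /mean mulrCA mulVf ?gt_eqF// mulr1.
rewrite normrM ger0_norm ?invr_ge0 ?(ltW U0)// ler_pM2l ?invr_gt0//.
exact: le_normr_Rintegral (integrable_subr a iff).
Qed.

Lemma Rintegral_norm_le_Lq f q : 1 <= q -> measurable_fun U f -> (Lq mu q U f < +oo)%E ->
  \int[mu]_(x in U) `|f x| <= fine (Lq mu q U f) * v `^ (1 - q^-1).
Proof.
move=> q1 mf fq; have h := Lq1_le mu q1 mU mf; rewrite Lq1E in h.
have iff := Lq_lty_integrable q1 mU muU_lty mf fq.
have ifin : (\int[mu]_(x in U) `|f x|%:E)%E \is a fin_num.
  exact: (integrable_fin_num mU (integrable_norm iff)).
rewrite -lee_fin /Rintegral fineK// EFinM fineK ?ge0_fin_numE ?Lq_ge0//.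
by apply: (le_trans h); rewrite -poweR_EFin fineK.
Qed.

Lemma oscillationE p f : 0 < p -> oscillation p f U =
  ((v `^ (- p^-1))%:E * Lq mu p U (fun x => (f x - mean f U)%R))%E.
Proof.
move=> p0; rewrite /oscillation LqE// poweRM ?lee_fin ?invr_ge0 ?(ltW U0)//; last first.
  by apply: integral_ge0 => x _; rewrite lee_fin powR_ge0.
by rewrite poweR_EFin -(powR_inv1 (ltW U0)) -powRrM mulN1r.
Qed.

(** The mean approximates as well as any other constant, up to the factor 2. *)
Lemma oscillation_le p f (a : R) : 1 <= p -> mu.-integrable U (EFin \o f) ->
  (oscillation p f U <= (2 * v `^ (- p^-1))%:E * Lq mu p U (fun x => (f x - a)%R))%E.
Proof.
move=> p1 iff; have p0 : 0 < p by apply: lt_le_trans p1.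
have mf : measurable_fun U f by apply/measurable_EFinP; exact: (measurable_int _ iff).
have mfa : measurable_fun U (fun x => f x - a) by exact: measurable_funB.
have vp : 0 < v `^ (- p^-1) by rewrite powR_gt0.
have [fy|] := ltP (Lq mu p U (fun x => f x - a)) +oo%E; last first.
  rewrite leye_eq => /eqP ->; rewrite gt0_muley ?leey// lte_fin mulr_gt0//.
rewrite oscillationE// mulrC EFinM -muleA; apply: lee_wpmul2l; first by rewrite lee_fin ltW.
have -> : Lq mu p U (fun x => f x - mean f U) =
    Lq mu p U ((fun x => f x - a) \- cst (mean f U - a))%R.
  by apply: eq_Lq => x _ /=; ring.
apply: le_trans (LqB mu p1 mU mfa (measurable_cst _)) _.
have two : (2 : R) = 1 + 1 by [].
rewrite [X in (X%:E * _)%E]two EFinD ge0_muleDl// mul1e leeD2l//.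
rewrite Lq_cst// muU poweR_EFin -EFinM.
have -> : Lq mu p U (fun x => f x - a) = (fine (Lq mu p U (fun x => f x - a)))%:E.
  by rewrite fineK// ge0_fin_numE// Lq_ge0.
rewrite lee_fin; set L := fine (Lq _ _ _ _).
have v0 : 0 <= v^-1 by rewrite invr_ge0 ltW.
have h := le_trans (mean_dist_le a iff)
  (ler_wpM2l v0 (Rintegral_norm_le_Lq p1 mfa fy)).
apply: (@le_trans _ _ (v^-1 * (L * v `^ (1 - p^-1)) * v `^ p^-1)).
  by rewrite ler_wpM2r ?powR_ge0.
rewrite -!mulrA -powRD ?subrK; last by rewrite (gt_eqF U0) implybT.
by rewrite powRr1 ?(ltW U0)// mulrCA mulVf ?gt_eqF// mulr1.
Qed.

End one_set.

Lemma mean_diff_le f U U' (D P : R) : measurable U -> measurable U' ->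
  mu U \is a fin_num -> mu U' \is a fin_num -> 0 < fine (mu U) -> 0 < fine (mu U') ->
  U `<=` U' -> fine (mu U') <= D * fine (mu U) ->
  mu.-integrable U' (EFin \o f) ->
  \int[mu]_(x in U') `|f x - mean f U'| <= P * fine (mu U') ->
  `|mean f U - mean f U'| <= D * P.
Proof.
move=> mU mU' Ufin Ufin' U0 U0' UU' UD iff hP.
have iU := integrableS mU' mU UU' iff.
apply: (le_trans (mean_dist_le mU Ufin U0 _ iU)).
rewrite mulrC ler_pdivrMr//.
have ii := integrable_norm (integrable_subr mU' Ufin' (mean f U') iff).
apply: (@le_trans _ _ (\int[mu]_(x in U') `|f x - mean f U'|)).
  rewrite /Rintegral fine_le//.
  - exact: (integrable_fin_num mU (integrableS mU' mU UU' ii)).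
  - exact: (integrable_fin_num mU' ii).
  - by apply: ge0_subset_integral => //; exact: (measurable_int _ ii).
apply: (le_trans hP); rewrite [D * P]mulrC -mulrA ler_wpM2l//.
have : 0 <= P * fine (mu U') by apply: le_trans hP; apply: Rintegral_ge0.
by rewrite pmulr_lge0.
Qed.

End oscillation.

(** * The estimate on Campanato norms *)

Section main_estimate.
Context (R : realType) (n : nat) (s : cell_shape).
Local Notation V := 'rV[R]_n.
Local Notation mu := (@lebesgue_rV R n).
Local Notation d := (Num.sqrt n%:R : R).
Local Notation B := (cell EuclideanBall).
Variables (kappa C : R) (K : V -> V -> R) (T : (V -> R) -> V -> R).
Hypotheses (n0 : (0 < n)%N) (hK : standard_kernel kappa C K).
Hypothesis hT : singular_integral kappa K T.
Implicit Types (f g h : V -> R).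

Let kappa0 := kernel_kappa_gt0 hK.
Let C0 := kernel_const_ge0 hK.

Lemma vanishing_bound (a b : \bar R) (F : R -> \bar R) : vanishing F ->
  (\forall eta \near 0^'+, a <= b + F eta)%E -> (a <= b)%E.
Proof.
move=> vF h; apply/lee_addgt0Pr => e e0.
have : \forall eta \near (0 : R)^'+, (a <= b + e%:E)%E.
  near=> eta; apply: (@le_trans _ _ (b + F eta)%E); first by near: eta.
  by rewrite leeD2l//; near: eta; exact: vF.
by move=> /filter_ex[].
Unshelve. all: by end_near. Qed.

Lemma far_integral_ge0 x r h : (0 <= far_integral kappa x r h)%E.
Proof.
by apply: integral_ge0 => z _; rewrite lee_fin; apply: mulr_ge0 => //; exact: decay_ge0.
Qed.

(** Near the ball the operator is controlled by its [L^q] bound, away from it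
    by the regularity of the kernel. *)
Lemma modified_limit_ball q : 1 < q -> exists2 Cq : R, 0 < Cq &
  forall f g x r (c : R), admissible kappa q f -> modified_limit s K q f g -> 0 < r ->
  exists a : R, (Lq mu q (B x r) (fun y => (g y - a)%R) <=
    Cq%:E * Lq mu q (B x (2 * r)) (fun y => (f y - c)%R) +
    (C * fine (far_integral kappa x r (fun y => (f y - c)%R)))%:E * mu (B x r) `^ q^-1)%E.
Proof.
move=> q1; have [Cq Cq0 hC] := truncated_patch_le n0 hK hT q1; exists Cq => // f g x r c af lg r0.
have q0 : 0 < q by apply: lt_trans q1.
have -> : (fun y => f y - c) = (fun y => (- c) * cst 1 y + f y).
  by apply/funext => y /=; ring.
set h := fun y => _ + _; have r20 : 0 < 2 * r by rewrite mulr_gt0.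
have a1 : admissible kappa q (cst 1 : V -> R) by exact: (admissible_cst n kappa0 (ltW q1)).
have ah : admissible kappa q h by exact: (admissible_lin (ltW q1) (- c) a1 af).
pose a := constant_part s K x r h - c * kernel0_mass s K; exists a.
have mB : measurable (B x r) by exact: measurable_cell.
have mA u : admissible kappa q u -> forall eta, 0 < eta ->
    measurable_fun (B x r) (modified_truncated s K eta u).
  move=> au eta eta0; apply: measurable_funTS.
  exact: (measurable_modified_truncated s n0 hK eta0 (admissible_measurable au)).
have mg : measurable_fun (B x r) g by exact: measurable_funTS (modified_limit_measurable lg).
pose rho := enorm x + r.
have rho0 : 0 < rho by rewrite ltr_wpDl// enorm_ge0.
have sub : B x r `<=` B 0 rho by apply: ball_sub_ball; rewrite subr0.
have vg : vanishing (fun eta => Lq mu q (B x r) (modified_truncated s K eta f \- g)%R).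
  apply: vanishing_le (modified_limit_cvg lg rho0); near=> eta.
  have eta0 : 0 < eta by near: eta; exact: nbhs_right_gt.
  apply: Lq_subset => //.
  apply: measurable_funB; apply: measurable_funTS; last exact: modified_limit_measurable lg.
  exact: (measurable_modified_truncated s n0 hK eta0 (admissible_measurable af)).
have v1 := kernel0_part_vanishing s n0 hK x q1 r0 a1.
have vh := kernel0_part_vanishing s n0 hK x q1 r0 ah.
apply: (vanishing_bound (vanishingD vg (vanishingD vh (vanishingZ (normr_ge0 c) v1)))).
near=> eta; have eta0 : 0 < eta by near: eta; exact: nbhs_right_gt.
have er : eta <= r by near: eta; exact: nbhs_right_le.
pose t := truncated K eta (h \_ (B x (2 * r))).
pose sm := smooth_part K x r h.
pose e1 y := \int[mu]_(z in B y eta) (kernel0 s K z * cst 1 z).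
pose eh y := \int[mu]_(z in B y eta) (kernel0 s K z * h z).
have e1E y : e1 y = modified_truncated s K eta (cst 1) y + kernel0_mass s K.
  rewrite (modified_truncated_cst s n0 hK)//; last first.
    by move=> z t1 t2 h1 h2; have [] := kernel_cancellation hT z h1 h2.
  rewrite addrAC addNr add0r; apply: eq_Rintegral => z _; by rewrite mulr1.
have ehE y : B x r y -> eh y = modified_truncated s K eta h y - (t y + sm y + constant_part s K x r h).
  by move=> By; rewrite (modified_truncated_split s n0 hK (ltW q1) ah eta0 er By) /eh /t /sm; ring.
have fE y : modified_truncated s K eta f y =
    modified_truncated s K eta h y + c * modified_truncated s K eta (cst 1) y.
  by rewrite (modified_truncated_lin s n0 hK (- c) y eta0 (ltW q1) a1 af); ring.
have mt : measurable_fun (B x r) t.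
  apply: measurable_funTS; apply: (measurable_truncated n0 hK) => //.
  apply: measurable_patch; first exact: measurable_cell.
  exact: measurable_funTS (admissible_measurable ah).
have msm : measurable_fun (B x r) sm.
  by apply: (measurable_smooth_part n0 hK r0); exact: admissible_measurable ah.
have me1 : measurable_fun (B x r) e1.
  apply: (@eq_measurable_fun _ _ _ _ _ (fun y => modified_truncated s K eta (cst 1) y + kernel0_mass s K)).
    by move=> y _; rewrite e1E.
  by apply: measurable_funD => //; exact: mA.
have meh : measurable_fun (B x r) eh.
  apply: (@eq_measurable_fun _ _ _ _ _ (fun y => modified_truncated s K eta h y -
      (t y + sm y + constant_part s K x r h))).
    by move=> y; rewrite inE => By; rewrite ehE.
  apply: measurable_funB; first exact: mA.
  by apply: measurable_funD => //; exact: measurable_funD.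
pose w y := modified_truncated s K eta f y - g y.
have mw : measurable_fun (B x r) w by apply: measurable_funB => //; exact: mA.
have -> : Lq mu q (B x r) (fun y => (g y - a)%R) =
    Lq mu q (B x r) (((t \+ sm) \+ (eh \+ (fun y => c * e1 y))) \- w)%R.
  by apply: eq_Lq => y By; rewrite /= /w fE ehE// e1E /a; ring.
have mce : measurable_fun (B x r) (fun y => c * e1 y) by exact: measurable_funM.
have q1' := ltW q1.
apply: le_trans (LqB mu q1' mB (measurable_funD (measurable_funD mt msm)
  (measurable_funD meh mce)) mw) _.
rewrite [leRHS]addeA [leRHS]addeAC; apply: leeD2r.
apply: le_trans (LqD mu q1' mB (measurable_funD mt msm) (measurable_funD meh mce)) _.
apply: leeD; last first.
  rewrite -LqZ//; exact: LqD.
apply: le_trans (LqD mu q1' mB mt msm) _; apply: leeD; first exact: hC.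
apply: Lq_le_cst => //; first by rewrite mulr_ge0// fine_ge0// far_integral_ge0.
by move=> y By; exact: (smooth_part_le n0 hK ah).
Unshelve. all: by end_near. Qed.

Lemma campanato_norm_cell p lambda (M : R) U f x t : 0 < t -> cell s x t `<=` U ->
  (campanato_norm s p lambda U f <= M%:E)%E ->
  (oscillation p f (cell s x t) <= (t `^ lambda * M)%:E)%E.
Proof.
move=> t0 sub hM; have : ((t `^ (- lambda))%:E * oscillation p f (cell s x t) <= M%:E)%E.
  by apply: le_trans hM; apply: ereal_sup_ubound; exists x, t.
have tl : 0 < t `^ lambda by rewrite powR_gt0.
move=> /(lee_wpmul2l (_ : (0 <= (t `^ lambda)%:E)%E)); rewrite lee_fin => /(_ (ltW tl)).
by rewrite muleA -!EFinM powRN mulfV ?gt_eqF// mul1e.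
Qed.

End main_estimate.

Section oscillation_growth.
Context (R : realType) (n : nat) (s : cell_shape).
Local Notation V := 'rV[R]_n.
Local Notation mu := (@lebesgue_rV R n).
Local Notation d := (Num.sqrt n%:R : R).
Local Notation B := (cell EuclideanBall).
Hypothesis n0 : (0 < n)%N.
Implicit Types (f g h : V -> R).

Lemma Lq_oscillation p (M : R) f (x : V) t : 1 <= p -> 0 < t ->
  (oscillation p f (cell s x t) <= M%:E)%E ->
  (Lq mu p (cell s x t) (fun y => (f y - mean f (cell s x t))%R) <=
    (M * volume s x t `^ p^-1)%:E)%E.
Proof.
move=> p1 t0; have v0 := volume_gt0 n0 s x t0.
have p0 : 0 < p by exact: lt_le_trans p1.
have vf := volume_cell_fin s x t0.
rewrite oscillationE// -/(volume s x t).
have vp : 0 < volume s x t `^ p^-1 by rewrite powR_gt0.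
move=> /(lee_wpmul2l (_ : (0 <= (volume s x t `^ p^-1)%:E)%E)).
rewrite lee_fin => /(_ (ltW vp)); rewrite muleA -EFinM -powRD; last first.
  by rewrite (gt_eqF v0) implybT.
by rewrite subrr powRr0 mul1e -EFinM mulrC.
Qed.

Lemma Rintegral_oscillation p (M : R) f (x : V) t : 1 <= p -> 0 < t ->
  mu.-integrable (cell s x t) (EFin \o f) ->
  (oscillation p f (cell s x t) <= M%:E)%E ->
  \int[mu]_(y in cell s x t) `|f y - mean f (cell s x t)| <= M * volume s x t.
Proof.
move=> p1 t0 iff hM; have h := Lq_oscillation p1 t0 hM.
have v0 := volume_gt0 n0 s x t0.
have mf : measurable_fun (cell s x t) f.
  by apply/measurable_EFinP; exact: (measurable_int _ iff).
have mc := measurable_cell s x t.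
have fin := le_lt_trans h (ltry _).
apply: (le_trans (Rintegral_norm_le_Lq mc (volume_cell_fin s x t0) p1 _ fin)).
  exact: measurable_funB.
apply: (@le_trans _ _ (M * volume s x t `^ p^-1 * volume s x t `^ (1 - p^-1))).
  by rewrite ler_wpM2r ?powR_ge0// -lee_fin fineK// ge0_fin_numE// Lq_ge0.
rewrite -mulrA -powRD ?subrKC ?powRr1 ?(ltW v0)//.
by rewrite (gt_eqF v0) implybT.
Qed.

(** The means over consecutive dilates differ by at most a multiple of
    [theta ^+ k]: sum the geometric series. *)
Lemma oscillation_growth f (x : V) (rho theta P : R) : 0 < rho -> 1 < theta -> 0 <= P ->
  (forall k, mu.-integrable (cell s x (2 ^+ k * rho)) (EFin \o f)) ->
  (forall k, \int[mu]_(y in cell s x (2 ^+ k * rho))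
     `|f y - mean f (cell s x (2 ^+ k * rho))| <=
     P * theta ^+ k * volume s x (2 ^+ k * rho)) ->
  forall k, \int[mu]_(y in cell s x (2 ^+ k * rho)) `|f y - mean f (cell s x rho)| <=
    (1 + (d * 2) ^+ n * theta / (theta - 1)) * P * theta ^+ k * volume s x (2 ^+ k * rho).
Proof.
move=> rho0 th1 P0 iff hP.
pose Q k := cell s x (2 ^+ k * rho); pose m k := mean f (Q k).
have pr k : 0 < 2 ^+ k * rho by rewrite mulr_gt0// exprn_gt0.
have mQ k : measurable (Q k) by exact: measurable_cell.
have fQ k : mu (Q k) \is a fin_num by exact: volume_cell_fin.
have vQ k : 0 < fine (mu (Q k)) by exact: volume_gt0.
have QE : cell s x rho = Q 0%N by rewrite /Q expr0 mul1r.
set D := (d * 2) ^+ n * theta / (theta - 1).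
have d0 := sqrtn_gt0 R n0.
have th0 : 0 < theta - 1 by rewrite subr_gt0.
have th : 0 <= theta by lra.
have D0 : 0 <= D by rewrite divr_ge0 ?mulr_ge0 ?exprn_ge0 ?mulr_ge0// ltW.
have DE : D * (theta - 1) = (d * 2) ^+ n * theta by rewrite divfK// gt_eqF.
have hm k : `|m k - m 0%N| <= D * P * theta ^+ k.
  elim: k => [|k ih]; first by rewrite subrr normr0 expr0 mulr1 mulr_ge0.
  have step : `|m k - m k.+1| <= (d * 2) ^+ n * (P * theta ^+ k.+1).
    apply: (mean_diff_le (mQ k) (mQ k.+1)) => //.
    - apply: sub_cell; rewrite subrr snorm0 add0r ler_pM2r// ler_eXn2l ?ltr1n//.
    - have := volume_doubling n0 s s x x (pr k) (ltr0n R 2).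
      by rewrite mulrA -exprS.
    - exact: iff.
    - exact: hP.
  rewrite -(subrKA (m k)); apply: (le_trans (ler_normD _ _)).
  rewrite distrC; apply: (le_trans (lerD step ih)).
  have : 0 <= P * theta ^+ k by rewrite mulr_ge0// exprn_ge0.
  set u := P * theta ^+ k => u0.
  have -> : (d * 2) ^+ n * (P * theta ^+ k.+1) = D * (theta - 1) * u.
    by rewrite DE /u exprS; ring.
  have -> : D * P * theta ^+ k = D * u by rewrite /u; ring.
  have -> : D * P * theta ^+ k.+1 = D * theta * u by rewrite /u exprS; ring.
  by rewrite le_eqVlt; apply/orP; left; apply/eqP; ring.
move=> k; rewrite QE -/(m 0%N) -/(Q k).
have ik (c : R) := integrable_norm (integrable_subr (mQ k) (fQ k) c (iff k)).
apply: (@le_trans _ _ (\int[mu]_(y in Q k) (`|f y - m k| + `|m k - m 0%N|))).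
  apply: le_Rintegral => //.
  - exact: (ik (m 0%N)).
  - have := integrableD (mQ k) (ik (m k)) (integrable_cst (mQ k) (fQ k) `|m k - m 0%N|).
    by apply: eq_integrable.
  - by move=> y _; rewrite -{1}(subrKA (m k)) ler_normD.
rewrite RintegralD//; first last.
  - exact: integrable_cst.
  - exact: (ik (m k)).
rewrite Rintegral_cst//.
have -> : (1 + D) * P * theta ^+ k * volume s x (2 ^+ k * rho) =
  P * theta ^+ k * volume s x (2 ^+ k * rho) + D * P * theta ^+ k * fine (mu (Q k)).
  by rewrite /volume; ring.
by apply: lerD; [exact: hP|rewrite ler_pM2r].
Qed.

Lemma far_integral_oscillation (kappa : R) f (x : V) (r b theta P : R) : 0 < r -> 0 < kappa ->
  1 < theta -> 0 <= P -> theta * 2^-1 `^ kappa < 1 -> 2 <= b -> measurable_fun setT f ->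
  (forall k, mu.-integrable (cell s x (2 ^+ k * (b * r))) (EFin \o f)) ->
  (forall k, \int[mu]_(y in cell s x (2 ^+ k * (b * r)))
     `|f y - mean f (cell s x (2 ^+ k * (b * r)))| <=
     P * theta ^+ k * volume s x (2 ^+ k * (b * r))) ->
  (far_integral kappa x r (fun y => (f y - mean f (cell s x (b * r)))%R) <=
    ((1 + (d * 2) ^+ n * theta / (theta - 1)) * (2 * b) ^+ n /
      (1 - theta * 2^-1 `^ kappa) * P)%:E)%E.
Proof.
move=> r0 k0 th1 P0 thk b2 mf iff hP; have b0 : 0 < b by lra.
have rho0 : 0 < b * r by rewrite mulr_gt0.
have hg := oscillation_growth rho0 th1 P0 iff hP.
set c := mean f (cell s x (b * r)); set D := (1 + _).
have D0 : 0 <= D.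
  rewrite /D addr_ge0// divr_ge0 ?subr_ge0 ?(ltW th1)//.
  by rewrite mulr_ge0 ?exprn_ge0 ?mulr_ge0 ?sqrtr_ge0//; lra.
have -> : D * (2 * b) ^+ n / (1 - theta * 2^-1 `^ kappa) * P =
    D * P * (2 * b) ^+ n / (1 - theta * 2^-1 `^ kappa) by ring.
have M0 : 0 <= D * P * (2 * b) ^+ n.
  by rewrite mulr_ge0 ?mulr_ge0// exprn_ge0// mulr_ge0// ltW.
apply: far_integral_le => //; first by lra.
  exact: measurable_funB.
move=> k; have pr : 0 < 2 ^+ k * (b * r) by rewrite mulr_gt0// exprn_gt0.
have mQ := measurable_cell s x (2 ^+ k * (b * r)).
have ik := integrable_norm (integrable_subr mQ (volume_cell_fin s x pr) c (iff k)).
apply: (@le_trans _ _ (\int[mu]_(z in cell s x (2 ^+ k * (b * r))) `|f z - c|%:E)%E).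
  apply: ge0_subset_integral => //; first exact: (measurable_int _ ik).
  apply: (@subset_trans _ (cell EuclideanBall x (2 ^+ k * (b * r)))); last first.
    exact: ball_sub_cell.
  apply: sub_cell; rewrite subrr snorm0 add0r exprSr -mulrA ler_pM2l ?exprn_gt0//.
  by rewrite ler_pM2r.
have ifin := integrable_fin_num mQ ik.
rewrite -(fineK ifin) lee_fin; apply: (le_trans (hg k)).
have th0 : 0 <= D * P * theta ^+ k by rewrite mulr_ge0 ?mulr_ge0// exprn_ge0//; lra.
apply: (@le_trans _ _ (D * P * theta ^+ k * (2 * (2 ^+ k * (b * r))) ^+ n)).
  by rewrite ler_wpM2l// volume_le.
rewrite le_eqVlt; apply/orP; left; apply/eqP.
have -> : 2 * (2 ^+ k * (b * r)) = (2 * b) * (2 ^+ k * r) by ring.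
by rewrite [in LHS]exprMn; ring.
Qed.

(** The form in which membership in the spaces is used; there [delta] exceeds
    [sigma]. *)
Definition campanato_growth p lambda delta (r M : R) f :=
  forall j, (campanato_norm s p lambda (cell s 0 (2 ^+ j * r)) f <= (M * (2 ^+ j) `^ delta)%:E)%E.

Lemma campanato_growth_oscillation p lambda delta theta (r M : R) f (x : V) t :
  0 < t -> 0 <= M -> 2 `^ (lambda + delta) <= theta -> snorm s x + t <= r ->
  campanato_growth p lambda delta r M f ->
  forall k, (oscillation p f (cell s x (2 ^+ k * t)) <= (t `^ lambda * M * theta ^+ k)%:E)%E.
Proof.
move=> t0 M0 hth xtr G k; have pk : 0 < 2 ^+ k :> R by rewrite exprn_gt0.
have pr : 0 < 2 ^+ k * t by rewrite mulr_gt0.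
have sub : cell s x (2 ^+ k * t) `<=` cell s 0 (2 ^+ k * r).
  apply: sub_cell_origin; apply: (@le_trans _ _ (2 ^+ k * (snorm s x + t))).
    by rewrite mulrDr lerD2r ler_peMl ?snorm_ge0// exprn_ege1// ler1n.
  by rewrite ler_pM2l.
apply: (le_trans (campanato_norm_cell pr sub (G k))).
rewrite lee_fin powRM ?(ltW pk) ?(ltW t0)//.
have -> : (2 ^+ k) `^ lambda * t `^ lambda * (M * (2 ^+ k) `^ delta) =
  t `^ lambda * M * ((2 ^+ k) `^ lambda * (2 ^+ k) `^ delta) by ring.
rewrite -powRD ?(gt_eqF pk) ?implybT// ler_wpM2l ?mulr_ge0 ?powR_ge0//.
rewrite -powR_expn// lerXn2r ?nnegrE ?powR_ge0//.
exact: le_trans (powR_ge0 _ _) hth.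
Qed.

End oscillation_growth.

Section growth.
Context (R : realType) (n : nat) (s : cell_shape).
Local Notation V := 'rV[R]_n.
Local Notation mu := (@lebesgue_rV R n).
Local Notation d := (Num.sqrt n%:R : R).
Local Notation B := (cell EuclideanBall).
Hypothesis n0 : (0 < n)%N.
Implicit Types (f g h : V -> R).

(** A power of 2 with exponent strictly between 0 and [kappa]. *)
Lemma growth_ratio (kappa a : R) : 0 < kappa -> a < kappa ->
  exists theta : R, [/\ 1 < theta, 2 `^ a <= theta & theta * 2^-1 `^ kappa < 1].
Proof.
move=> k0 ak; pose b := Num.max a (kappa / 2).
have b0 : 0 < b by rewrite lt_max divr_gt0 ?orbT.
have bk : b < kappa by rewrite gt_max ak/=; lra.
have hV e : 2^-1 `^ e = (2 `^ e)^-1 :> R by rewrite -powR_inv1// -powRrM mulN1r powRN.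
have gt1 e : 0 < e -> 1 < 2 `^ e :> R.
  by move=> /half_powR_lt1; rewrite hV invf_lt1// powR_gt0.
exists (2 `^ b); split; first exact: gt1.
  by rewrite ler_powR ?ler1n// le_max lexx.
rewrite hV -powRN -powRD ?pnatr_eq0 ?implybT//.
by rewrite -(opprB kappa b) powRN invf_lt1 ?powR_gt0// gt1// subr_gt0.
Qed.

Lemma campanato_growth_shift p lambda delta (r M : R) f k :
  campanato_growth s p lambda delta r M f ->
  campanato_growth s p lambda delta (2 ^+ k * r) (M * (2 ^+ k) `^ delta) f.
Proof.
move=> G j; rewrite mulrA -exprD -mulrA -powRM ?exprn_ge0// -exprD addnC.
exact: G.
Qed.

Lemma far_integralD_le (kappa : R) f g (x : V) (r : R) : 0 < r ->
  measurable_fun setT f -> measurable_fun setT g ->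
  (far_integral kappa x r (f \+ g)%R <= far_integral kappa x r f + far_integral kappa x r g)%E.
Proof.
move=> r0 mf mg; have mA : measurable (away x r) by exact: measurable_away.
have md h : measurable_fun setT h ->
    measurable_fun (away x r) (fun z => (decay kappa x r z * `|h z|)%:E).
  move=> mh; apply/measurable_EFinP; apply: measurable_funM.
    exact: measurable_funTS (measurable_decay _ _ _).
  by apply: measurableT_comp => //; exact: measurable_funTS.
have d0 h z : (0 <= (decay kappa x r z * `|h z|)%:E)%E.
  by rewrite lee_fin; apply: mulr_ge0 => //; exact: decay_ge0.
rewrite /far_integral -ge0_integralD//; [|exact: md..].
apply: ge0_le_integral => //.
- exact: md (measurable_funD mf mg).
- by apply: emeasurable_funD; exact: md.
- by move=> z _; rewrite -EFinD lee_fin -mulrDr ler_wpM2l ?decay_ge0 ?ler_normD.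
Qed.

Section below_kappa.
Variables (kappa q lambda delta : R).
Hypotheses (kappa0 : 0 < kappa) (q1 : 1 <= q) (ldk : lambda + delta < kappa).

Lemma integrable_cells f (x : V) t :
  (forall r, 0 < r -> mu.-integrable (cell s 0 r) (EFin \o f)) -> 0 < t -> mu.-integrable (cell s x t) (EFin \o f).
Proof.
move=> iff t0; have r0 : 0 < snorm s x + t by rewrite ltr_wpDl// snorm_ge0.
apply: integrableS (iff _ r0) => //.
exact: sub_cell_origin.
Qed.

Lemma far_integral_growth : exists2 A : R, 0 <= A & forall f (b : R), measurable_fun setT f ->
  (forall r, 0 < r -> mu.-integrable (cell s 0 r) (EFin \o f)) -> 2 <= b ->
  forall (M r t : R) (x : V), 0 <= M -> 0 < t -> snorm s x + b * t <= r ->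
  campanato_growth s q lambda delta r M f ->
  (far_integral kappa x t (fun y => (f y - mean f (cell s x (b * t)))%R) <=
    (A * b ^+ n * ((b * t) `^ lambda * M))%:E)%E.
Proof.
have [th [th1 hth thk]] := growth_ratio kappa0 ldk.
have th0 : 0 < th by lra.
exists ((1 + (d * 2) ^+ n * th / (th - 1)) * 2 ^+ n / (1 - th * 2^-1 `^ kappa)).
  rewrite divr_ge0 ?subr_ge0 ?(ltW thk)// mulr_ge0 ?exprn_ge0// addr_ge0// divr_ge0 ?subr_ge0 ?(ltW th1)//.
  by rewrite mulr_ge0 ?(ltW th0)// exprn_ge0// mulr_ge0// sqrtr_ge0.
move=> f b mf iff b2 M r t x M0 t0 xtr G; have b0 : 0 < b by lra.
have bt0 : 0 < b * t by rewrite mulr_gt0.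
have P0 : 0 <= (b * t) `^ lambda * M by rewrite mulr_ge0 ?powR_ge0.
have osc := campanato_growth_oscillation bt0 M0 hth xtr G.
have pr k : 0 < 2 ^+ k * (b * t) by rewrite mulr_gt0// exprn_gt0.
have := far_integral_oscillation n0 t0 kappa0 th1 P0 thk b2 mf.
move=> /(_ s x (fun k => integrable_cells x iff (pr k))).
move=> /(_ (fun k => Rintegral_oscillation n0 q1 (pr k) (integrable_cells x iff (pr k)) (osc k))).
move/le_trans; apply; rewrite lee_fin le_eqVlt; apply/orP; left; apply/eqP.
by rewrite [X in _ * X / _]exprMn; ring.
Qed.

Lemma Lq_ball_oscillation f (x : V) (t M : R) : 0 < t -> measurable_fun setT f ->
  (oscillation q f (cell s x t) <= M%:E)%E -> (Lq mu q (B x t) f < +oo)%E.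
Proof.
move=> t0 mf /(Lq_oscillation n0 q1 t0) h.
have q0 : 0 < q by apply: lt_le_trans q1.
have mB : measurable (B x t) by exact: measurable_cell.
have mQ : measurable (cell s x t) by exact: measurable_cell.
apply: (@le_lt_trans _ _ (Lq mu q (cell s x t) f)).
  by apply: Lq_subset => //; [exact: measurable_funTS|exact: ball_sub_cell].
set c := mean f _ in h.
have -> : f = (fun y => f y - c) \+ cst c by apply/funext => y /=; rewrite subrK.
apply: le_lt_trans (LqD mu q1 mQ _ _) _ => //.
  by apply: measurable_funB => //; exact: measurable_funTS.
rewrite lte_add_pinfty ?(le_lt_trans h (ltry _))// Lq_cst//.
by rewrite lte_mul_pinfty ?lee_fin// poweR_lty// volume_cell_lty.
Qed.

(** Growth of the oscillations below the exponent [kappa] suffices for the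
    modified integrals to converge. *)
Lemma campanato_growth_admissible f (r M : R) : measurable_fun setT f ->
  (forall r, 0 < r -> mu.-integrable (cell s 0 r) (EFin \o f)) -> 0 < r -> 0 <= M ->
  campanato_growth s q lambda delta r M f -> admissible kappa q f.
Proof.
move=> mf iff r0 M0 G; have q0 : 0 < q by apply: lt_le_trans q1.
have big (x : V) t : exists2 k, snorm s x + 2 * t <= 2 ^+ k * r &
    campanato_growth s q lambda delta (2 ^+ k * r) (M * (2 ^+ k) `^ delta) f.
  exists (Num.Def.archi_bound ((snorm s x + 2 * t) / r)).
    by rewrite -ler_pdivrMr// ltW//; exact: upper_nthrootP.
  exact: campanato_growth_shift.
have M'0 k : 0 <= M * (2 ^+ k) `^ delta by rewrite mulr_ge0 ?powR_ge0.
split => // x t t0.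
  have [k xt Gk] := big x t.
  have xt' : snorm s x + t <= 2 ^+ k * r by lra.
  have := campanato_growth_oscillation t0 (M'0 k) (lexx _) xt' Gk 0.
  by rewrite expr0 mul1r; exact: Lq_ball_oscillation.
have [A A0 hA] := far_integral_growth.
have [k xt Gk] := big x t.
have := hA f 2 mf iff (lexx _) _ _ t x (M'0 k) t0 xt Gk.
set c := mean f _ => h.
have -> : f = (fun y => f y - c) \+ cst c by apply/funext => y /=; rewrite subrK.
apply: le_lt_trans (far_integralD_le kappa x t0 _ _) _ => //.
  exact: measurable_funB.
rewrite lte_add_pinfty ?(le_lt_trans h (ltry _))//.
exact: le_lt_trans (far_integral_cst_le _ _ _ t0) (ltry _).
Qed.

End below_kappa.
End growth.

Section estimate.
Context (R : realType) (n : nat) (s : cell_shape).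
Local Notation V := 'rV[R]_n.
Local Notation mu := (@lebesgue_rV R n).
Local Notation d := (Num.sqrt n%:R : R).
Local Notation B := (cell EuclideanBall).
Variables (kappa C : R) (K : V -> V -> R) (T : (V -> R) -> V -> R).
Hypotheses (n0 : (0 < n)%N) (hK : standard_kernel kappa C K).
Hypothesis hT : singular_integral kappa K T.
Implicit Types (f g : V -> R).

Let kappa0 := kernel_kappa_gt0 hK.
Let C0 := kernel_const_ge0 hK.

Lemma modified_limit_integrable q f g (x : V) t : 1 <= q -> 0 < t ->
  modified_limit s K q f g -> mu.-integrable (cell s x t) (EFin \o g).
Proof.
move=> q1 t0 lg; have d0 := sqrtn_gt0 R n0.
have dt0 : 0 < d * t by rewrite mulr_gt0.
have r0 : 0 < enorm x + d * t by rewrite ltr_wpDl// enorm_ge0.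
have mg := modified_limit_measurable lg.
have mB : measurable (B (0 : V) (enorm x + d * t)) by exact: measurable_cell.
have ig : mu.-integrable (B 0 (enorm x + d * t)) (EFin \o g).
  apply: (Lq_lty_integrable q1 mB); first exact: volume_cell_lty.
    exact: measurable_funTS.
  exact: modified_limit_lty lg _ r0.
apply: integrableS ig => //.
apply: (@subset_trans _ (B x (d * t))); first exact: cell_sub_ball.
by apply: ball_sub_ball; rewrite subr0.
Qed.

(** The value of the modified operator on a cell is governed by the behaviour
    of the function on a fixed dilate of it and by the growth of the function
    away from it; both are controlled by the growth of the Campanato norms. *)
Lemma modified_limit_campanato q lambda delta : 1 < q -> lambda + delta < kappa ->
  exists A m, 0 <= A /\ forall f g r M, 0 < r -> 0 <= M ->
    admissible kappa q f -> modified_limit s K q f g ->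
    campanato_growth s q lambda delta (2 ^+ m * r) M f ->
    (campanato_norm s q lambda (cell s 0 r) g <= (A * M)%:E)%E.
Proof.
move=> q1 ldk; have q0 : 0 < q by apply: lt_trans q1.
have [Cq Cq0 hCq] := modified_limit_ball s n0 hK hT q1.
have [Af Af0 hAf] := far_integral_growth s n0 kappa0 (ltW q1) ldk.
have d1 := sqrtn_ge1 R n0; have d0 := sqrtn_gt0 R n0.
(* [m] is such that [cell s x (2 ^+ m * t)] contains [B x (2 * (d * t))], where
   [B x (d * t)] contains [cell s x t]. *)
pose m := Num.Def.archi_bound (2 * d).
have hm : 2 * d <= 2 ^+ m by rewrite ltW//; exact: upper_nthrootP.
have m0 : 0 < 2 ^+ m :> R by rewrite exprn_gt0.
pose b := 2 ^+ m / d : R; have b2 : 2 <= b by rewrite ler_pdivlMr.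
have b0 : 0 < b by lra.
pose E : R := ((d * 2 ^+ m) ^+ n) `^ q^-1.
have E0 : 0 <= E by exact: powR_ge0.
pose F := Af * b ^+ n.
have F0 : 0 <= F by rewrite mulr_ge0// exprn_ge0// ltW.
exists (2 * E * (Cq + C * F) * (2 ^+ m) `^ lambda), m; split.
  rewrite mulr_ge0 ?powR_ge0//; apply: mulr_ge0; first exact: mulr_ge0.
  by rewrite addr_ge0 ?(ltW Cq0)// mulr_ge0.
move=> f g r M r0 M0 af lg G.
apply: ge_ereal_sup => _ [x [t [t0 sub ->]]].
have xtr := cell_sub_origin n0 t0 sub.
have mt0 : 0 < 2 ^+ m * t by rewrite mulr_gt0.
have dt0 : 0 < d * t by rewrite mulr_gt0.
have bdt : b * (d * t) = 2 ^+ m * t by rewrite /b mulrA divfK// gt_eqF.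
have xtr' : snorm s x + 2 ^+ m * t <= 2 ^+ m * r.
  apply: (@le_trans _ _ (2 ^+ m * (snorm s x + t))); last by rewrite ler_pM2l.
  by rewrite mulrDr lerD2r ler_peMl ?snorm_ge0// exprn_ege1// ler1n.
have mf := admissible_measurable af.
have iQ (y : V) u : 0 < u -> mu.-integrable (cell s y u) (EFin \o f).
  move=> u0; have du0 : 0 < d * u by rewrite mulr_gt0.
  apply: integrableS (admissible_integrable (ltW q1) af y du0) => //.
  exact: cell_sub_ball.
pose P := (2 ^+ m * t) `^ lambda * M.
have P0 : 0 <= P by rewrite mulr_ge0 ?powR_ge0.
pose Q := cell s x (2 ^+ m * t); pose c := mean f Q.
have far : (far_integral kappa x (d * t) (fun y => (f y - c)%R) <= (F * P)%:E)%E.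
  have := hAf f b mf (fun r => iQ 0 r) b2 M (2 ^+ m * r) (d * t) x M0 dt0.
  by rewrite bdt; apply.
have osc : (oscillation q f Q <= P%:E)%E.
  have := campanato_growth_oscillation mt0 M0 (lexx _) xtr' G 0.
  by rewrite !expr0 mul1r mulr1.
have mQ : measurable Q by exact: measurable_cell.
have mU : measurable (cell s x t) by exact: measurable_cell.
pose v := volume s x t; have v0 : 0 < v by exact: volume_gt0.
have volQ : volume s x (2 ^+ m * t) <= (d * 2 ^+ m) ^+ n * v by exact: volume_doubling.
have volP : (volume s x (2 ^+ m * t)) `^ q^-1 <= E * v `^ q^-1.
  rewrite -powRM ?exprn_ge0 ?mulr_ge0 ?(ltW v0) ?(ltW m0) ?(ltW d0)//.
  have vQ0 : 0 <= volume s x (2 ^+ m * t) by rewrite ltW// volume_gt0.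
  by rewrite ge0_ler_powR ?invr_ge0 ?(ltW q0) ?nnegrE//; exact: le_trans volQ.
have BQ : B x (2 * (d * t)) `<=` Q.
  apply: (@subset_trans _ (cell s x (2 * (d * t)))); first exact: ball_sub_cell.
  by apply: sub_cell; rewrite subrr snorm0 add0r mulrA ler_pM2r.
have mB u : measurable (B x u) by exact: measurable_cell.
have volB : (mu (B x (d * t)) `^ q^-1 <= (E * v `^ q^-1)%:E)%E.
  apply: (@le_trans _ _ (mu Q `^ q^-1)%E).
    rewrite le_poweR ?invr_ge0 ?(ltW q0)//; apply: le_measure; rewrite ?inE//.
    apply: subset_trans BQ; apply: (@sub_cell _ _ EuclideanBall).
    by rewrite subrr snorm0 add0r ler_peMl ?ler1n// ltW.
  by rewrite /Q volumeE// poweR_EFin lee_fin.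
have [a ha] := hCq f g x (d * t) c af lg dt0.
have hLf : (Lq mu q (B x (2 * (d * t))) (fun y => (f y - c)%R) <= (P * (E * v `^ q^-1))%:E)%E.
  apply: (@le_trans _ _ (Lq mu q Q (fun y => (f y - c)%R))).
    apply: Lq_subset => //; apply: measurable_funTS; exact: measurable_funB.
  apply: (le_trans (Lq_oscillation n0 (ltW q1) mt0 osc)).
  by rewrite lee_fin ler_wpM2l.
have far0 := far_integral_ge0 kappa x (d * t) (fun y => f y - c).
have farfin : fine (far_integral kappa x (d * t) (fun y => f y - c)) <= F * P.
  by rewrite -lee_fin fineK// ge0_fin_numE// (le_lt_trans far)// ltry.
have hg : (Lq mu q (cell s x t) (fun y => (g y - a)%R) <=
    ((Cq + C * F) * P * (E * v `^ q^-1))%:E)%E.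
  apply: (@le_trans _ _ (Lq mu q (B x (d * t)) (fun y => (g y - a)%R))).
    apply: Lq_subset => //; last exact: cell_sub_ball.
    by apply: measurable_funTS; apply: measurable_funB => //; exact: modified_limit_measurable lg.
  apply: (le_trans ha).
  rewrite (_ : (Cq + C * F) * P * (E * v `^ q^-1) =
    Cq * (P * (E * v `^ q^-1)) + C * (F * P) * (E * v `^ q^-1)); last by ring.
  rewrite EFinD leeD//.
    by rewrite EFinM lee_wpmul2l// lee_fin ltW.
  rewrite [leRHS]EFinM lee_pmul//.
  - by rewrite lee_fin mulr_ge0// fine_ge0.
  - exact: poweR_ge0.
  - by rewrite lee_fin ler_wpM2l.
have ig := modified_limit_integrable x (ltW q1) t0 lg.
have := oscillation_le mU (volume_cell_fin s x t0) v0 a (ltW q1) ig.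
rewrite -/v => hosc.
have tl0 : 0 < t `^ lambda by rewrite powR_gt0.
have vq0 : 0 < v `^ q^-1 by rewrite powR_gt0.
apply: (@le_trans _ _ ((t `^ (- lambda))%:E * ((2 * v `^ (- q^-1))%:E *
   ((Cq + C * F) * P * (E * v `^ q^-1))%:E))%E).
  rewrite lee_wpmul2l ?lee_fin ?powR_ge0//; apply: (le_trans hosc).
  by rewrite lee_wpmul2l// lee_fin mulr_ge0 ?powR_ge0.
rewrite -!EFinM lee_fin /P powRM ?(ltW m0) ?(ltW t0)// !powRN.
rewrite le_eqVlt; apply/orP; left; apply/eqP.
field.
by rewrite !gt_eqF.
Qed.

End estimate.

(** * The John-Nirenberg inequality on dyadic boxes *)

Section dyadic.
Context (R : realType) (n : nat).
Local Notation V := 'rV[R]_n.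
Local Notation mu := (@lebesgue_rV R n).
Implicit Types (a y : V) (l : R) (f g : V -> R) (F G : V -> R -> R).

(** Half-open, so that bisecting the sides partitions a box. *)
Definition box a l : set V := [set y | forall i, a 0 i <= y 0 i < a 0 i + l].

Definition corner a l (e : {ffun 'I_n -> bool}) : V := \row_i (a 0 i + (e i)%:R * (l / 2)).

(** When [F] is the volume times a function of the mean of [f], this is the
    integral of that function of the conditional expectation of [f] at depth
    [k]. *)
Fixpoint dyadic_sum F k a l : R :=
  if k is k'.+1 then \sum_e dyadic_sum F k' (corner a l e) (l / 2) else F a l.

Lemma box_itv a l : box a l = [set y : V | forall i, [set` `[a 0 i, a 0 i + l[] (y 0 i)].
Proof. by apply/seteqP; split => y /= h i; have := h i; rewrite in_itv. Qed.

Lemma measurable_box a l : measurable (box a l).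
Proof.
rewrite box_itv (_ : [set y | _] =
    \bigcap_(i in setT) (rV_coord i @^-1` [set` `[a 0 i, a 0 i + l[])); last first.
  by apply/seteqP; split => x /= h; [move=> i _; exact: h|move=> i; exact: h].
apply: fin_bigcap_measurable => // i _; rewrite -[X in measurable X]setTI.
by apply: measurable_rV_coord => //; exact: measurable_itv.
Qed.

Lemma lebesgue_box a l : 0 < l -> mu (box a l) = (l ^+ n)%:E.
Proof.
move=> l0; rewrite box_itv (@lebesgue_rV_box R n (fun i => [set` `[a 0 i, a 0 i + l[]))//.
rewrite (eq_bigr (fun=> l%:E)).
  by rewrite prodEFin prodr_const card_ord.
by move=> i _; rewrite lebesgue_measure_itv/= lte_fin ltrDl l0 -EFinB addrAC subrr add0r.
Qed.

Lemma box_corner a l e y : 0 < l -> box (corner a l e) (l / 2) y <->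
  box a l y /\ forall i, e i = (a 0 i + l / 2 <= y 0 i).
Proof.
move=> l0; split => [h|[h he] i].
  suff H i : a 0 i <= y 0 i < a 0 i + l /\ e i = (a 0 i + l / 2 <= y 0 i).
    by split => i; have [] := H i.
  have := h i; rewrite mxE; case: (e i); rewrite ?mul1r ?mul0r ?addr0 => /andP[h1 h2].
    by rewrite h1; split => //; apply/andP; split; lra.
  by rewrite [a 0 i + _ <= _]leNgt h2; split => //; apply/andP; split; lra.
have /andP[h1 h2] := h i; rewrite mxE he; case: (leP (a 0 i + l / 2)) => h3; rewrite ?mul1r ?mul0r ?addr0; apply/andP; split; lra.
Qed.

Lemma box_children a l : 0 < l ->
  box a l = \big[setU/set0]_(e : {ffun 'I_n -> bool}) box (corner a l e) (l / 2).
Proof.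
move=> l0; rewrite -bigcup_seq; apply/seteqP; split => y; last first.
  by move=> [e _ /(box_corner _ _ _ l0)[]].
move=> yl; exists [ffun i => a 0 i + l / 2 <= y 0 i].
  by rewrite /= mem_index_enum.
by apply/(box_corner _ _ _ l0); split => // i; rewrite ffunE.
Qed.

Lemma sub_box_corner a l e : 0 < l -> box (corner a l e) (l / 2) `<=` box a l.
Proof. by move=> l0 y /(box_corner _ _ _ l0)[]. Qed.

Lemma Rintegral_box_children f a l : 0 < l -> mu.-integrable (box a l) (EFin \o f) ->
  \int[mu]_(y in box a l) f y =
  \sum_(e : {ffun 'I_n -> bool}) \int[mu]_(y in box (corner a l e) (l / 2)) f y.
Proof.
move=> l0 iff; apply: EFin_inj; rewrite -sumEFin.
have mb b h : measurable (box b h) by exact: measurable_box.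
rewrite /Rintegral fineK; last exact: integrable_fin_num.
rewrite {1}box_children// integral_bigsetU_EFin//.
- apply: eq_bigr => e _; rewrite fineK//; apply: integrable_fin_num => //.
  by apply: integrableS iff => //; exact: sub_box_corner.
- exact: index_enum_uniq.
- apply/trivIsetP => e e' _ _ ee'; apply/seteqP; split => // y.
  move=> [/(box_corner _ _ _ l0)[_ h] /(box_corner _ _ _ l0)[_ h']].
  by move/eqP: ee' => /(_ _)[]; apply/ffunP => i; rewrite h h'.
- by rewrite -box_children//; exact: (measurable_int _ iff).
Qed.

Lemma dyadic_sum_le F G k a l : 0 < l ->
  (forall b, box b (l / 2 ^+ k) `<=` box a l -> F b (l / 2 ^+ k) <= G b (l / 2 ^+ k)) ->
  dyadic_sum F k a l <= dyadic_sum G k a l.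
Proof.
elim: k a l => [|k ih] a l l0 h /=.
  by have := h a; rewrite expr0 divr1; exact.
apply: ler_sum => e _; apply: ih; first by rewrite divr_gt0.
have -> : l / 2 / 2 ^+ k = l / 2 ^+ k.+1 by rewrite exprS invfM mulrA.
by move=> b hb; apply: h; apply: subset_trans hb _; exact: sub_box_corner.
Qed.

Lemma dyadic_sum_lin (c : R) F G k a l :
  dyadic_sum (fun a l => c * F a l + G a l) k a l =
  c * dyadic_sum F k a l + dyadic_sum G k a l.
Proof.
elim: k a l => [//|k ih] a l /=; rewrite mulr_sumr -big_split/=.
by apply: eq_bigr => e _; exact: ih.
Qed.

Lemma dyadic_sum0 k a l : dyadic_sum (fun _ _ => 0) k a l = 0.
Proof. by elim: k a l => //= k ih a l; rewrite big1. Qed.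

Lemma dyadic_sumZ (c : R) F k a l :
  dyadic_sum (fun a l => c * F a l) k a l = c * dyadic_sum F k a l.
Proof.
elim: k a l => [//|k ih] a l /=; rewrite mulr_sumr.
by apply: eq_bigr => e _; exact: ih.
Qed.

Lemma dyadic_sum_integral f k a l : 0 < l -> mu.-integrable (box a l) (EFin \o f) ->
  dyadic_sum (fun a l => \int[mu]_(y in box a l) f y) k a l = \int[mu]_(y in box a l) f y.
Proof.
elim: k a l => [//|k ih] a l l0 iff /=; rewrite Rintegral_box_children//.
apply: eq_bigr => e _; apply: ih; first by rewrite divr_gt0.
apply: integrableS iff => //; [exact: measurable_box..|exact: sub_box_corner].
Qed.

End dyadic.

Section john_nirenberg.
Context (R : realType) (n : nat).
Local Notation V := 'rV[R]_n.
Local Notation mu := (@lebesgue_rV R n).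
Implicit Types (a : V) (l : R) (f g : V -> R).

Local Notation m f a l := (mean f (box a l)).

Lemma box_fin a l : 0 < l -> mu (box a l) \is a fin_num.
Proof. by move=> l0; rewrite lebesgue_box. Qed.

Lemma box_volume a l : 0 < l -> fine (mu (box a l)) = l ^+ n.
Proof. by move=> l0; rewrite lebesgue_box. Qed.

Lemma box_volume_gt0 a l : 0 < l -> 0 < fine (mu (box a l)).
Proof. by move=> l0; rewrite box_volume// exprn_gt0. Qed.

Lemma mean_box_dist f a l (c : R) : 0 < l -> mu.-integrable (box a l) (EFin \o f) ->
  l ^+ n * `|m f a l - c| <= \int[mu]_(y in box a l) `|f y - c|.
Proof.
move=> l0 iff; have v0 : 0 < l ^+ n by rewrite exprn_gt0.
have := mean_dist_le (measurable_box a l) (box_fin a l0) (box_volume_gt0 a l0) c iff.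
by rewrite box_volume// ler_pdivlMl.
Qed.

Section root.
Variables (f : V -> R) (a0 : V) (l0 b : R).
Hypothesis iff : mu.-integrable (box a0 l0) (EFin \o f).
Hypothesis b0 : 0 <= b.
Hypothesis bmo : forall a l, 0 < l -> box a l `<=` box a0 l0 ->
  \int[mu]_(y in box a l) `|f y - m f a l| <= b * l ^+ n.

Let sub_integrable a l : box a l `<=` box a0 l0 -> mu.-integrable (box a l) (EFin \o f).
Proof. by move=> sub; apply: integrableS iff => //; exact: measurable_box. Qed.

Definition box_variance (c : R) a l := l ^+ n * (m f a l - c) ^+ 2.

(** The difference of the two squares is affine in the mean, hence additive
    under bisection. *)
Lemma box_variance_recentre k a l (c c' : R) : 0 < l -> box a l `<=` box a0 l0 ->
  dyadic_sum (box_variance c) k a l <= dyadic_sum (box_variance c') k a l +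
    (2 * (c' - c) * (m f a l - c') + (c' - c) ^+ 2) * l ^+ n.
Proof.
move=> lp sub.
pose h y := 2 * (c' - c) * (f y - c') + (c' - c) ^+ 2.
have hE b' l' : 0 < l' -> box b' l' `<=` box a0 l0 ->
    mu.-integrable (box b' l') (EFin \o h) /\ \int[mu]_(y in box b' l') h y =
    (2 * (c' - c) * (m f b' l' - c') + (c' - c) ^+ 2) * l' ^+ n.
  move=> lp' sub'; have mB := measurable_box b' l'; have fB := box_fin b' lp'.
  have i1 := integrable_subr mB fB c' (sub_integrable sub').
  have i2 := integrableZl mB (2 * (c' - c)) i1.
  have i3 := integrable_cst mB fB ((c' - c) ^+ 2).
  split; first by apply: eq_integrable (integrableD mB i2 i3).
  rewrite /h RintegralD// RintegralZl// RintegralB//; [|exact: sub_integrable|exact: integrable_cst].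
  rewrite !Rintegral_cst// box_volume// /mean box_volume//.
  by field; rewrite expf_neq0 ?gt_eqF.
have [ih <-] := hE a l lp sub.
rewrite -(dyadic_sum_integral k lp ih) -[X in X + _]mul1r -dyadic_sum_lin.
apply: dyadic_sum_le => // b' sub'.
have lp' : 0 < l / 2 ^+ k by rewrite divr_gt0// exprn_gt0.
have [_ ->] := hE _ _ lp' (subset_trans sub' sub).
by rewrite /box_variance le_eqVlt; apply/orP; left; apply/eqP; ring.
Qed.

(** A Bellman function argument: the mean of [`|f - c|] over a box is additive
    under bisection, and dominates the quadratic increment at each child whose
    mean has moved far from [c]; there one starts afresh from the mean of the
    child. *)
Lemma dyadic_variance k a l (c : R) : 0 < l -> box a l `<=` box a0 l0 ->
  `|m f a l - c| <= 2 * b ->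
  dyadic_sum (box_variance c) k a l <=
    (2 + 2 ^+ n) ^+ 2 * b * \int[mu]_(y in box a l) `|f y - c|.
Proof.
set al := (2 + 2 ^+ n) ^+ 2.
have al4 : 4 <= al.
  have : 0 <= 2 ^+ n :> R by rewrite exprn_ge0.
  by rewrite /al; set u := 2 ^+ n; nra.
elim: k a l c => [|k ih] a l c lp sub mc.
  have h := mean_box_dist c lp (sub_integrable sub).
  rewrite /= /box_variance -real_normK ?num_real//.
  have v0 : 0 <= l ^+ n by rewrite exprn_ge0// ltW.
  set I := Rintegral _ _ _ in h *; set u := `|_ - _| in mc h *.
  have u0 : 0 <= u by rewrite normr_ge0.
  have vu : 0 <= l ^+ n * u by apply: mulr_ge0.
  have I0 : 0 <= I by exact: le_trans h.
  apply: (@le_trans _ _ (I * (2 * b))).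
    by rewrite expr2 mulrA; apply: ler_pM.
  by rewrite mulrC ler_wpM2r// ler_wpM2r//; lra.
have mB := measurable_box a l; have fB := box_fin a lp.
have iab := integrable_norm (integrable_subr mB fB c (sub_integrable sub)).
rewrite /= Rintegral_box_children// mulr_sumr; apply: ler_sum => e _.
have lp2 : 0 < l / 2 by rewrite divr_gt0.
have subc : box (corner a l e) (l / 2) `<=` box a l by exact: sub_box_corner.
have sub2 := subset_trans subc sub.
set q := corner a l e in subc sub2 *.
have [|far] := leP `|m f q (l / 2) - c| (2 * b); first exact: ih.
(* The child has moved far from [c]: start afresh from its own mean. *)
apply: (le_trans (box_variance_recentre k c (m f q (l / 2)) lp2 sub2)).
rewrite subrr mulr0 add0r.
have v0 : 0 < (l / 2) ^+ n by rewrite exprn_gt0.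
have h1 : dyadic_sum (box_variance (m f q (l / 2))) k q (l / 2) <= al * b * (b * (l / 2) ^+ n).
  apply: le_trans (ih _ _ _ lp2 sub2 _) _; first by rewrite subrr normr0 mulr_ge0.
  by rewrite ler_wpM2l ?bmo// mulr_ge0//; lra.
have hm : `|m f q (l / 2) - c| <= (2 + 2 ^+ n) * b.
  rewrite -(subrKA (m f a l)); apply: (le_trans (ler_normD _ _)).
  rewrite mulrDl addrC; apply: lerD => //.
  apply: (mean_diff_le (measurable_box _ _) mB (box_fin q lp2) fB) => //.
  - exact: box_volume_gt0.
  - exact: box_volume_gt0.
  - by rewrite !box_volume// -exprMn mulrC divfK.
  - exact: sub_integrable.
  - by rewrite box_volume//; exact: bmo.
have h2 := mean_box_dist c lp2 (sub_integrable sub2).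
rewrite -(real_normK (num_real (_ - c))).
set I := Rintegral _ _ _ in h2 *; set u := `|_ - _| in far hm h2 *.
have hu2 : u ^+ 2 <= al * b ^+ 2.
  have u0 : 0 <= u by exact: normr_ge0.
  by rewrite /al -exprMn lerXn2r// nnegrE; exact: le_trans hm.
have : al * b * (2 * b * (l / 2) ^+ n) <= al * b * I.
  apply: ler_wpM2l; first by rewrite mulr_ge0//; lra.
  by apply: le_trans h2; rewrite mulrC ler_pM2l// ltW.
have : u ^+ 2 * (l / 2) ^+ n <= al * b ^+ 2 * (l / 2) ^+ n by rewrite ler_pM2r.
by move: h1; set D := dyadic_sum _ _ _ _; lra.
Qed.

End root.
End john_nirenberg.

Section dyadic_approximation.
Context (R : realType) (n : nat).
Local Notation V := 'rV[R]_n.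
Local Notation mu := (@lebesgue_rV R n).
Implicit Types (a : V) (l : R) (f g : V -> R) (A : set V).
Local Notation m f a l := (mean f (box a l)).
Variables (a0 : V) (l0 : R).
Hypothesis l0_gt0 : 0 < l0.
Local Notation Q := (box a0 l0).

Definition box_dist f a l := \int[mu]_(y in box a l) `|f y - m f a l|.

(** The dyadic step functions given by the means of [f] tend to [f] in the
    mean. *)
Record dyadic_flat f : Prop := {
  dyadic_flat_integrable : mu.-integrable Q (EFin \o f);
  dyadic_flat_small : forall e, 0 < e ->
    \forall k \near \oo, dyadic_sum (box_dist f) k a0 l0 <= e }.

Let mQ : measurable Q. Proof. exact: measurable_box. Qed.

Let Qfin : mu Q \is a fin_num. Proof. exact: box_fin. Qed.

Let side_gt0 k : 0 < l0 / 2 ^+ k. Proof. by rewrite divr_gt0// exprn_gt0. Qed.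

Let sub_integrable f a l : mu.-integrable Q (EFin \o f) -> box a l `<=` Q ->
  mu.-integrable (box a l) (EFin \o f).
Proof. by move=> iff sub; apply: integrableS iff => //; exact: measurable_box. Qed.

Lemma box_dist_le f a l (c : R) : 0 < l -> mu.-integrable (box a l) (EFin \o f) ->
  box_dist f a l <= 2 * \int[mu]_(y in box a l) `|f y - c|.
Proof.
move=> lp iff; have mB := measurable_box a l; have fB := box_fin a lp.
have i1 c' := integrable_norm (integrable_subr mB fB c' iff).
have i2 := integrable_cst mB fB `|m f a l - c|.
apply: (@le_trans _ _ (\int[mu]_(y in box a l) (`|f y - c| + `|m f a l - c|))).
  apply: le_Rintegral => //; first exact: (i1 (m f a l)).
    by apply: eq_integrable (integrableD mB (i1 c) i2).
  move=> y _; rewrite -{1}(subrKA c); apply: (le_trans (ler_normD _ _)).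
  by rewrite lerD2l distrC.
rewrite RintegralD//; last exact: (i1 c).
rewrite Rintegral_cst// box_volume// mulr_natl mulr2n lerD2l mulrC.
exact: mean_box_dist.
Qed.

(** Flatness passes to a function that is, on each box, about as close to a
    constant as [g] and [h] are. *)
Lemma dyadic_flat_le f g h (M : R) : 0 <= M -> mu.-integrable Q (EFin \o f) ->
  dyadic_flat g -> dyadic_flat h ->
  (forall a l, 0 < l -> box a l `<=` Q ->
    exists c, \int[mu]_(y in box a l) `|f y - c| <= M * (box_dist g a l + box_dist h a l)) ->
  dyadic_flat f.
Proof.
move=> M0 iff [_ hg] [_ hh] H; split; [exact: iff|move=> e e0].
have M1 : 0 < 4 * M + 1 by lra.
have e1 : 0 < e / (4 * M + 1) by rewrite divr_gt0.
have := hg _ e1; have := hh _ e1; apply: filterS2 => k hk gk.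
pose G a l := M * box_dist g a l + M * box_dist h a l.
apply: (@le_trans _ _ (2 * dyadic_sum G k a0 l0)).
  rewrite -dyadic_sumZ; apply: dyadic_sum_le => // b sub.
  have [c hc] := H _ _ (side_gt0 k) sub.
  apply: le_trans (box_dist_le c (side_gt0 k) (sub_integrable iff sub)) _.
  by rewrite ler_pM2l// /G -mulrDr.
rewrite /G dyadic_sum_lin dyadic_sumZ -mulrDr mulrA.
apply: (@le_trans _ _ (2 * M * (e / (4 * M + 1) + e / (4 * M + 1)))).
  rewrite ler_wpM2l//; first by rewrite mulr_ge0.
  exact: (lerD gk hk).
have -> : 2 * M * (e / (4 * M + 1) + e / (4 * M + 1)) = e - e / (4 * M + 1).
  by field; rewrite gt_eqF.
by rewrite gerBl ltW.
Qed.

Lemma dyadic_flat_cst (c : R) : dyadic_flat (cst c).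
Proof.
split; first exact: integrable_cst.
move=> e e0; near=> k; apply: le_trans (ltW e0).
rewrite -(@dyadic_sum0 _ _ k a0 l0); apply: dyadic_sum_le => // b sub.
have ic := integrable_cst (measurable_box b _) (box_fin b (side_gt0 k)) c.
apply: (le_trans (box_dist_le c (side_gt0 k) ic)).
rewrite (_ : (fun y => _) = cst 0); last by apply/funext => y; rewrite /= subrr normr0.
by rewrite Rintegral_cst ?mul0r ?mulr0//; exact: measurable_box.
Unshelve. all: by end_near. Qed.

Lemma dyadic_flat_lin (r : R) f g : dyadic_flat f -> dyadic_flat g ->
  dyadic_flat (fun y => r * f y + g y).
Proof.
move=> ff fg; have [iff _] := ff; have [ig _] := fg.
have irf := integrableZl mQ r iff.
apply: (@dyadic_flat_le _ f g (`|r| + 1)) => //.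
  by apply: eq_integrable (integrableD mQ irf ig).
move=> a l lp sub; exists (r * m f a l + m g a l).
have mB := measurable_box a l; have fB := box_fin a lp.
have i1 := integrable_norm (integrable_subr mB fB (m f a l) (sub_integrable iff sub)).
have i2 := integrable_norm (integrable_subr mB fB (m g a l) (sub_integrable ig sub)).
have i3 := integrableZl mB `|r| i1.
apply: (@le_trans _ _ (\int[mu]_(y in box a l) (`|r| * `|f y - m f a l| + `|g y - m g a l|))).
  apply: le_Rintegral => //.
  - have irfg := integrableD mB (integrableZl mB r (sub_integrable iff sub)) (sub_integrable ig sub).
    by apply: integrable_norm (integrable_subr mB fB _ _); apply: eq_integrable irfg.
  - by apply: eq_integrable (integrableD mB i3 i2).
  - move=> y _; rewrite -normrM; apply: le_trans (ler_normD _ _).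
    by rewrite le_eqVlt; apply/orP; left; apply/eqP; congr `|_|; ring.
rewrite RintegralD// RintegralZl// -/(box_dist f a l) -/(box_dist g a l).
have F0 : 0 <= box_dist f a l by apply: Rintegral_ge0.
have G0 : 0 <= box_dist g a l by apply: Rintegral_ge0.
by rewrite mulrDl mul1r lerD ?lerDr// ler_wpM2l ?lerDl.
Qed.

Lemma dyadic_flat_approx f : mu.-integrable Q (EFin \o f) ->
  (forall e, 0 < e -> exists2 g, dyadic_flat g & \int[mu]_(y in Q) `|f y - g y| <= e) ->
  dyadic_flat f.
Proof.
move=> iff H; split; [exact: iff|move=> e e0]; have e4 : 0 < e / 4 by rewrite divr_gt0.
have [g [ig hg] fg] := H _ e4; have := hg _ e4; apply: filterS => k hk.
have ifg : mu.-integrable Q (EFin \o (fun y => `|f y - g y|)).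
  by apply: integrable_norm; apply: eq_integrable (integrableB mQ iff ig).
have -> : e = 2 * (e / 4) + 2 * (e / 4) by field.
apply: (@le_trans _ _ (2 * dyadic_sum (box_dist g) k a0 l0 +
    dyadic_sum (fun a l => \int[mu]_(y in box a l) (2 * `|f y - g y|)) k a0 l0)); last first.
  rewrite dyadic_sum_integral//; last by apply: eq_integrable (integrableZl mQ 2 ifg).
  by rewrite RintegralZl// lerD// ler_pM2l.
rewrite -dyadic_sum_lin; apply: dyadic_sum_le => // b sub.
have lp := side_gt0 k; set l := l0 / _ in sub lp *.
have mB := measurable_box b l; have fB := box_fin b lp.
apply: (le_trans (box_dist_le (m g b l) lp (sub_integrable iff sub))).
have i1 := integrable_norm (integrable_subr mB fB (m g b l) (sub_integrable ig sub)).
have i2 := sub_integrable ifg sub.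
rewrite RintegralZl// -mulrDr ler_pM2l// -RintegralD//.
apply: le_Rintegral => //.
- exact: (integrable_norm (integrable_subr mB fB (m g b l) (sub_integrable iff sub))).
- by apply: eq_integrable (integrableD mB i1 i2).
- move=> y _; apply: le_trans (ler_normD _ _).
  by rewrite le_eqVlt; apply/orP; left; apply/eqP; congr `|_|; ring.
Qed.

End dyadic_approximation.

Lemma dist_max_le (R : realDomainType) (u v u' v' : R) :
  `|Num.max u v - Num.max u' v'| <= `|u - u'| + `|v - v'|.
Proof.
have hu := ler_norm (u - u'); have hu2 := ler_norm (- (u - u')); rewrite normrN in hu2.
have hv := ler_norm (v - v'); have hv2 := ler_norm (- (v - v')); rewrite normrN in hv2.
have pu := normr_ge0 (u - u'); have pv := normr_ge0 (v - v').
by rewrite ler_norml; apply/andP; split; case: (leP u v) => h1; case: (leP u' v') => h2; lra.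
Qed.

Section dyadic_density.
Context (R : realType) (n : nat).
Local Notation V := 'rV[R]_n.
Local Notation mu := (@lebesgue_rV R n).
Implicit Types (a : V) (l : R) (f g : V -> R) (A : set V).
Local Notation m f a l := (mean f (box a l)).
Variables (a0 : V) (l0 : R).
Hypothesis l0_gt0 : 0 < l0.
Local Notation Q := (box a0 l0).
Local Notation flat := (dyadic_flat a0 l0).

Let mQ : measurable Q. Proof. exact: measurable_box. Qed.

Let Qfin : mu Q \is a fin_num. Proof. exact: box_fin. Qed.

Let side_gt0 k : 0 < l0 / 2 ^+ k. Proof. by rewrite divr_gt0// exprn_gt0. Qed.

Lemma integrable_indic_box a l A : 0 < l -> measurable A ->
  mu.-integrable (box a l) (EFin \o \1_A).
Proof.
move=> lp mA; apply/integrableP; split.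
  by apply/measurable_EFinP; exact: measurable_indic.
have mB := measurable_box a l.
rewrite (eq_integral (fun y => (\1_A y)%:E)); last first.
  by move=> y _; rewrite /= ger0_norm// indicE; case: (y \in A).
rewrite integral_indic//; apply: (@le_lt_trans _ _ (mu (box a l))).
  by apply: le_measure; rewrite ?inE//; exact: measurableI.
by rewrite lebesgue_box// ltry.
Qed.

Lemma Rintegral_shrinking (S : nat -> set V) : (forall k, measurable (S k)) ->
  {homo S : i j / (i <= j)%N >-> (j `<=` i)} -> \bigcap_k S k = set0 ->
  forall e : R, 0 < e -> \forall k \near \oo, \int[mu]_(y in Q) (\1_(S k) y) <= e.
Proof.
move=> mS homS capS e e0.
have mSQ k : measurable (S k `&` Q) by exact: measurableI.
have cap0 : \bigcap_k (S k `&` Q) = set0.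
  by apply/seteqP; split => // y yS; rewrite -capS => k _; have [] := yS k I.
have := @nonincreasing_cvg_mu _ _ _ mu (fun k => S k `&` Q).
rewrite cap0 measure0 => /(_ _ _ _ _)/fine_cvgP[].
- apply: (@le_lt_trans _ _ (mu Q)); last by rewrite lebesgue_box// ltry.
  by apply: le_measure; rewrite ?inE//; exact: subIsetr.
- by [].
- exact: measurable0.
- by move=> i j ij; apply/subsetPset; exact: setSI (homS _ _ ij).
move=> _ /cvgrPdist_le /(_ e e0); apply: filterS => k /=.
rewrite sub0r normrN /Rintegral integral_indic// ger0_norm//.
Qed.

Definition flat_set A := measurable A /\ flat \1_A.

Lemma flat_setC A : flat_set A -> flat_set (~` A).
Proof.
move=> [mA fA]; split; first exact: measurableC.
have := dyadic_flat_lin l0_gt0 (-1) fA (dyadic_flat_cst a0 l0_gt0 1).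
by congr flat; apply/funext => y; rewrite !indicE in_setC; case: (y \in A) => /=; ring.
Qed.

Lemma flat_setU A B : flat_set A -> flat_set B -> flat_set (A `|` B).
Proof.
move=> [mA fA] [mB fB]; have mAB : measurable (A `|` B) by exact: measurableU.
split => //; apply: (dyadic_flat_le l0_gt0 (M := 1) _ _ fA fB) => //.
  exact: integrable_indic_box.
move=> a l lp sub; exists (Num.max (m \1_A a l) (m \1_B a l)).
have mbx := measurable_box a l; have fbx := box_fin a lp.
have i1 (D : set V) (c : R) : measurable D ->
    mu.-integrable (box a l) (EFin \o (fun y => `|\1_D y - c|)).
  by move=> mD; exact: integrable_norm (integrable_subr mbx fbx c (integrable_indic_box a lp mD)).
rewrite mul1r /box_dist -RintegralD//; [|exact: i1..].
apply: le_Rintegral => //; first exact: i1.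
  by apply: eq_integrable (integrableD mbx (i1 A (m \1_A a l) mA) (i1 B (m \1_B a l) mB)).
move=> y _; rewrite -(_ : Num.max (\1_A y) (\1_B y) = \1_(A `|` B) y :> R); last first.
  by rewrite !indicE in_setU; case: (y \in A); case: (y \in B); rewrite ?maxxx ?maxEle ?ler01 ?ler10.
exact: dist_max_le.
Qed.

Lemma flat_set0 : flat_set set0.
Proof.
split; first exact: measurable0.
by rewrite indic0; exact: (dyadic_flat_cst a0 l0_gt0 0).
Qed.

Lemma flat_bigcup (A : nat -> set V) : (forall j, flat_set (A j)) -> flat_set (\bigcup_j A j).
Proof.
move=> fA; have mA j : measurable (A j) by have [] := fA j.
have mU : measurable (\bigcup_j A j) by exact: bigcupT_measurable.
split => //; apply: dyadic_flat_approx => //; first exact: integrable_indic_box.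
pose W N := \big[setU/set0]_(j < N) A j.
have fW N : flat_set (W N).
  rewrite /W; elim: N => [|N ih]; first by rewrite big_ord0; exact: flat_set0.
  by rewrite big_ord_recr; exact: flat_setU.
pose S N := \bigcup_j A j `\` W N.
have mS N : measurable (S N) by apply: measurableD => //; have [] := fW N.
have homS : {homo S : i j / (i <= j)%N >-> (j `<=` i)}.
  by move=> i j ij; apply: setDS; exact: subset_bigsetU.
have capS : \bigcap_N S N = set0.
  apply/seteqP; split => // y yS; have [[j _ yj] _] := yS 0 I.
  have [_] := yS j.+1 I; apply; rewrite /W big_ord_recr; by right.
move=> e e0; have /filter_ex[N hN] := Rintegral_shrinking mS homS capS e0.
exists \1_(W N); first by have [] := fW N.
apply: le_trans hN; rewrite le_eqVlt; apply/orP; left; apply/eqP.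
apply: eq_Rintegral => y _; rewrite !indicE in_setD.
have : W N `<=` \bigcup_j A j by exact: bigsetU_bigcup.
case: (boolP (y \in W N)) => /= yW sub; last first.
  by rewrite subr0 andbT ger0_norm//; case: (_ \in _).
by rewrite andbF mem_set ?subrr ?normr0//; apply: sub; exact: set_mem.
Qed.

(** The boxes of depth [k] that meet a hyperplane lie in a slab around it. *)
Lemma flat_halfspace (i : 'I_n) (r : R) : flat_set [set y : V | y 0 i < r].
Proof.
set A := [set y | _].
have mA : measurable A.
  rewrite (_ : A = rV_coord i @^-1` [set` `]-oo, r[]); last first.
    by apply/seteqP; split => y; rewrite /A/= in_itv.
  by rewrite -[X in measurable X]setTI; apply: measurable_rV_coord => //; exact: measurable_itv.
split => //; split; first exact: integrable_indic_box.
pose S k := A `&` [set y : V | r - l0 / 2 ^+ k <= y 0 i].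
have mS k : measurable (S k).
  apply: measurableI => //; rewrite (_ : [set y | _] = rV_coord i @^-1` [set` `[r - l0 / 2 ^+ k, +oo[]).
    by rewrite -[X in measurable X]setTI; apply: measurable_rV_coord => //; exact: measurable_itv.
  by apply/seteqP; split => y; rewrite /= in_itv/= andbT.
have homS : {homo S : k j / (k <= j)%N >-> (j `<=` k)}.
  move=> k j kj; apply: setIS => y /=; apply: le_trans.
  rewrite lerB// ler_pM2l// lef_pV2 ?posrE ?exprn_gt0//.
  by rewrite ler_eXn2l// ltr1n.
have capS : \bigcap_k S k = set0.
  apply/seteqP; split => // y yS; have [yA _] := yS 0 I; rewrite /A/= in yA.
  have d0 : 0 < r - y 0 i by rewrite subr_gt0.
  have [_ /=] := yS (Num.Def.archi_bound (l0 / (r - y 0 i))) I.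
  set N := Num.Def.archi_bound _; apply/negP; rewrite -ltNge ltrBrDr -ltrBrDl.
  rewrite ltr_pdivrMr ?exprn_gt0// mulrC -ltr_pdivrMr//.
  exact: upper_nthrootP.
move=> e e0; have e2 : 0 < e / 2 by rewrite divr_gt0.
have := Rintegral_shrinking mS homS capS e2; apply: filterS => k hk.
have iS l a (lp : 0 < l) := integrable_indic_box a lp (mS k).
have -> : e = 2 * (e / 2) by field.
apply: (@le_trans _ _ (dyadic_sum (fun a l => 2 * \int[mu]_(y in box a l) \1_(S k) y) k a0 l0)).
  apply: dyadic_sum_le => // b sub; have lp := side_gt0 k; set l := l0 / _ in sub lp *.
  have mB := measurable_box b l; have fB := box_fin b lp.
  have ib := integrable_indic_box b lp mA.
  pose c : R := `[< box b l `<=` A >]%:R.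
  apply: (le_trans (box_dist_le c lp ib)); rewrite ler_pM2l//.
  apply: le_Rintegral => //; [exact: (integrable_norm (integrable_subr mB fB c ib))|exact: iS|].
  move=> y yb; rewrite /c; case: asboolP => [subA|].
    by rewrite !indicE (mem_set (subA _ yb)) subrr normr0.
  move=> /existsNP[z /not_implyP[zb zA]]; rewrite subr0 !indicE.
  case: (boolP (y \in A)) => yA; last by rewrite normr0.
  rewrite (_ : y \in S k) ?normr1//; apply/mem_set; split; first exact: set_mem.
  have /andP[h1 _] := yb i; have /andP[_ h2] := zb i.
  by move/negP: zA; rewrite /A/= -leNgt -/l => h3; lra.
rewrite dyadic_sumZ dyadic_sum_integral//; last exact: iS.
by rewrite ler_pM2l.
Qed.

(** The flat sets form a sigma-algebra that contains the half-spaces. *)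
Lemma measurable_flat A : measurable A -> flat_set A.
Proof.
have sig : sigma_algebra setT flat_set.
  split; first exact: flat_set0.
    by move=> B fB; rewrite setTD; exact: flat_setC.
  exact: flat_bigcup.
move=> mA; suff: g_sigma_preimage (@rV_coord R n) `<=` flat_set by exact.
apply: smallest_sub => //; rewrite -bigcup_seq => B [i _ [D mD <-]]; rewrite setTI.
pose G := [set D : set R | flat_set (rV_coord i @^-1` D)].
suff: (@ocitv R).-sigma.-measurable `<=` G by exact.
rewrite RGenInftyO.measurableE; apply: smallest_sub.
  split.
  - by rewrite /G/= preimage_set0; exact: flat_set0.
  - by move=> E; rewrite /G/= setTD preimage_setC; exact: flat_setC.
  - by move=> F hF; rewrite /G/= preimage_bigcup; exact: flat_bigcup.
move=> _ [r ->]; rewrite /G/= (_ : _ @^-1` _ = [set y : V | y 0 i < r]).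
  exact: flat_halfspace.
by apply/seteqP; split => y; rewrite /= in_itv.
Qed.

Import HBSimple.

(** The dyadic form of Lebesgue's differentiation theorem, in the mean. *)
Lemma integrable_dyadic_flat f : mu.-integrable Q (EFin \o f) -> flat f.
Proof.
move=> iff; apply: dyadic_flat_approx => // e e0.
have [g [ig _ /fine_cvgP[gfin]]] := approximation_sfun_integrable mQ iff.
move=> /cvgrPdist_le /(_ e e0) h.
have /filter_ex[N hN] := h; exists (g N); last first.
  by move: hN; rewrite /= sub0r normrN; apply: le_trans; rewrite ler_norm.
have -> : (g N : V -> R) = fun y =>
    \sum_(z <- finmap.enum_fset (fset_set (range (g N)))) z * \1_(g N @^-1` [set z]) y.
  by apply/funext => y; rewrite {1}fimfunE fsbig_finite.
elim: (finmap.enum_fset _) => [|z r ih].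
  by under eq_fun do rewrite big_nil; exact: (dyadic_flat_cst a0 l0_gt0 0).
under eq_fun do rewrite big_cons; apply: dyadic_flat_lin => //.
have [] // := @measurable_flat (g N @^-1` [set z]) _.
Qed.

End dyadic_density.

Section john_nirenberg_boxes.
Context (R : realType) (n : nat).
Local Notation V := 'rV[R]_n.
Local Notation mu := (@lebesgue_rV R n).
Implicit Types (a : V) (l : R) (f g : V -> R).
Local Notation m f a l := (mean f (box a l)).

Lemma truncated_square_le (u v c L : R) : 0 <= L ->
  Num.min `|u - c| L ^+ 2 <= 2 * L * `|u - v| + (v - c) ^+ 2.
Proof.
move=> L0; rewrite -(real_normK (num_real (v - c))).
have : `|u - c| <= `|u - v| + `|v - c| by rewrite -{1}(subrKA v) ler_normD.
have := normr_ge0 (u - c); have := normr_ge0 (u - v); have := normr_ge0 (v - c).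
move: `|u - c| `|u - v| `|v - c| => x w z z0 w0 x0 xwz.
have L2w : 0 <= 2 * L * w by rewrite !mulr_ge0.
suff H y : 0 <= y -> y <= x -> y <= L -> y ^+ 2 <= 2 * L * w + z ^+ 2.
  by case: (leP x L) => xL; apply: H => //; exact: ltW.
move=> y0 yx yL; have [yz|/ltW zy] := leP y z.
  by apply: ler_wpDl => //; rewrite lerXn2r ?nnegrE.
have : (y - z) * (y + z) <= w * (2 * L) by apply: ler_pM; lra.
have -> : (y - z) * (y + z) = y ^+ 2 - z ^+ 2 by ring.
by lra.
Qed.

(** Cutting [f - c] off at the level [L] makes the approximation by dyadic means
    applicable to its square; then [L] tends to infinity. *)
Lemma john_nirenberg f a0 l0 (b : R) : 0 < l0 -> 0 <= b ->
  mu.-integrable (box a0 l0) (EFin \o f) ->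
  (forall a l, 0 < l -> box a l `<=` box a0 l0 ->
    \int[mu]_(y in box a l) `|f y - m f a l| <= b * l ^+ n) ->
  (\int[mu]_(y in box a0 l0) ((f y - m f a0 l0) ^+ 2)%:E <=
    ((2 + 2 ^+ n) ^+ 2 * b ^+ 2 * l0 ^+ n)%:E)%E.
Proof.
move=> lp b0 iff bmo; set c := m f a0 l0; set al := (2 + 2 ^+ n) ^+ 2.
have al0 : 0 <= al by exact: sqr_ge0.
have mQ : measurable (box a0 l0) by exact: measurable_box.
have Qfin : mu (box a0 l0) \is a fin_num by exact: box_fin.
have mf : measurable_fun (box a0 l0) f by apply/measurable_EFinP; exact: (measurable_int _ iff).
pose t (L : R) (y : V) : R := Num.min `|f y - c| L ^+ 2.
have t0 L y : 0 <= t L y by exact: sqr_ge0.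
have mt L : measurable_fun (box a0 l0) (t L).
  apply: measurable_funX; apply: measurable_minr; last exact: measurable_cst.
  by apply: measurableT_comp => //; exact: measurable_funB.
have it L : 0 <= L -> mu.-integrable (box a0 l0) (EFin \o t L).
  move=> L0; apply: le_integrable (integrable_cst mQ Qfin (L ^+ 2)) => //.
    exact/measurable_EFinP.
  move=> y _; rewrite /= lee_fin !ger0_norm ?sqr_ge0// lerXn2r ?nnegrE ?ge_min ?lexx ?orbT//.
  by rewrite le_min normr_ge0.
have [_ flat] := integrable_dyadic_flat lp iff.
have tle L : 0 <= L -> \int[mu]_(y in box a0 l0) t L y <= al * b ^+ 2 * l0 ^+ n.
  move=> L0; apply/ler_addgt0Pr => e e0.
  have L21 : 0 < 2 * L + 1 by lra.
  have /filter_ex[k hk] := flat _ (divr_gt0 e0 L21).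
  rewrite -(dyadic_sum_integral k lp (it L L0)).
  apply: (@le_trans _ _ (dyadic_sum (fun a l => 2 * L * box_dist f a l + box_variance f c a l) k a0 l0)).
    apply: dyadic_sum_le => // a sub; set l := l0 / _ in sub *.
    have lp' : 0 < l by rewrite divr_gt0// exprn_gt0.
    have mB := measurable_box a l; have fB := box_fin a lp'.
    have iS g : mu.-integrable (box a0 l0) (EFin \o g) -> mu.-integrable (box a l) (EFin \o g).
      by move=> ig; apply: integrableS ig.
    have i1 := integrable_norm (integrable_subr mB fB (m f a l) (iS f iff)).
    have i2 := integrable_cst mB fB ((m f a l - c) ^+ 2).
    have i3 := integrableZl mB (2 * L) i1.
    apply: (@le_trans _ _ (\int[mu]_(y in box a l)
        (2 * L * `|f y - m f a l| + (m f a l - c) ^+ 2))).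
      apply: le_Rintegral => //; first exact: iS (it L L0).
        by apply: eq_integrable (integrableD mB i3 i2).
      by move=> y _; exact: truncated_square_le.
    rewrite RintegralD// RintegralZl// Rintegral_cst// box_volume//.
    by rewrite /box_variance /box_dist [in leRHS](mulrC (l ^+ n)).
  rewrite dyadic_sum_lin addrC; apply: lerD.
    apply: le_trans (dyadic_variance iff b0 bmo k lp _ _) _ => //.
      by rewrite subrr normr0 mulr_ge0.
    rewrite expr2 !mulrA -!mulrA ler_wpM2l// ler_wpM2l//.
    by rewrite ler_wpM2l//; exact: bmo.
  apply: (@le_trans _ _ (2 * L * (e / (2 * L + 1)))); first by rewrite ler_wpM2l// mulr_ge0.
  have -> : 2 * L * (e / (2 * L + 1)) = e - e / (2 * L + 1) by field; rewrite gt_eqF.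
  by rewrite gerBl ltW// divr_gt0.
have mono : {homo (fun N : nat => t N%:R) : i j / (i <= j)%N >-> forall y, i y <= j y}.
  move=> i j ij y; rewrite lerXn2r ?nnegrE ?le_min ?normr_ge0 ?ler0n//.
  by rewrite ge_min lexx/= ge_min ler_nat ij orbT.
have cvgt y : (t N%:R y)%:E @[N --> \oo] --> ((f y - c) ^+ 2)%:E.
  apply: cvg_EFin; first exact: nearW.
  apply: cvg_near_cst; near=> N.
  have yN : `|f y - c| <= N%:R.
    apply: (@le_trans _ _ (Num.truncn `|f y - c|).+1%:R).
      by rewrite ltW// truncnS_gt.
    by rewrite ler_nat; near: N; exact: nbhs_infty_ge.
  by rewrite /= /t min_l// real_normK ?num_real.
have mg N : measurable_fun (box a0 l0) (fun y => (t N%:R y)%:E) by exact/measurable_EFinP.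
have g0 N y : box a0 l0 y -> (0 <= (t N%:R y)%:E)%E by rewrite lee_fin.
have nd y : box a0 l0 y -> {homo (fun N => (t N%:R y)%:E) : i j / (i <= j)%N >-> (i <= j)%E}.
  by move=> _ i j ij; rewrite lee_fin; exact: mono.
have cv := @cvg_monotone_convergence _ _ _ mu _ mQ _ mg g0 nd.
have -> : (\int[mu]_(y in box a0 l0) ((f y - c) ^+ 2)%:E =
    \int[mu]_(y in box a0 l0) limn (fun N => (t N%:R y)%:E))%E.
  by apply: eq_integral => y _; rewrite (cvg_lim _ (cvgt y)).
rewrite -(cvg_lim _ cv)//; apply: lime_le; first by apply/cvg_ex; eexists; exact: cv.
apply: nearW => N; have := tle N%:R (ler0n _ _).
rewrite -lee_fin; apply: le_trans; rewrite /Rintegral fineK//.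
exact: integrable_fin_num (it _ _).
Unshelve. all: by end_near. Qed.

End john_nirenberg_boxes.

Section campanato_exponents.
Context (R : realType) (n : nat) (s : cell_shape).
Local Notation V := 'rV[R]_n.
Local Notation mu := (@lebesgue_rV R n).
Local Notation d := (Num.sqrt n%:R : R).
Hypothesis n0 : (0 < n)%N.
Implicit Types (f g : V -> R).

Lemma oscillation1_le q f (x : V) t : 1 <= q -> 0 < t ->
  mu.-integrable (cell s x t) (EFin \o f) ->
  (oscillation 1 f (cell s x t) <= oscillation q f (cell s x t))%E.
Proof.
move=> q1 t0 iff; have mU := measurable_cell s x t.
have Ufin := volume_cell_fin s x t0; have v0 := volume_gt0 n0 s x t0.
have q0 : 0 < q by apply: lt_le_trans q1.
rewrite !oscillationE// -/(volume s x t) invr1.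
have mf : measurable_fun (cell s x t) (fun y => f y - mean f (cell s x t)).
  apply: measurable_funB => //; apply/measurable_EFinP; exact: (measurable_int _ iff).
have := Lq1_le mu q1 mU mf; rewrite volumeE// poweR_EFin => h.
apply: (@le_trans _ _ ((volume s x t `^ (- (1)))%:E *
    (Lq mu q (cell s x t) (fun y => (f y - mean f (cell s x t))%R) * (volume s x t `^ (1 - q^-1))%:E))%E).
  by rewrite lee_wpmul2l// lee_fin powR_ge0.
rewrite muleCA muleA -[X in (X <= _)%E]muleA -EFinM -powRD; last by rewrite (gt_eqF v0) implybT.
by rewrite addKr muleC.
Qed.

Lemma campanato_norm1_le q lambda (U : set V) f : 1 <= q ->
  (forall x t, 0 < t -> cell s x t `<=` U -> mu.-integrable (cell s x t) (EFin \o f)) ->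
  (campanato_norm s 1 lambda U f <= campanato_norm s q lambda U f)%E.
Proof.
move=> q1 iff; apply: ge_ereal_sup => _ [x [t [t0 sub ->]]].
apply: (@le_trans _ _ ((t `^ (- lambda))%:E * oscillation q f (cell s x t))%E).
  by rewrite lee_wpmul2l ?lee_fin ?powR_ge0// oscillation1_le//; exact: iff.
by apply: ereal_sup_ubound; exists x, t.
Qed.

Lemma sub_box_side (a a0 : V) (l l0 : R) : 0 < l0 -> 0 < l ->
  box a l `<=` box a0 l0 -> l <= l0.
Proof.
move=> l00 lp sub; rewrite leNgt; apply/negP => ll0.
pose i := Ordinal n0.
have aa : box a l a by move=> j; rewrite lexx ltrDl.
have /(_ i)/andP[h1 _] := sub _ aa.
have ba : box a l (\row_j (a 0 j + l0)).
  by move=> j; rewrite mxE lerDl (ltW l00) ltrD2l.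
by have /(_ i)/andP[_] := sub _ ba; rewrite mxE ltrD2r ltNge h1.
Qed.

Lemma box_sub_cell (a : V) l : 0 < l ->
  box a l `<=` cell s (\row_i (a 0 i + l / 2)) (d * l).
Proof.
move=> lp y yl; rewrite cellE/=; have d0 := sqrtn_gt0 R n0.
apply: (le_lt_trans (snorm_le_enorm _ _)); apply: (le_lt_trans (enorm_le_norm _)).
rewrite ltr_pM2l//; apply: (@le_lt_trans _ _ (l / 2)); last by lra.
apply: norm_le => [|i]; first by rewrite divr_ge0// ltW.
by have /andP[h1 h2] := yl i; rewrite !mxE ler_norml; apply/andP; split; lra.
Qed.

(** As [lambda >= 0], the bound on the mean oscillation over a small box inside
    a cell is not worse than that over the cell, so that the John-Nirenberg
    inequality applies to the box that encloses the cell. *)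
Lemma campanato_norm2_le lambda : 0 <= lambda ->
  exists A m, 0 <= A /\ forall f r M, 0 < r -> 0 <= M ->
    (forall r, 0 < r -> mu.-integrable (cell s 0 r) (EFin \o f)) ->
    (campanato_norm s 1 lambda (cell s 0 (2 ^+ m * r)) f <= M%:E)%E ->
    (campanato_norm s 2 lambda (cell s 0 r) f <= (A * M)%:E)%E.
Proof.
move=> la0; have d1 := sqrtn_ge1 R n0; have d0 := sqrtn_gt0 R n0.
pose m := Num.Def.archi_bound (4 * d).
have hm : 4 * d <= 2 ^+ m by rewrite ltW//; exact: upper_nthrootP.
pose al : R := (2 + 2 ^+ n) ^+ 2.
have al0 : 0 <= al by exact: sqr_ge0.
pose D : R := 2 * ((2 * d) ^+ n * (2 * d) `^ lambda).
have D0 : 0 <= D by rewrite mulr_ge0// mulr_ge0 ?powR_ge0// exprn_ge0// mulr_ge0// ltW.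
pose E : R := (al * d ^+ n) `^ 2^-1.
have E0 : 0 <= E by exact: powR_ge0.
exists (2 * E * D), m; split; first by rewrite mulr_ge0// mulr_ge0.
move=> f r M r0 M0 iff hM.
apply: ge_ereal_sup => _ [x [t [t0 sub ->]]].
have xtr := cell_sub_origin n0 t0 sub.
pose a0 : V := \row_i (x 0 i - t); pose l0 := 2 * t.
have l00 : 0 < l0 by rewrite mulr_gt0.
have sub0 : cell s x t `<=` box a0 l0.
  move=> y /cell_sub_cube; rewrite cellE/= => yt i.
  have := le_lt_trans (coord_le_norm (y - x) i) yt.
  by rewrite !mxE ltr_norml /l0 => /andP[h1 h2]; apply/andP; split; lra.
pose b := D * (t `^ lambda * M).
have b0 : 0 <= b by rewrite mulr_ge0// mulr_ge0 ?powR_ge0.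
have ibox a l : 0 < l -> mu.-integrable (box a l) (EFin \o f).
  move=> lp; have dl : 0 < d * l by rewrite mulr_gt0.
  have := integrable_cells (\row_i (a 0 i + l / 2)) iff dl.
  by apply: integrableS => //; [exact: measurable_box|exact: box_sub_cell].
have bmo a l : 0 < l -> box a l `<=` box a0 l0 ->
    \int[mu]_(y in box a l) `|f y - mean f (box a l)| <= b * l ^+ n.
  move=> lp subl; have ll0 := sub_box_side l00 lp subl.
  have dl : 0 < d * l by rewrite mulr_gt0.
  pose z : V := \row_i (a 0 i + l / 2).
  have zx : snorm s (z - x) <= d * (2 * t).
    apply: (le_trans (snorm_le_enorm _ _)); apply: (le_trans (enorm_le_norm _)).
    rewrite ler_pM2l//; apply: norm_le => [|i]; first by rewrite mulr_ge0// ltW.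
    have aa : box a l a by move=> j; rewrite lexx ltrDl.
    have /andP[h1 h2] := subl _ aa i; move: h1 h2 ll0; rewrite !mxE /l0 => h1 h2 ll0.
    by rewrite ler_norml; apply/andP; split; lra.
  have ztr : snorm s z + d * l <= 2 ^+ m * r.
    have h1 : snorm s z <= snorm s x + snorm s (z - x).
      by rewrite -{1}(subrKC x z) snormD.
    have h2 : d * l <= d * (2 * t) by rewrite ler_pM2l.
    apply: (@le_trans _ _ (2 ^+ m * (snorm s x + t))); last by rewrite ler_pM2l// exprn_gt0.
    have h3 : snorm s x <= 2 ^+ m * snorm s x.
      by rewrite ler_peMl ?snorm_ge0// exprn_ege1// ler1n.
    have h4 : 4 * d * t <= 2 ^+ m * t by rewrite ler_pM2r.
    by rewrite mulrDr; lra.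
  have icell := integrable_cells z iff dl.
  have subz : cell s z (d * l) `<=` cell s 0 (2 ^+ m * r) by exact: sub_cell_origin.
  have osc := campanato_norm_cell dl subz hM.
  have := Rintegral_oscillation n0 (lexx 1) dl icell osc.
  set c := mean f (cell s z (d * l)) => hc.
  apply: (le_trans (box_dist_le c lp (ibox a l lp))).
  have i1 : mu.-integrable (cell s z (d * l)) (EFin \o (fun y => `|f y - c|)).
    by apply: integrable_norm; apply: integrable_subr => //; exact: volume_cell_fin.
  have hb : \int[mu]_(y in box a l) `|f y - c| <= \int[mu]_(y in cell s z (d * l)) `|f y - c|.
    rewrite /Rintegral fine_le//.
    - apply: integrable_fin_num; first exact: measurable_box.
      by apply: integrableS i1 => //; [exact: measurable_box|exact: box_sub_cell].
    - exact: integrable_fin_num i1.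
    - apply: ge0_subset_integral => //; first exact: measurable_box.
        exact: (measurable_int _ i1).
      exact: box_sub_cell.
  rewrite /b /D -!mulrA ler_pM2l//; apply: (le_trans hb); apply: (le_trans hc).
  apply: (@le_trans _ _ (((d * (2 * t)) `^ lambda * M) * (2 * (d * l)) ^+ n)).
    apply: ler_pM; rewrite ?mulr_ge0 ?powR_ge0//.
    - by rewrite ltW// volume_gt0.
    - by rewrite ler_wpM2r// ge0_ler_powR ?nnegrE ?mulr_ge0 ?(ltW d0) ?(ltW lp) ?(ltW t0)// ler_pM2l.
    - exact: volume_le.
  rewrite le_eqVlt; apply/orP; left; apply/eqP.
  rewrite (_ : d * (2 * t) = (2 * d) * t); last by ring.
  rewrite powRM ?mulr_ge0 ?(ltW d0) ?(ltW t0)// mulrA exprMn.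
  by ring.
have := john_nirenberg l00 b0 (ibox a0 l0 l00) bmo.
set c := mean f (box a0 l0); rewrite -/al => jn.
have mU := measurable_cell s x t; have v0 := volume_gt0 n0 s x t0.
have iU := integrable_cells x iff t0.
have mf : measurable_fun (box a0 l0) f by apply/measurable_EFinP; exact: (measurable_int _ (ibox a0 l0 l00)).
have hL : (Lq mu 2 (cell s x t) (fun y => (f y - c)%R) <= (E * b * volume s x t `^ 2^-1)%:E)%E.
  rewrite LqE//.
  have -> : (\int[mu]_(y in cell s x t) (`|f y - c| `^ 2)%:E =
      \int[mu]_(y in cell s x t) ((f y - c) ^+ 2)%:E)%E.
    by apply: eq_integral => y _; rewrite powR_mulrn// real_normK// num_real.
  have h : (\int[mu]_(y in cell s x t) ((f y - c) ^+ 2)%:E <=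
      (al * d ^+ n * b ^+ 2 * volume s x t)%:E)%E.
    apply: le_trans (_ : (_ <= \int[mu]_(y in box a0 l0) ((f y - c) ^+ 2)%:E)%E) _.
      apply: ge0_subset_integral => //; first exact: measurable_box.
        by apply/measurable_EFinP; apply: measurable_funX; exact: measurable_funB.
      by move=> y _; rewrite lee_fin sqr_ge0.
    apply: (le_trans jn); rewrite lee_fin.
    have hv : l0 ^+ n <= d ^+ n * volume s x t.
      apply: (@le_trans _ _ (d ^+ n * (2 * (t / d)) ^+ n)).
        rewrite -exprMn le_eqVlt; apply/orP; left; apply/eqP; congr (_ ^+ _).
        by rewrite /l0; field; rewrite gt_eqF.
      by rewrite ler_pM2l ?exprn_gt0// volume_ge.
    apply: le_trans (ler_wpM2l _ hv) _; first by rewrite mulr_ge0 ?sqr_ge0.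
    by rewrite le_eqVlt; apply/orP; left; apply/eqP; ring.
  apply: (@le_trans _ _ ((al * d ^+ n * b ^+ 2 * volume s x t)%:E `^ 2^-1)%E).
    rewrite le_poweR ?invr_ge0//.
    by apply: integral_ge0 => y _; rewrite lee_fin sqr_ge0.
  have dn0 : 0 <= al * d ^+ n by rewrite mulr_ge0// exprn_ge0// ltW.
  rewrite poweR_EFin lee_fin (powRM _ (mulr_ge0 dn0 (sqr_ge0 b)) (ltW v0)).
  rewrite (powRM _ dn0 (sqr_ge0 b)) -(powR_mulrn 2 b0) -powRrM mulfV//.
  by rewrite (powRr1 b0).
have hosc := oscillation_le mU (volume_cell_fin s x t0) v0 c (ler1n R 2) iU.
apply: (@le_trans _ _ ((t `^ (- lambda))%:E * ((2 * volume s x t `^ (- 2^-1))%:E *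
   (E * b * volume s x t `^ 2^-1)%:E))%E).
  rewrite lee_wpmul2l ?lee_fin ?powR_ge0//; apply: (le_trans hosc).
  by rewrite lee_wpmul2l// lee_fin mulr_ge0 ?powR_ge0.
rewrite -!EFinM lee_fin /b !powRN le_eqVlt; apply/orP; left; apply/eqP.
by field; rewrite !gt_eqF// powR_gt0.
Qed.

End campanato_exponents.

(** * Weighted norms of monotone functions *)

Section lower_integral.
Local Open Scope ereal_scope.
Context d (T : measurableType d) (R : realType) (mu : {measure set T -> \bar R}).
Implicit Types (D : set T) (f h : T -> \bar R).
Import HBNNSimple.

(** The integral of a nonnegative function is the supremum over the simple
    functions below it, even when the function is not measurable. *)
Lemma integral_le_lower D h (B : \bar R) : measurable D -> (forall x, D x -> 0 <= h x) ->
  (forall f, measurable_fun setT f -> (forall x, 0 <= f x) ->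
    (forall x, D x -> f x <= h x) -> \int[mu]_(x in D) f x <= B) ->
  \int[mu]_(x in D) h x <= B.
Proof.
move=> mD h0 H; rewrite ge0_integralE//; apply: ge_ereal_sup => _ [f /= fh <-].
have fD : (f : T -> R) = f \_ D.
  apply/funext => x; rewrite patchE; case: ifPn => // xD.
  have := fh x; rewrite patchE (negbTE xD) lee_fin => f0.
  by apply/eqP; rewrite eq_le f0/=; exact: fun_ge0.
rewrite (_ : sintegral mu f = \int[mu]_(x in D) (f x)%:E).
  apply: H.
  - by apply/measurable_EFinP; exact: measurable_funP.
  - by move=> x; rewrite lee_fin; exact: fun_ge0.
  - by move=> x Dx; have := fh x; rewrite patchE mem_set.
by rewrite integral_nnsfun// -fD.
Qed.

Lemma ge0_le_lower_integral D f h : (forall x, D x -> 0 <= f x) ->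
  (forall x, D x -> f x <= h x) -> \int[mu]_(x in D) f x <= \int[mu]_(x in D) h x.
Proof.
move=> f0 fh; have h0 x : D x -> 0 <= h x by move=> Dx; apply: le_trans (f0 _ Dx) (fh _ Dx).
rewrite !ge0_integralE//; apply: ereal_sup_le => _ [g /= gf <-]; exists g => //= x.
apply: (le_trans (gf x)); rewrite !patchE; case: ifPn => // /set_mem; exact: fh.
Qed.

End lower_integral.

Section geometric_sup.
Context (R : realType).

(** The function [q k = sup_j theta ^+ j * p (k + j)] satisfies
    [q k <= p k + theta * q k.+1]; after summation the last term is absorbed. *)
Lemma geometric_sup_sum (theta J : R) (p : nat -> R) : 0 < theta -> theta < 1 ->
  (forall k, 0 <= p k) -> (forall K, \sum_(k < K) p k <= J) ->
  exists q : nat -> R, (forall k j, theta ^+ j * p (k + j)%N <= q k) /\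
    forall K, \sum_(k < K) q k <= 2 * J / (1 - theta).
Proof.
move=> th0 th1 p0 hJ; pose E k := [set theta ^+ j * p (k + j)%N | j in [set: nat]].
have pJ k : p k <= J.
  apply: le_trans (hJ k.+1); rewrite big_ord_recr/= lerDr; exact: sumr_ge0.
have ub k : ubound (E k) J.
  move=> _ [j _ <-]; apply: le_trans (pJ (k + j)%N).
  by rewrite ler_piMl// exprn_ile1// ltW.
have hs k : has_sup (E k).
  by split; [exists (theta ^+ 0 * p (k + 0)%N), 0%N|exists J; exact: ub].
have Eq k j : theta ^+ j * p (k + j)%N <= sup (E k).
  by apply: ub_le_sup; [exists J; exact: ub|exists j].
exists (fun k => sup (E k)); split => //.
have rec k : sup (E k) <= p k + theta * sup (E k.+1).
  have q0 : 0 <= sup (E k.+1).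
    by apply: le_trans (Eq k.+1 0); rewrite expr0 mul1r.
  apply: ge_sup; first by case: (hs k).
  move=> _ [[|j] _ <-]; first by rewrite expr0 mul1r addn0 lerDl mulr_ge0// ltW.
  rewrite exprS -mulrA addnS -addSn; apply: ler_wpDl => //.
  by rewrite ler_pM2l.
move=> K; rewrite ler_pdivlMr ?subr_gt0//.
have qJ : sup (E K) <= J by apply: ge_sup; [case: (hs K)|exact: ub].
have : \sum_(k < K) sup (E k) <= J + theta * (\sum_(k < K) sup (E k) + J).
  apply: (@le_trans _ _ (\sum_(k < K) (p k + theta * sup (E k.+1)))).
    by apply: ler_sum => k _; exact: rec.
  rewrite big_split/= -mulr_sumr; apply: lerD; [exact: hJ|rewrite ler_pM2l//].
  have -> : \sum_(i < K) sup (E i.+1) = \sum_(i < K) sup (E i) + sup (E K) - sup (E 0).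
    have := erefl (\sum_(i < K.+1) sup (E i)).
    rewrite {1}big_ord_recl big_ord_recr/= => <-; rewrite addrC addKr.
    by apply: eq_bigr.
  have q0 : 0 <= sup (E 0) by apply: le_trans (Eq 0 0); rewrite expr0 mul1r.
  by lra.
have J0 : 0 <= J by apply: le_trans (pJ 0).
set S := \sum_(_ < _) _ => h; have : theta * J <= J by rewrite ler_piMl// ltW.
by lra.
Qed.

End geometric_sup.

Section weights.
Context (R : realType).
Local Notation leb := (@lebesgue_measure R).
Variables (w : R -> R) (C sigma : R).
Hypotheses (w0 : forall r, 0 < r -> 0 < w r) (C0 : 0 < C) (sigma0 : 0 < sigma).
Hypothesis hw : forall r t, 0 < r -> 1 <= t -> w r <= C * t `^ sigma * w (t * r).
Implicit Types (N : R -> R) (I : set R).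

Local Notation D := (C * 2 `^ sigma).

Let D0 : 0 < D. Proof. by rewrite mulr_gt0// powR_gt0. Qed.

Lemma weight_doubling rho r : 0 < rho -> rho <= r <= 2 * rho ->
  w rho <= D * w r /\ w r <= D * w (2 * rho).
Proof.
move=> rho0 /andP[h1 h2]; have r0 : 0 < r by exact: lt_le_trans h1.
have H x y : 0 < x -> x <= y -> y <= 2 * x -> w x <= D * w y.
  move=> x0 xy y2x; have y0 : 0 < y by exact: lt_le_trans xy.
  have t1 : 1 <= y / x by rewrite ler_pdivlMr// mul1r.
  have := hw x0 t1; rewrite divfK ?gt_eqF// => /le_trans; apply.
  rewrite ler_pM2r ?w0// ler_pM2l// ge0_ler_powR ?nnegrE ?(ltW sigma0)//.
    by rewrite divr_ge0// ltW.
  by rewrite ler_pdivrMr.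
by split; apply: H => //; rewrite ler_pM2l.
Qed.

(** A common form of the two domains of integration: the increasing union is
    a closed half-line when the sequence is constant, an open one when it tends
    to the endpoint. *)
Definition right_ray I := exists a : nat -> R, [/\ forall M, 0 < a M,
  {homo a : i j / (i <= j)%N >-> j <= i} & I = \bigcup_M [set` `[a M, +oo[]].

Lemma right_ray_closed (a : R) : 0 < a -> right_ray [set` `[a, +oo[].
Proof.
move=> a0; exists (fun=> a); split => //; apply/seteqP; split => [r ra|r [_ _]//].
by exists 0%N.
Qed.

Lemma right_ray_open : right_ray [set` `]0, +oo[].
Proof.
exists (fun M => 2 ^- M); split.
- by move=> M; rewrite invr_gt0 exprn_gt0.
- by move=> i j ij; rewrite lef_pV2 ?posrE ?exprn_gt0// ler_eXn2l// ltr1n.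
apply/seteqP; split => r /=; rewrite in_itv/= andbT.
  move=> r0; exists (Num.Def.archi_bound r^-1) => //=; rewrite in_itv/= andbT.
  rewrite -[leRHS]invrK lef_pV2 ?posrE ?exprn_gt0 ?invr_gt0//.
  by rewrite ltW//; exact: upper_nthrootP.
move=> [M _] /=; rewrite in_itv/= andbT; apply: lt_le_trans.
by rewrite invr_gt0 exprn_gt0.
Qed.

Lemma right_ray_gt0 I r : right_ray I -> I r -> 0 < r.
Proof.
move=> [a [a0 _ ->]] [M _] /=; rewrite in_itv/= andbT; exact: lt_le_trans.
Qed.

Lemma right_ray_sub I r : right_ray I -> I r -> [set` `[r, +oo[] `<=` I.
Proof.
move=> [a [a0 _ ->]] [M _] /=; rewrite in_itv/= andbT => ar t /=; rewrite in_itv/= andbT => rt.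
by exists M => //=; rewrite in_itv/= andbT (le_trans ar).
Qed.

Lemma measurable_right_ray I : right_ray I -> measurable I.
Proof. by move=> [a [_ _ ->]]; apply: bigcupT_measurable => M; exact: measurable_itv. Qed.

Definition Lv_integral I v (F : R -> R) : \bar R :=
  (\int[leb]_(r in I) (F r `^ v * r^-1)%:E)%E.

Local Notation P N r := (w r * N r).

Let grid (a : R) k : set R := [set` `[2 ^+ k * a, 2 ^+ k.+1 * a[].

Let gridE a k r : grid a k r = (2 ^+ k * a <= r < 2 ^+ k.+1 * a).
Proof. by rewrite /grid/= in_itv. Qed.

Let grid_length a k : 0 < a -> leb (grid a k) = (2 ^+ k * a)%:E.
Proof.
move=> a0; rewrite lebesgue_measure_itv/= lte_fin ltr_pM2r// ltr_eXn2l ?ltr1n// ltnSn.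
by rewrite -EFinB exprS; congr EFin; ring.
Qed.

Let grid_disj a : 0 < a -> trivIset setT (grid a).
Proof.
move=> a0; apply/trivIsetP => i j _ _.
wlog ij : i j / (i < j)%N.
  move=> wl; rewrite neq_ltn => /orP[] ij; first by apply: wl => //; rewrite ltn_eqF.
  by rewrite setIC; apply: wl => //; rewrite ltn_eqF.
move=> _; apply/seteqP; split => // z [zi zj]; move: zi zj.
rewrite !gridE => /andP[_ h1] /andP[h2 _].
by have := le_lt_trans h2 h1; rewrite ltr_pM2r// ltNge ler_eXn2l ?ltr1n// ij.
Qed.

Let grid_cover a : 0 < a -> [set` `[a, +oo[] = \bigcup_k grid a k.
Proof.
move=> a0; apply/seteqP; split => r /=; rewrite in_itv/= andbT; last first.
  move=> [k _]; rewrite gridE => /andP[+ _]; apply: le_trans.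
  by rewrite ler_peMl ?(ltW a0)// exprn_ege1// ler1n.
move=> ar; have : exists k, r < 2 ^+ k * a.
  exists (Num.Def.archi_bound (r / a)); rewrite -ltr_pdivrMr//; exact: upper_nthrootP.
move=> /ex_minnP[[|k]]; first by rewrite expr0 mul1r ltNge ar.
move=> hk hmin; exists k => //; rewrite gridE hk andbT leNgt.
by apply/negP => /hmin; rewrite ltnn.
Qed.

Let measurable_grid a k : measurable (grid a k).
Proof. exact: measurable_itv. Qed.

Definition monotone N := (forall r, 0 < r -> 0 <= N r) /\
  forall r r', 0 < r -> r <= r' -> N r <= N r'.

(** A step function on the grid lies below the integrand. *)
Lemma grid_lower I (a v : R) N K : 0 < v -> 0 < a -> [set` `[a, +oo[] `<=` I ->
  measurable I -> (forall r, I r -> 0 < r) -> monotone N ->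
  ((\sum_(k < K) P N (2 ^+ k * a) `^ v)%:E <= (2 * D `^ v)%:E * Lv_integral I v (fun r => P N r))%E.
Proof.
move=> v0 a0 aI mI I0 [N0 mN].
have ka k : 0 < 2 ^+ k * a by rewrite mulr_gt0// exprn_gt0.
have P0 r : 0 < r -> 0 <= P N r by move=> r0; rewrite mulr_ge0 ?N0// ltW// w0.
pose b k := (P N (2 ^+ k * a) / D) `^ v * (2 ^+ k.+1 * a)^-1.
have b0 k : 0 <= b k by rewrite mulr_ge0 ?powR_ge0// invr_ge0 ltW.
have gI k : grid a k `<=` I.
  by apply: subset_trans aI; rewrite (grid_cover a0); exact: bigcup_sup.
have bound k r : grid a k r -> b k <= P N r `^ v * r^-1.
  move=> gr; have r0 := I0 _ (gI _ _ gr).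
  move: gr; rewrite gridE => /andP[h1 h2].
  have [|h3 _] := weight_doubling (ka k) (r := r).
    by rewrite h1 mulrA -exprS ltW.
  have h4 := mN _ _ (ka k) h1.
  apply: ler_pM; rewrite ?powR_ge0 ?invr_ge0 ?(ltW (ka _))//.
    rewrite ge0_ler_powR ?nnegrE ?(ltW v0) ?divr_ge0 ?P0 ?(ltW D0)//.
    rewrite ler_pdivrMr// mulrAC [w r * D]mulrC; apply: ler_pM => //; first exact/ltW/w0.
    exact: N0.
  by rewrite lef_pV2 ?posrE// ltW.
pose phi r : \bar R := (\sum_(k < K) (b k * \1_(grid a k) r))%:E.
have mphi k : measurable_fun I (fun r => (b k * \1_(grid a k) r)%:E).
  by apply/measurable_EFinP; apply: measurable_funM => //; exact: measurable_indic.
have mi k : measurable_fun I (fun r => (\1_(grid a k) r : R)%:E).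
  by apply/measurable_EFinP; exact: measurable_indic.
have phi_le r : I r -> (phi r <= (P N r `^ v * r^-1)%:E)%E.
  move=> Ir; have r0 := I0 _ Ir; rewrite lee_fin.
  have [[k gk]|none] := pselect (exists k : 'I_K, grid a k r).
    rewrite (bigD1 k)//= big1 ?addr0.
      by rewrite indicE mem_set// mulr1; exact: bound.
    move=> j jk; rewrite indicE memNset ?mulr0// => gj.
    have /trivIsetP/(_ j k Logic.I Logic.I) := grid_disj a0.
    move=> /(_ jk) /seteqP[/(_ r)+ _]; exact.
  rewrite big1 ?mulr_ge0 ?powR_ge0 ?invr_ge0 ?(ltW r0)// => k _.
  by rewrite indicE memNset ?mulr0// => gk; apply: none; exists k.
have phi0 r : (0 <= phi r)%E.
  by rewrite lee_fin sumr_ge0// => k _; rewrite mulr_ge0.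
have := ge0_le_lower_integral leb (fun r _ => phi0 r) phi_le.
rewrite /phi; under eq_integral do rewrite -sumEFin.
rewrite ge0_integral_sum; [|exact: mI|by move=> k; exact: mphi|]; last first.
  by move=> k r _; rewrite lee_fin mulr_ge0.
rewrite (eq_bigr (fun k : 'I_K => (P N (2 ^+ k * a) `^ v / (2 * D `^ v))%:E)); last first.
  move=> k _; under eq_integral do rewrite EFinM.
  rewrite ge0_integralZl//; last 2 first.
    exact: mi.
    by rewrite lee_fin.
  have -> : (\int[leb]_(r in I) (\1_(grid a k) r)%:E = (2 ^+ k * a)%:E)%E.
    rewrite (integral_indic leb mI (measurable_grid a k)) -(grid_length k a0).
    by congr (leb _); apply/seteqP; split=> [r []//|r gr]; split => //; exact: gI gr.
  rewrite -EFinM; congr EFin.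
  rewrite /b exprS powRM ?P0 ?invr_ge0 ?(ltW D0) ?(ltW (ka _))//.
  rewrite -[D^-1]powR_inv1 ?(ltW D0)// -powRrM mulN1r powRN.
  by field; rewrite !gt_eqF ?powR_gt0 ?exprn_gt0.
have Dv0 : 0 < 2 * D `^ v by rewrite mulr_gt0// powR_gt0.
rewrite sumEFin -mulr_suml => /(lee_wpmul2l (_ : (0 <= (2 * D `^ v)%:E)%E)).
rewrite lee_fin => /(_ (ltW Dv0)); apply: le_trans.
by rewrite -EFinM lee_fin mulrC divfK// gt_eqF.
Qed.

(** A step function on the grid lies above the integrand. *)
Lemma grid_upper (a v Bd : R) N : 0 < v -> 0 < a -> monotone N ->
  (forall K, \sum_(k < K) P N (2 ^+ k.+1 * a) `^ v <= Bd) ->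
  (Lv_integral [set` `[a, +oo[] v (fun r => P N r) <= (D `^ v * Bd)%:E)%E.
Proof.
move=> v0 a0 [N0 mN] hB.
have ka k : 0 < 2 ^+ k * a by rewrite mulr_gt0// exprn_gt0.
have P0 r : 0 < r -> 0 <= P N r by move=> r0; rewrite mulr_ge0 ?N0// ltW// w0.
apply: integral_le_lower => //.
  move=> r /=; rewrite in_itv/= andbT => ar.
  by rewrite lee_fin mulr_ge0 ?powR_ge0// invr_ge0 (le_trans (ltW a0)).
move=> f mf f0 fh; rewrite grid_cover// ge0_integral_bigcup//; first last.
- exact: grid_disj.
- exact: measurable_funTS.
- exact: measurable_grid.
apply: lime_le; first by apply: is_cvg_nneseries => k _ _; apply: integral_ge0.
apply: nearW => K; rewrite big_mkord.
apply: (@le_trans _ _ (\sum_(k < K) (D `^ v * P N (2 ^+ k.+1 * a) `^ v)%:E)%E); last first.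
  by rewrite sumEFin lee_fin -mulr_sumr ler_pM2l ?powR_gt0.
apply: lee_sum => k _.
apply: (@le_trans _ _ (\int[leb]_(r in grid a k) ((D * P N (2 ^+ k.+1 * a)) `^ v * (2 ^+ k * a)^-1)%:E)%E).
  apply: ge0_le_integral; [exact: measurable_grid|by []|exact: measurable_funTS|by []|].
  move=> r gr; have h := gr; rewrite gridE in h; have /andP[h1 h2] := h.
  have r0 : 0 < r by exact: lt_le_trans h1.
  have ra : [set` `[a, +oo[] r by rewrite grid_cover//; exists k.
  apply: (le_trans (fh r ra)); rewrite lee_fin.
  have [|_ h3] := weight_doubling (ka k) (r := r).
    by rewrite h1 mulrA -exprS ltW.
  rewrite mulrA -exprS in h3.
  have h4 := mN _ _ r0 (ltW h2).
  apply: ler_pM; rewrite ?powR_ge0 ?invr_ge0 ?(ltW r0)//.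
    rewrite ge0_ler_powR ?nnegrE ?(ltW v0) ?P0//; first by rewrite mulr_ge0 ?P0// ltW.
    rewrite mulrA; apply: ler_pM => //; first exact/ltW/w0.
    exact: N0.
  by rewrite lef_pV2 ?posrE.
rewrite integral_cst; last exact: measurable_grid.
rewrite [X in (_ * X)%E](grid_length k a0) -EFinM lee_fin powRM ?P0 ?(ltW D0)//.
by rewrite divfK// gt_eqF.
Qed.

Lemma right_ray_integral_le I v N (Bd : \bar R) : right_ray I -> monotone N ->
  (forall a, I a -> (Lv_integral [set` `[a, +oo[] v (fun r => P N r) <= Bd)%E) ->
  (Lv_integral I v (fun r => P N r) <= Bd)%E.
Proof.
move=> rI [N0 mN] H; have mI := measurable_right_ray rI.
have h0 r : I r -> (0 <= (P N r `^ v * r^-1)%:E)%E.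
  move=> Ir; have r0 := right_ray_gt0 rI Ir.
  by rewrite lee_fin mulr_ge0 ?powR_ge0// invr_ge0 ltW.
apply: integral_le_lower => // f mf f0 fh; have [a [a0 da IE]] := rI.
have aI M : I (a M) by rewrite IE; exists M => //=; rewrite in_itv/= lexx.
pose F M : set R := [set` `[a M, +oo[].
have mF M : measurable (F M) by exact: measurable_itv.
have hF : {homo F : i j / (i <= j)%N >-> (i <= j)%O}.
  move=> i j ij; apply/subsetPset => r; rewrite /F/= !in_itv/= !andbT.
  by apply: le_trans; exact: da.
have cv := ge0_nondecreasing_set_cvg_integral (f := f) (mu := leb) hF mF
  (fun i => measurable_funTS mf) (fun i x _ => f0 x).
rewrite IE -(cvg_lim _ cv)//; apply: lime_le; first by apply/cvg_ex; eexists; exact: cv.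
apply: nearW => M; apply: le_trans (H _ (aI M)).
apply: ge0_le_lower_integral => // r rM; apply: fh; exact: (right_ray_sub rI (aI M)).
Qed.

Lemma Lu_normE I v N :
  Lu_norm I v%:E (fun r => (P N r)%:E) = (Lv_integral I v (fun r => P N r) `^ v^-1)%E.
Proof. by []. Qed.

(** By monotonicity the values on [[rho, 2 * rho]] control the value at [rho]. *)
Lemma Lu_norm_pointwise I u : right_ray I -> (0 < u)%E -> exists2 B : R, 0 < B &
  forall N, monotone N -> forall rho, I rho ->
    ((P N rho)%:E <= B%:E * Lu_norm I u (fun r => (P N r)%:E))%E.
Proof.
move=> rI; have mI := measurable_right_ray rI.
have I0 r : I r -> 0 < r by exact: right_ray_gt0.
case: u => [v| |]; rewrite ?lte_fin// => v0.
  have Dv0 : 0 < 2 * D `^ v by rewrite mulr_gt0// powR_gt0.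
  exists ((2 * D `^ v) `^ v^-1); first by rewrite powR_gt0.
  move=> N mN rho Irho; have rho0 := I0 _ Irho.
  have [N0 _] := mN; have Pr0 : 0 <= P N rho by rewrite mulr_ge0 ?N0// ltW// w0.
  have := grid_lower 1 v0 rho0 (right_ray_sub rI Irho) mI I0 mN.
  rewrite big_ord1 expr0 mul1r Lu_normE// => h.
  have J0 : (0 <= Lv_integral I v (fun r => P N r))%E.
    apply: integral_ge0 => r Ir; rewrite lee_fin mulr_ge0 ?powR_ge0// invr_ge0 ltW//.
    exact: I0.
  rewrite -poweR_EFin -poweRM ?lee_fin ?(ltW Dv0)//.
  apply: le_trans (_ : (_ <= (P N rho `^ v)%:E `^ v^-1)%E) _.
    by rewrite poweR_EFin -powRrM mulfV ?gt_eqF// powRr1.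
  by rewrite le_poweR ?invr_ge0 ?(ltW v0)// lee_fin powR_ge0.
exists D => // N mN rho Irho; have rho0 := I0 _ Irho; have [N0 incN] := mN.
have := ess_sup_ge leb ((fun r => (P N r)%:E) \_ I).
set B := ess_sup _ _ => /= aeB.
have [r [rg rB]] : exists r, [set` `[rho, 2 * rho[] r /\ ((P N r)%:E <= B)%E.
  apply: contrapT => none; have : (0 < leb [set` `[rho, (2 * rho)%R[])%E.
    rewrite lebesgue_measure_itv/= lte_fin ltr_pMl// ltr1n -EFinB lte_fin subr_gt0.
    by rewrite ltr_pMl// ltr1n.
  move: aeB => [Z [mZ Z0 sZ]]; rewrite ltNge => /negP; apply.
  rewrite -Z0; apply: le_measure.
  - by apply/mem_set; exact: measurable_itv.
  - by apply/mem_set.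
  move=> r rg; apply: sZ => /= h; apply: none; exists r; split => //.
  have rI' : I r.
    by apply: (right_ray_sub rI Irho); move: rg; rewrite /= !in_itv/= => /andP[->].
  by move: h; rewrite patchE mem_set.
apply: le_trans (lee_wpmul2l _ rB); last by rewrite lee_fin ltW.
move: rg; rewrite /= in_itv/= => /andP[h1 h2].
have [|h3 _] := weight_doubling rho0 (r := r); first by rewrite h1 ltW.
rewrite -EFinM lee_fin mulrA; apply: ler_pM => //; first exact/ltW/w0.
  exact: N0.
exact: incN.
Qed.

End weights.

Section weighted_comparison.
Context (R : realType).
Variables (w : R -> R) (C sigma : R).
Hypotheses (w0 : forall r, 0 < r -> 0 < w r) (C0 : 0 < C) (sigma0 : 0 < sigma).
Hypothesis hw : forall r t, 0 < r -> 1 <= t -> w r <= C * t `^ sigma * w (t * r).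
Implicit Types (N : R -> R) (I : set R).

Local Notation P N r := (w r * N r).
Local Notation D := (C * 2 `^ sigma).

Let D0 : 0 < D. Proof. by rewrite mulr_gt0// powR_gt0. Qed.

Variables (delta A : R) (m : nat).
Hypotheses (sigma_delta : sigma < delta) (A0 : 0 <= A).

(** The relation between the Campanato norms of a function and of its image, as
    functions of the radius. *)
Definition growth_dominates N N' := forall rho S, 0 < rho -> 0 <= S ->
  (forall j, N (2 ^+ j * (2 ^+ m * rho)) <= S * (2 ^+ j) `^ delta) -> N' rho <= A * S.

Local Notation E := (C * (2 ^+ m) `^ sigma).

Lemma growth_dominates_weight N N' rho b : growth_dominates N N' -> 0 < rho -> 0 <= b ->
  (forall j, (2 `^ (sigma - delta)) ^+ j * P N (2 ^+ j * (2 ^+ m * rho)) <= b) ->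
  P N' rho <= A * E * b.
Proof.
move=> dom rho0 b0 hb; have wr := w0 rho0.
have pm : 0 < 2 ^+ m :> R by rewrite exprn_gt0.
have E0 : 0 <= E by rewrite mulr_ge0 ?powR_ge0// ltW.
have S0 : 0 <= E * b / w rho by rewrite mulr_ge0 ?invr_ge0 ?mulr_ge0// ltW.
have := dom rho _ rho0 S0; rewrite mulrA ler_pdivlMr// [N' rho * _]mulrC mulrA; apply => j.
have pj : 0 < 2 ^+ j :> R by rewrite exprn_gt0.
have t1 : 1 <= 2 ^+ j * 2 ^+ m :> R by rewrite -exprD exprn_ege1// ler1n.
have bj := hb j.
have h1 : w rho <= C * (2 ^+ j * 2 ^+ m) `^ sigma * w (2 ^+ j * (2 ^+ m * rho)).
  by rewrite [2 ^+ j * (_ * rho)]mulrA; exact: hw.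
set r := 2 ^+ j * (2 ^+ m * rho) in h1 bj *.
have bj' : w r * N r <= b * (2 ^+ j) `^ (delta - sigma).
  have u0 : 0 < (2 ^+ j) `^ (delta - sigma) :> R by rewrite powR_gt0.
  by rewrite -ler_pdivrMr// -powRN opprB mulrC -powR_expn.
rewrite mulrAC ler_pdivlMr//.
have [Nr|Nr] := leP (N r) 0.
  apply: (@le_trans _ _ 0); first by rewrite mulr_le0_ge0// ltW.
  by rewrite mulr_ge0 ?powR_ge0// mulr_ge0.
apply: (@le_trans _ _ (N r * (C * (2 ^+ j * 2 ^+ m) `^ sigma * w r))).
  by rewrite ler_pM2l.
rewrite powRM ?(ltW pj) ?(ltW pm)//.
have -> : N r * (C * ((2 ^+ j) `^ sigma * (2 ^+ m) `^ sigma) * w r) =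
  E * (2 ^+ j) `^ sigma * (w r * N r) by ring.
have -> : E * b * (2 ^+ j) `^ delta = E * (2 ^+ j) `^ sigma * (b * (2 ^+ j) `^ (delta - sigma)).
  have -> : (2 ^+ j) `^ delta = (2 ^+ j) `^ (delta - sigma) * (2 ^+ j) `^ sigma :> R.
    by rewrite -powRD ?subrK// (gt_eqF pj) implybT.
  by ring.
by rewrite ler_wpM2l// mulr_ge0 ?powR_ge0.
Qed.

(** On a grid the values of [N'] are at most the geometric suprema of those of
    [N], with the ratio [2 `^ (sigma - delta)]. *)
Lemma Lu_norm_compare I u : right_ray I -> (0 < u)%E -> exists2 B : R, 0 < B &
  forall N N', monotone N -> monotone N' -> growth_dominates N N' ->
  (Lu_norm I u (fun r => (P N' r)%:E) <= B%:E * Lu_norm I u (fun r => (P N r)%:E))%E.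
Proof.
move=> rI u0; have mI := measurable_right_ray rI.
have I0 r : I r -> 0 < r by exact: right_ray_gt0.
have [B1 B10 pw] := Lu_norm_pointwise w0 C0 sigma0 hw rI u0.
have E0 : 0 < E by rewrite mulr_gt0// powR_gt0// exprn_gt0.
have AE0 : 0 <= A * E by rewrite mulr_ge0// ltW.
have scale rho j : I rho -> I (2 ^+ j * (2 ^+ m * rho)).
  move=> Irho; apply: (right_ray_sub rI Irho); rewrite /= in_itv/= andbT mulrA.
  by rewrite ler_peMl ?(ltW (I0 _ Irho))// -exprD exprn_ege1// ler1n.
pose th := 2 `^ (sigma - delta) : R.
have th0 : 0 < th by rewrite powR_gt0.
have th1 : th < 1.
  rewrite /th -[_ - _]opprB powRN invf_lt1 ?powR_gt0//.
  have := @half_powR_lt1 R (delta - sigma); rewrite subr_gt0 => /(_ sigma_delta).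
  by rewrite -powR_inv1// -powRrM mulN1r powRN invf_lt1// powR_gt0.
have P0 N r : monotone N -> 0 < r -> 0 <= P N r.
  by move=> [N0 _] r0; rewrite mulr_ge0 ?N0// ltW// w0.
case: u u0 pw => [v| |]; rewrite ?lte_fin// => v0 pw.
  have thv1 : 0 < 1 - th `^ v.
    rewrite subr_gt0; apply: (@lt_le_trans _ _ (1 `^ v)); last by rewrite powR1.
    by rewrite gt0_ltr_powR// nnegrE ltW.
  have [G [GE G0]] : exists G, G = D `^ v * (A * E) `^ v * 4 * D `^ v / (1 - th `^ v) /\ 0 <= G.
    eexists; split => //.
    by rewrite mulr_ge0 ?invr_ge0 ?(ltW thv1)// !mulr_ge0 ?powR_ge0.
  pose B := G `^ v^-1 + 1.
  exists B; first by rewrite ltr_wpDl// powR_ge0.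
  move=> N N' mN mN' dom; rewrite /Lu_norm.
  set J := Lv_integral I v (fun r => P N r).
  rewrite -[X in (_ <= _ * X `^ _)%E]/J -[X in (X `^ _ <= _)%E]/(Lv_integral I v (fun r => P N' r)).
  have J0 : (0 <= J)%E.
    apply: integral_ge0 => r Ir; have r0 := I0 _ Ir.
    by rewrite lee_fin mulr_ge0 ?powR_ge0// invr_ge0 ltW.
  have B0 : 0 < B by rewrite ltr_wpDl// powR_ge0.
  case: (ltP J +oo)%E => [Jfin|]; last first.
    by rewrite leye_eq => /eqP ->; rewrite poweRyr ?gt0_muley ?leey ?lte_fin// gt_eqF// invr_gt0.
  have JE : J = (fine J)%:E by rewrite fineK// ge0_fin_numE.
  set j := fine J in JE.
  have j0 : 0 <= j by exact: fine_ge0.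
  have key a : I a -> (Lv_integral [set` `[a, +oo[] v (fun r => P N' r) <=
      (D `^ v * ((A * E) `^ v * (2 * (2 * D `^ v * j) / (1 - th `^ v))))%:E)%E.
    move=> Ia; have a0 := I0 _ Ia; have [Nge _] := mN; have [N'ge _] := mN'.
    have ka k : 0 < 2 ^+ k * a by rewrite mulr_gt0// exprn_gt0.
    have hJ K : \sum_(k < K) P N (2 ^+ k * a) `^ v <= 2 * D `^ v * j.
      rewrite -lee_fin EFinM -JE.
      exact: (grid_lower w0 C0 sigma0 hw K v0 a0 (right_ray_sub rI Ia) mI I0 mN).
    have thv0 : 0 < th `^ v by rewrite powR_gt0.
    have thv1' : th `^ v < 1 by rewrite -subr_gt0.
    have [q [pq hq]] := geometric_sup_sum thv0 thv1'
      (fun k => powR_ge0 (P N (2 ^+ k * a)) v) hJ.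
    have q0 k : 0 <= q k.
      by apply: le_trans (pq k 0); rewrite mulr_ge0 ?powR_ge0// exprn_ge0 ?powR_ge0.
    apply: (grid_upper w0 C0 sigma0 hw v0 a0 mN') => K.
    apply: (@le_trans _ _ (\sum_(k < K) (A * E) `^ v * q (m.+1 + k)%N)).
      apply: ler_sum => k _.
      have AEq0 : 0 <= A * E * q (m.+1 + k)%N `^ v^-1.
        by rewrite mulr_ge0 ?powR_ge0.
      have -> : (A * E) `^ v * q (m.+1 + k)%N = (A * E * q (m.+1 + k)%N `^ v^-1) `^ v.
        rewrite [RHS](powRM _ AE0 (powR_ge0 _ _)); congr (_ * _).
        by rewrite -powRrM mulVf ?gt_eqF// powRr1.
      rewrite ge0_ler_powR ?nnegrE ?(ltW v0)//; first exact: P0.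
      apply: (growth_dominates_weight dom (ka _)); first exact: powR_ge0.
      move=> i; set r := 2 ^+ i * _.
      have r0 : 0 < r by rewrite /r mulr_gt0 ?exprn_gt0// mulr_gt0 ?exprn_gt0.
      have thi : 0 <= th ^+ i by rewrite exprn_ge0// ltW.
      have := pq (m.+1 + k)%N i.
      have -> : 2 ^+ (m.+1 + k + i) * a = r by rewrite /r !exprD !exprS; ring.
      rewrite powR_expn ?(ltW th0)// -powRM ?P0//.
      move=> h; have x0 : 0 <= th ^+ i * P N r by rewrite mulr_ge0 ?P0.
      rewrite -[leLHS](powRr1 x0) -[X in _ `^ X](mulfV (lt0r_neq0 v0)) powRrM.
      by rewrite ge0_ler_powR ?nnegrE ?powR_ge0 ?invr_ge0 ?(ltW v0).
    rewrite -mulr_sumr ler_wpM2l ?powR_ge0//; apply: le_trans (hq (m.+1 + K)%N).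
    by rewrite big_split_ord/= lerDr sumr_ge0.
  have := right_ray_integral_le rI mN' key; rewrite JE => h.
  have {}h : (Lv_integral I v (fun r => P N' r) <= (G * j)%:E)%E.
    apply: (le_trans h); rewrite lee_fin le_eqVlt; apply/orP; left; apply/eqP.
    by rewrite GE; ring.
  have J'0 : (0 <= Lv_integral I v (fun r => P N' r))%E.
    apply: integral_ge0 => r Ir; have r0 := I0 _ Ir.
    by rewrite lee_fin mulr_ge0 ?powR_ge0// invr_ge0 ltW.
  apply: (@le_trans _ _ ((G * j)%:E `^ v^-1)%E).
    by rewrite le_poweR ?invr_ge0 ?(ltW v0).
  rewrite !poweR_EFin -EFinM lee_fin powRM//.
  by rewrite ler_wpM2r ?powR_ge0// /B lerDl.
exists (A * E * B1 + 1); first by rewrite ltr_wpDl// !mulr_ge0// ltW.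
move=> N N' mN mN' dom.
have := pw N mN; set L := Lu_norm I +oo _ => {}pw.
have [t It] : exists t, I t.
  by have [a [_ _ ->]] := rI; exists (a 0), 0 => //=; rewrite in_itv/= lexx.
case: L pw => [L| |] pw.
- have bound rho : I rho -> P N' rho <= A * E * (B1 * L).
    move=> Irho; have rho0 := I0 _ Irho.
    have BL0 : 0 <= B1 * L.
      by rewrite -lee_fin EFinM; apply: le_trans (pw _ Irho); rewrite lee_fin P0.
    apply: (growth_dominates_weight dom rho0 BL0) => j.
    have := pw _ (scale rho j Irho); rewrite -EFinM lee_fin; apply: le_trans.
    rewrite ler_piMl ?P0//; first by apply: (I0 _ (scale rho j Irho)).
    by rewrite exprn_ile1// ltW.
  have BL0 : 0 <= B1 * L.
    rewrite -lee_fin EFinM; apply: le_trans (pw _ It); rewrite lee_fin P0//.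
    exact: I0.
  have L0 : 0 <= L by rewrite -(pmulr_rge0 _ B10).
  have hB : A * E * (B1 * L) <= (A * E * B1 + 1) * L.
    by rewrite mulrA ler_wpM2r// lerDl.
  apply/ess_supP; apply: nearW => r; rewrite patchE -EFinM; case: ifPn => [/set_mem Ir|_].
    by rewrite lee_fin (le_trans (bound r Ir)).
  by rewrite lee_fin; apply: le_trans hB; rewrite mulr_ge0.
- by rewrite gt0_muley ?leey// lte_fin ltr_wpDl// mulr_ge0// ltW.
- have := pw _ It; rewrite gt0_muleNy ?lte_fin//.
Qed.

End weighted_comparison.

(** * The modified operator on the spaces *)

Section modified_operator.
Context (R : realType) (n : nat) (s : cell_shape).
Local Notation V := 'rV[R]_n.
Local Notation mu := (@lebesgue_rV R n).
Local Notation d := (Num.sqrt n%:R : R).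
Local Notation B := (cell EuclideanBall).
Variables (kappa C : R) (K : V -> V -> R) (T : (V -> R) -> V -> R).
Hypotheses (n0 : (0 < n)%N) (hK : standard_kernel kappa C K).
Hypothesis hT : singular_integral kappa K T.
Implicit Types (f g : V -> R).

Let kappa0 := kernel_kappa_gt0 hK.

Lemma cell_sub_big_ball (x : V) r : cell s x r `<=` B 0 (enorm x + d * r).
Proof.
apply: (@subset_trans _ (B x (d * r))); first exact: cell_sub_ball.
by apply: ball_sub_ball; rewrite subr0.
Qed.

Lemma modified_limit_value q f g : 1 < q -> admissible kappa q f ->
  modified_limit s K q f g -> modified_value s K q f g.
Proof.
move=> q1 af lg; split=> [eta x eta0|x r r0].
  exact: (modified_integrable s n0 hK (ltW q1) af x eta0).
have q0 : 0 < q by apply: lt_trans q1.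
have rho0 : 0 < enorm x + d * r by rewrite ltr_wpDl ?enorm_ge0// mulr_gt0// sqrtn_gt0.
have sub := @cell_sub_big_ball x r.
have mg := modified_limit_measurable lg.
have mc := measurable_cell s x r.
have mB := measurable_cell EuclideanBall (0 : V) (enorm x + d * r).
split.
  apply: Lq_LfunP => //; first exact: measurable_funTS.
  apply: le_lt_trans (modified_limit_lty lg rho0).
  by apply: Lq_subset => //; exact: measurable_funTS.
have : vanishing (fun eta => Lq mu q (cell s x r) (modified_truncated s K eta f \- g)%R).
  apply: vanishing_le (modified_limit_cvg lg rho0); near=> eta.
  have eta0 : 0 < eta by near: eta; exact: nbhs_right_gt.
  apply: Lq_subset => //; apply: measurable_funB; apply: measurable_funTS => //.
  exact: (measurable_modified_truncated s n0 hK eta0 (admissible_measurable af)).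
by move=> /vanishingP; apply => eta; exact: Lq_ge0.
Unshelve. all: by end_near. Qed.

Lemma modified_value_limit q f g : 1 < q -> measurable_fun setT f ->
  modified_value s K q f g -> modified_limit s K q f g.
Proof.
move=> q1 mf [_ hg]; have q0 : 0 < q by apply: lt_trans q1.
have mB r : measurable (B (0 : V) r) by exact: measurable_cell.
have mC r : measurable (cell s (0 : V) r) by exact: measurable_cell.
have mgC r : 0 < r -> measurable_fun (cell s 0 r) g /\ (Lq mu q (cell s 0 r) g < +oo)%E.
  by move=> r0; have [h _] := hg 0 r r0; exact: Lfun_patchP.
have sub r : B (0 : V) r `<=` cell s 0 r by exact: ball_sub_cell.
have mg : measurable_fun setT g.
  rewrite -ball_exhaust; apply/measurable_fun_bigcup => // k.
  by apply: measurable_funS (sub k.+1%:R) _ => //; have [] := mgC k.+1%:R (ltr0Sn R k).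
split => // [r r0|r r0].
  apply: le_lt_trans (proj2 (mgC r r0)); apply: Lq_subset => //.
  exact: measurable_funTS.
have [_ cv] := hg 0 r r0.
have : vanishing (fun eta => Lq mu q (cell s 0 r) (modified_truncated s K eta f \- g)%R).
  by apply/vanishingP => // eta; exact: Lq_ge0.
apply: vanishing_le; near=> eta.
have eta0 : 0 < eta by near: eta; exact: nbhs_right_gt.
apply: Lq_subset => //; apply: measurable_funB; apply: measurable_funTS => //.
exact: (measurable_modified_truncated s n0 hK eta0 mf).
Unshelve. all: by end_near. Qed.

(** The cancellation of the kernel makes the modified operator map constants
    to constants. *)
Lemma modified_limit_cst1 q : 1 < q ->
  modified_limit s K q (cst 1) (cst (- kernel0_mass s K)).
Proof.
move=> q1; have q0 : 0 < q by apply: lt_trans q1.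
have mB r : measurable (B (0 : V) r) by exact: measurable_cell.
have a1 : admissible kappa q (cst 1 : V -> R) by exact: (admissible_cst n kappa0 (ltW q1)).
split => // [|r r0].
  by move=> r r0; rewrite Lq_cst// lte_mul_pinfty ?lee_fin// poweR_lty// volume_cell_lty.
have := kernel0_part_vanishing s n0 hK (0 : V) q1 r0 a1.
apply: vanishing_le; near=> eta.
have eta0 : 0 < eta by near: eta; exact: nbhs_right_gt.
rewrite le_eqVlt; apply/orP; left; apply/eqP; congr (Lq mu q); apply/funext => y /=.
rewrite (modified_truncated_cst s n0 hK)//; last first.
  by move=> z t1 t2 h1 h2; have [] := kernel_cancellation hT z h1 h2.
rewrite opprK addrAC addNr add0r.
by apply: eq_Rintegral => z _; rewrite mulr1.
Unshelve. all: by end_near. Qed.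

Lemma modified_truncated_ae eta f g (x : V) : (\forall y \ae mu, f y = g y) ->
  measurable_fun setT f -> measurable_fun setT g -> 0 < eta ->
  modified_truncated s K eta f x = modified_truncated s K eta g x.
Proof.
move=> fg mf mg eta0; rewrite /modified_truncated -/(away x eta) /Rintegral; congr fine.
have mm h : measurable_fun setT h -> measurable_fun (away x eta)
    (fun y => (modified_integrand s K h x y)%:E).
  move=> mh; apply/measurable_EFinP; apply: measurable_funM; last exact: measurable_funTS.
  apply: measurable_funB; first exact: (measurable_kernel_section n0 hK).
  exact: measurable_funTS (measurable_kernel0 s n0 hK).
apply: ae_eq_integral; [exact: measurable_away|exact: mm|exact: mm|].
by apply: filterS fg => y fgy _; rewrite /modified_integrand fgy.
Qed.

Lemma modified_limit_unique q q' f g g' : 1 <= q -> 1 <= q' -> measurable_fun setT f ->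
  modified_limit s K q f g -> modified_limit s K q' f g' ->
  \forall x \ae mu, g x = g' x.
Proof.
move=> q1 q'1 mf lg lg'.
have h : \forall x \ae mu, g x = 0 * g' x + g' x.
  apply: (modified_limit_lin n0 hK q'1 q'1 q1 mf mf mf _ lg' lg' lg) => eta x _.
  by rewrite mul0r add0r.
by apply: filterS h => x ->; rewrite mul0r add0r.
Qed.

End modified_operator.

Section campanato_monotone.
Context (R : realType) (n : nat) (s : cell_shape) (p lambda : R).
Local Notation V := 'rV[R]_n.
Implicit Types (f : V -> R) (U : set V).

Lemma campanato_norm_ge0 f r : 0 < r -> (0 <= campanato_norm s p lambda (cell s (0 : V) r) f)%E.
Proof.
move=> r0; apply: le_trans (_ : (_ <= (r `^ (- lambda))%:E * oscillation p f (cell s 0 r))%E) _.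
  by rewrite mule_ge0 ?poweR_ge0// lee_fin powR_ge0.
by apply: ereal_sup_ubound; exists 0, r; split.
Qed.

Lemma campanato_norm_subset f U U' : U `<=` U' ->
  (campanato_norm s p lambda U f <= campanato_norm s p lambda U' f)%E.
Proof.
move=> UU'; apply: ereal_sup_le => _ [x [r [r0 sub ->]]].
by exists x, r; split => //; exact: subset_trans UU'.
Qed.

Lemma sub_cell_radius (r r' : R) : r <= r' -> cell s (0 : V) r `<=` cell s 0 r'.
Proof. by move=> rr'; apply: sub_cell; rewrite subrr snorm0 add0r. Qed.

End campanato_monotone.

Section extension.
Context (R : realType) (n : nat) (s : cell_shape).
Local Notation V := 'rV[R]_n.
Local Notation mu := (@lebesgue_rV R n).
Local Notation B := (cell EuclideanBall).
Variables (kappa C : R) (K : V -> V -> R) (T : (V -> R) -> V -> R).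
Hypotheses (n0 : (0 < n)%N) (hK : standard_kernel kappa C K).
Hypothesis hT : singular_integral kappa K T.
Variables (I : set R) (u : \bar R) (w : R -> R) (Cw sigma : R).
Hypotheses (rI : right_ray I) (u0 : (0 < u)%E) (Cw0 : 0 < Cw) (sigma0 : 0 < sigma).
Hypothesis w0 : forall r, 0 < r -> 0 < w r.
Hypothesis hw : forall r t, 0 < r -> 1 <= t -> w r <= Cw * t `^ sigma * w (t * r).
Variables (p q lambda delta : R).
Hypotheses (q1 : 1 < q) (sigma_delta : sigma < delta) (ldk : lambda + delta < kappa).
Local Notation cnorm p r f := (campanato_norm s p lambda (cell s 0 r) f).
Hypothesis cnorm_pq : exists A m, 0 <= A /\ forall f r M, 0 < r -> 0 <= M ->
  (forall r, 0 < r -> mu.-integrable (cell s 0 r) (EFin \o f)) ->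
  (cnorm p (2 ^+ m * r) f <= M%:E)%E -> (cnorm q r f <= (A * M)%:E)%E.
Hypothesis cnorm_qp : forall (U : set V) f,
  (forall x t, 0 < t -> cell s x t `<=` U -> mu.-integrable (cell s x t) (EFin \o f)) ->
  (campanato_norm s p lambda U f <= campanato_norm s q lambda U f)%E.
Implicit Types (f g : V -> R).

Local Notation X := (B_space I s p lambda w u).
Local Notation norm := (B_norm I s p lambda w u).
Let kappa0 := kernel_kappa_gt0 hK.

Let I0 r : I r -> 0 < r. Proof. exact: right_ray_gt0. Qed.

Let N f r := fine (cnorm p r f).

Lemma B_space_integrable f : X f -> forall r, 0 < r -> mu.-integrable (cell s 0 r) (EFin \o f).
Proof. by move=> [_ h _] r r0; have [_ iff _] := h r r0; exact: iff. Qed.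

Lemma cnormE f : (forall r, 0 < r -> (cnorm p r f < +oo)%E) ->
  forall r, 0 < r -> cnorm p r f = (N f r)%:E.
Proof.
by move=> h r r0; rewrite /N fineK// ge0_fin_numE ?h// campanato_norm_ge0.
Qed.

Lemma B_space_cnormE f : X f -> forall r, 0 < r -> cnorm p r f = (N f r)%:E.
Proof. by move=> [_ h _]; apply: cnormE => r r0; have [] := h r r0. Qed.

Lemma cnorm_monotone f : (forall r, 0 < r -> cnorm p r f = (N f r)%:E) -> monotone (N f).
Proof.
move=> h; split=> [r r0|r r' r0 rr']; first by rewrite fine_ge0// campanato_norm_ge0.
have r'0 : 0 < r' by exact: lt_le_trans rr'.
by rewrite -lee_fin -!h// campanato_norm_subset//; exact: sub_cell_radius.
Qed.

Lemma B_normE f : (forall r, 0 < r -> cnorm p r f = (N f r)%:E) ->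
  norm f = Lu_norm I u (fun r => (w r * N f r)%:E).
Proof.
move=> h; rewrite /B_norm /Lu_norm; case: u => [v| |] //.
  congr poweR; apply: eq_integral => r /set_mem Ir.
  by rewrite h ?EFinM//; exact: I0.
congr ess_sup; apply/funext => r; rewrite !patchE; case: ifPn => // /set_mem Ir.
by rewrite h ?EFinM//; exact: I0.
Qed.

(** The pointwise bound on [w * N f] at [2 ^+ j * t], divided by the weight. *)
Lemma B_space_growth f : X f -> forall r, 0 < r ->
  exists2 M, 0 <= M & campanato_growth s p lambda delta r M f.
Proof.
move=> Xf; have NE := B_space_cnormE Xf; have mN := cnorm_monotone NE.
have [_ _ fin] := Xf; have [Bw Bw0 pw] := Lu_norm_pointwise w0 Cw0 sigma0 hw rI u0.
have := pw _ mN; rewrite -(B_normE NE) => {}pw.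
have [t It] : exists t, I t.
  by have [a [_ _ ->]] := rI; exists (a 0), 0 => //=; rewrite in_itv/= lexx.
have t0 := I0 It; have wt := w0 t0.
have P0 r : 0 < r -> 0 <= w r * N f r.
  by move=> r0; have [N0 _] := mN; rewrite mulr_ge0 ?N0// ltW// w0.
have [L LE] : exists L, norm f = L%:E.
  exists (fine (norm f)); rewrite fineK// fin_numE andbC lt_eqF//=.
  apply/eqP => h; have := pw _ It; rewrite h gt0_muleNy ?lte_fin//.
pose M := Bw * L * Cw / w t.
have BL0 : 0 <= Bw * L.
  by rewrite -lee_fin EFinM -LE; apply: le_trans (pw _ It); rewrite lee_fin P0.
have M0 : 0 <= M.
  apply: divr_ge0; last exact: ltW.
  by apply: mulr_ge0 => //; exact: ltW.
have G : campanato_growth s p lambda delta t M f.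
  move=> j; have pj : 0 < 2 ^+ j * t by rewrite mulr_gt0// exprn_gt0.
  have Ij : I (2 ^+ j * t).
    apply: (right_ray_sub rI It); rewrite /= in_itv/= andbT.
    by rewrite ler_peMl ?(ltW t0)// exprn_ege1// ler1n.
  rewrite NE// lee_fin.
  have := pw _ Ij; rewrite LE -EFinM lee_fin => h.
  have j1 : 1 <= 2 ^+ j :> R by rewrite exprn_ege1// ler1n.
  have := hw t0 j1 => h'.
  rewrite /M mulrAC ler_pdivlMr//.
  apply: (@le_trans _ _ (N f (2 ^+ j * t) * (Cw * (2 ^+ j) `^ sigma * w (2 ^+ j * t)))).
    by rewrite ler_wpM2l//; have [N0 _] := mN; rewrite N0.
  have -> : N f (2 ^+ j * t) * (Cw * (2 ^+ j) `^ sigma * w (2 ^+ j * t)) =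
    Cw * (2 ^+ j) `^ sigma * (w (2 ^+ j * t) * N f (2 ^+ j * t)) by ring.
  apply: (@le_trans _ _ (Cw * (2 ^+ j) `^ sigma * (Bw * L))).
    by rewrite ler_wpM2l// mulr_ge0 ?powR_ge0// ltW.
  have -> : Bw * L * Cw * (2 ^+ j) `^ delta = Cw * (2 ^+ j) `^ delta * (Bw * L) by ring.
  rewrite ler_wpM2r// ler_pM2l// ler_powR// ltW//.
move=> r r0; pose k := Num.Def.archi_bound (r / t).
have rk : r <= 2 ^+ k * t by rewrite -ler_pdivrMr// ltW//; exact: upper_nthrootP.
exists (M * (2 ^+ k) `^ delta); first by rewrite mulr_ge0 ?powR_ge0.
move=> j; apply: le_trans (campanato_growth_shift k G j).
by apply: campanato_norm_subset; apply: sub_cell_radius; rewrite ler_pM2l// exprn_gt0.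
Qed.

Lemma campanato_growth_exponent : exists A m, 0 <= A /\ forall f r M, 0 < r -> 0 <= M ->
  (forall r, 0 < r -> mu.-integrable (cell s 0 r) (EFin \o f)) ->
  campanato_growth s p lambda delta (2 ^+ m * r) M f ->
  campanato_growth s q lambda delta r (A * M) f.
Proof.
have [A [m [A0 h]]] := cnorm_pq; exists A, m; split => // f r M r0 M0 iff G j.
rewrite -mulrA; apply: h => //.
- by rewrite mulr_gt0// exprn_gt0.
- by rewrite mulr_ge0 ?powR_ge0.
- by rewrite mulrCA; exact: G.
Qed.

Lemma B_space_admissible f : X f -> admissible kappa q f.
Proof.
move=> Xf; have [mf _ _] := Xf; have iff := B_space_integrable Xf.
have [A [m [A0 h]]] := campanato_growth_exponent.
have pm : 0 < 2 ^+ m * 1 :> R by rewrite mulr1 exprn_gt0.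
have [M M0 G] := B_space_growth Xf pm.
apply: (campanato_growth_admissible n0 kappa0 (ltW q1) ldk mf iff ltr01 _ (h f 1 M ltr01 M0 iff G)).
by rewrite mulr_ge0.
Qed.

Let S f : V -> R := xget (cst 0) [set g | modified_limit s K q f g].

Let S_limit f : admissible kappa q f -> modified_limit s K q f (S f).
Proof.
move=> af; have [g lg] := modified_limit_exists s n0 hK hT q1 af.
by rewrite /S; case: xgetP => [h -> //|/(_ g)].
Qed.

Lemma modified_operator_dominated : exists A m, 0 <= A /\ forall f, X f ->
  (forall r, 0 < r -> cnorm p r (S f) = (N (S f) r)%:E) /\
  growth_dominates delta A m (N f) (N (S f)).
Proof.
have [A1 [m1 [A10 h1]]] := campanato_growth_exponent.
have [A2 [m2 [A20 h2]]] := modified_limit_campanato s n0 hK hT q1 ldk.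
exists (A2 * A1), (m1 + m2)%N; split; first by rewrite mulr_ge0.
move=> f Xf; have iff := B_space_integrable Xf; have af := B_space_admissible Xf.
have lS := S_limit af.
have bound r M : 0 < r -> 0 <= M ->
    campanato_growth s p lambda delta (2 ^+ (m1 + m2) * r) M f ->
    (cnorm p r (S f) <= (A2 * A1 * M)%:E)%E.
  move=> r0 M0 G; apply: le_trans (cnorm_qp _) _.
    by move=> x t t0 _; exact: (modified_limit_integrable n0 x (ltW q1) t0 lS).
  rewrite -mulrA; apply: (h2 f) => //; first by rewrite mulr_ge0.
  apply: h1 => //; first by rewrite mulr_gt0// exprn_gt0.
  by rewrite mulrA -exprD.
have NE : forall r, 0 < r -> cnorm p r (S f) = (N (S f) r)%:E.
  apply: cnormE => r r0.
  have pr : 0 < 2 ^+ (m1 + m2) * r by rewrite mulr_gt0// exprn_gt0.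
  have [M M0 G] := B_space_growth Xf pr.
  exact: le_lt_trans (bound r M r0 M0 G) (ltry _).
split => // r M r0 M0 h; rewrite -lee_fin -NE//; apply: bound => // j.
by rewrite (B_space_cnormE Xf) ?lee_fin ?h// mulr_gt0 ?exprn_gt0// mulr_gt0 ?exprn_gt0.
Qed.

(** Any choice of limits defines the operator: two limits agree almost
    everywhere, also across exponents, which gives linearity and the agreement
    with the modified operator. *)
Theorem modified_extension : modified_extends_boundedly s K X norm.
Proof.
exists S; split.
- move=> f g Xf Xg [c fg]; have af := B_space_admissible Xf; have ag := B_space_admissible Xg.
  have a1 : admissible kappa q (cst 1 : V -> R) by exact: (admissible_cst n kappa0 (ltW q1)).
  have l1 := modified_limit_cst1 s n0 hK hT q1.
  exists (- (c * kernel0_mass s K)).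
  have h : \forall x \ae mu, S f x = c * cst (- kernel0_mass s K) x + S g x.
    apply: (modified_limit_lin n0 hK (ltW q1) (ltW q1) (ltW q1) (admissible_measurable a1)
      (admissible_measurable ag) (admissible_measurable af) _ l1 (S_limit ag) (S_limit af)).
    move=> eta x eta0; rewrite -(modified_truncated_lin s n0 hK c x eta0 (ltW q1) a1 ag).
    have ml := admissible_measurable (admissible_lin (ltW q1) c a1 ag).
    apply: (modified_truncated_ae s n0 hK x _ (admissible_measurable af) ml eta0).
    by apply: filterS fg => y ->; rewrite /= mulr1 addrC.
  by apply: filterS h => x ->; rewrite /= mulrN addrC.
- move=> a f g Xf Xg; have af := B_space_admissible Xf; have ag := B_space_admissible Xg.
  have aL := admissible_lin (ltW q1) a af ag.
  exists 0.
  have h : \forall x \ae mu, S (fun x => a * f x + g x) x = a * S f x + S g x.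
    apply: (modified_limit_lin n0 hK (ltW q1) (ltW q1) (ltW q1) (admissible_measurable af)
      (admissible_measurable ag) (admissible_measurable aL) _ (S_limit af) (S_limit ag) (S_limit aL)).
    by move=> eta x eta0; exact: (modified_truncated_lin s n0 hK a x eta0 (ltW q1) af ag).
  by apply: filterS h => x ->; rewrite addr0.
- have [A [m [A0 hA]]] := modified_operator_dominated.
  have [Bd Bd0 hB] := Lu_norm_compare w0 Cw0 sigma0 hw m sigma_delta A0 rI u0.
  exists Bd => f Xf; have [NE dom] := hA f Xf.
  have NEf := B_space_cnormE Xf.
  have bound : (norm (S f) <= Bd%:E * norm f)%E.
    rewrite (B_normE NE) (B_normE NEf).
    by apply: hB => //; exact: cnorm_monotone.
  have lS := S_limit (B_space_admissible Xf).
  have mS := modified_limit_measurable lS.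
  split; last exact: bound.
  split; [exact: mS|move=> r r0|].
    split; first exact: measurable_funTS.
      by move=> x t t0 _; exact: (modified_limit_integrable n0 x (ltW q1) t0 lS).
    by rewrite NE// ltry.
  apply: (le_lt_trans bound); have [_ _ fin] := Xf.
  case: (norm f) fin => [L| |] // _; first by rewrite -EFinM ltry.
  by rewrite gt0_muleNy ?lte_fin.
- move=> q' f g q'1 Xf vg; have af := B_space_admissible Xf.
  have mf := admissible_measurable af.
  have lg := modified_value_limit n0 hK q'1 mf vg.
  exists 0; have := modified_limit_unique n0 hK (ltW q1) (ltW q'1) mf (S_limit af) lg.
  by apply: filterS => x ->; rewrite addr0.
- move=> q' lambda' f q'1 _ Xf [_ iff fin]; have af := B_space_admissible Xf.
  have mf := admissible_measurable af.
  have q'0 : 0 < q' by apply: lt_trans q'1.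
  have cn0 : (0 <= campanato_norm s q' lambda' setT f)%E.
    apply: (le_trans (campanato_norm_ge0 s q' lambda' f ltr01)).
    exact: campanato_norm_subset.
  pose M := fine (campanato_norm s q' lambda' setT f).
  have ME : (campanato_norm s q' lambda' setT f <= M%:E)%E by rewrite fineK// ge0_fin_numE.
  have af' : admissible kappa q' f.
    split => // [x r r0|x r r0]; last exact: admissible_far af _ _ r0.
    have osc := campanato_norm_cell r0 (@subsetT _ (cell s x r)) ME.
    exact: (Lq_ball_oscillation n0 (ltW q'1) r0 mf osc).
  have [g lg] := modified_limit_exists s n0 hK hT q'1 af'.
  by exists g; exact: (modified_limit_value n0 hK q'1 af' lg).
Qed.

End extension.

(** * The kernel and the weight of the theorem *)

Lemma singular_integral_standard (R : realType) n (kappa : R) K T : 0 < kappa ->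
  singular_integral kappa K T -> exists C, @standard_kernel R n kappa C K.
Proof.
move=> k0 [[C [hs hr]] _ _ _]; exists (Num.max C 0).
have CC : C <= Num.max C 0 by rewrite le_max lexx.
split => //; first by rewrite le_max lexx orbT.
  move=> x y xy; apply: (le_trans (hs x y xy)).
  by rewrite ler_wpM2r// invr_ge0 exprn_ge0// enorm_ge0.
move=> x y z xyz; apply: (le_trans (hr x y z xyz)).
by rewrite ler_wpM2r ?powR_ge0// ler_wpM2r// invr_ge0 exprn_ge0// enorm_ge0.
Qed.

(** Contracting the argument of [Theta] costs a constant; the power of [t] comes
    from the other factor of [w]. *)
Lemma Theta_star_weight (R : realType) (Theta w : R -> R) (sigma tau : R) :
  Theta_star Theta -> 0 < sigma -> 0 < tau ->
  (forall r, 0 < r -> w r = r `^ (- sigma) * Theta (r `^ tau)) ->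
  (forall r, 0 < r -> 0 < w r) /\ exists2 C, 0 < C &
    forall r t, 0 < r -> 1 <= t -> w r <= C * t `^ sigma * w (t * r).
Proof.
move=> [Th0 [C [e [e' [C0 /andP[e0 _] /andP[e'0 _] hC]]]]] s0 t0 hw; split.
  by move=> r r0; rewrite hw// mulr_gt0 ?powR_gt0// Th0// powR_gt0.
exists C => // r t r0 t1; have tp : 0 < t by exact: lt_le_trans t1.
have tr0 : 0 < t * r by rewrite mulr_gt0.
rewrite !hw// powRM ?(ltW tp) ?(ltW r0)//.
have Tr0 : 0 < Theta ((t * r) `^ tau) by rewrite Th0// powR_gt0.
have tt0 : 0 < t `^ (- tau) by rewrite powR_gt0.
have le1 a : 0 < a -> (t `^ (- tau)) `^ a <= 1.
  move=> a0; rewrite -powRrM mulNr powRN invf_le1 ?powR_gt0// -(powRr0 t).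
  by rewrite ler_powR// mulr_ge0// ltW.
have key : Theta (r `^ tau) <= C * Theta ((t * r) `^ tau).
  have := hC ((t * r) `^ tau) (t `^ (- tau)) (powR_gt0 _ tr0) tt0.
  rewrite ler_pdivrMr// [X in Theta X](_ : _ = r `^ tau); last first.
    rewrite powRM ?(ltW tp) ?(ltW r0)// mulrA powRN mulVf ?mul1r//.
    by rewrite gt_eqF// powR_gt0.
  move/le_trans; apply; rewrite ler_pM2r// ler_piMr ?(ltW C0)//.
  by rewrite ge_max !le1.
have -> : C * t `^ sigma * (t `^ (- sigma) * r `^ (- sigma) * Theta ((t * r) `^ tau)) =
  r `^ (- sigma) * (C * Theta ((t * r) `^ tau)).
  by rewrite !powRN; field; rewrite !gt_eqF// powR_gt0.
by rewrite ler_wpM2l// powR_ge0.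
Qed.


Theorem theorem5p11 (R : realType) (n : nat) (s : cell_shape)
    (kappa : R) (K : 'rV[R]_n -> 'rV[R]_n -> R)
    (T : ('rV[R]_n -> R) -> 'rV[R]_n -> R)
    (p sigma tau : R) (u : \bar R) (Theta w : R -> R) :
  (0 < n)%N ->
  0 < kappa <= 1 ->
  singular_integral kappa K T ->
  1 < p ->
  (0 < u)%E ->
  Theta_star Theta ->
  0 < sigma -> 0 < tau -> tau < sigma ->
  (forall r, 0 < r -> w r = r `^ (- sigma) * Theta (r `^ tau)) ->
  (- n%:R / p + sigma < kappa ->
   forall lambda : R, - n%:R / p <= lambda < kappa - sigma ->
     modified_extends_boundedly s K
       (B_space `[1, +oo[ s p lambda w u) (B_norm `[1, +oo[ s p lambda w u) /\
     modified_extends_boundedly s K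
       (B_space `]0, +oo[ s p lambda w u) (B_norm `]0, +oo[ s p lambda w u)) /\
  (sigma < kappa ->
   forall lambda : R, 0 <= lambda < kappa - sigma ->
     modified_extends_boundedly s K
       (B_space `[1, +oo[ s 1 lambda w u) (B_norm `[1, +oo[ s 1 lambda w u) /\
     modified_extends_boundedly s K
       (B_space `]0, +oo[ s 1 lambda w u) (B_norm `]0, +oo[ s 1 lambda w u)).
Proof.
move=> n0 /andP[k0 _] hT p1 u0 hTh s0 t0 _ hw.
have [C hK] := singular_integral_standard k0 hT.
have [w0 [Cw Cw0 hCw]] := Theta_star_weight hTh s0 t0 hw.
have ray1 := @right_ray_closed R 1 ltr01; have ray0 := @right_ray_open R.
(* [delta] is the midpoint of [sigma] and [kappa - lambda]. *)
have exponent lambda : lambda < kappa - sigma ->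
    sigma < (sigma + kappa - lambda) / 2 /\ lambda + (sigma + kappa - lambda) / 2 < kappa.
  by move=> h; split; lra.
split=> [_ lambda /andP[_ lk]|_ lambda /andP[l0 lk]]; have [sd ld] := exponent lambda lk.
  have pq : exists A m, 0 <= A /\ forall f r M, 0 < r -> 0 <= M ->
      (forall r, 0 < r -> (@lebesgue_rV R n).-integrable (cell s 0 r) (EFin \o f)) ->
      (campanato_norm s p lambda (cell s 0 (2 ^+ m * r)) f <= M%:E)%E ->
      (campanato_norm s p lambda (cell s 0 r) f <= (A * M)%:E)%E.
    by exists 1, 0; split => // f r M _ _ _; rewrite expr0 !mul1r.
  by split; apply: (modified_extension n0 hK hT _ u0 Cw0 s0 w0 hCw p1 sd ld pq).
have pq := campanato_norm2_le s n0 l0.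
have qp (U : set 'rV[R]_n) f := @campanato_norm1_le R n s n0 2 lambda U f (ler1n R 2).
by split; apply: (modified_extension n0 hK hT _ u0 Cw0 s0 w0 hCw (ltr1n R 2) sd ld pq qp).
Qed.
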